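(* Let $A$ be a dg algebra over $k$ and let $e\in H_0(A)$ be an idempotent. Then the full subcategory of the derived category $\mathrm{Ho}(A\text{-}\mathsf{Mod})$ of $A$ consisting of the $(1-e)$-torsion modules is equivalent to the derived category $\mathrm{Ho}(eAe\text{-}\mathsf{Mod})$ of $eAe$.
   Context: $k$ is a fixed unital commutative ring. A dg algebra is a unital associative differential $\mathbb{Z}$-graded (homologically graded) $k$-algebra; $A$-modules are dg left $A$-modules and $\mathrm{Ho}(A\text{-}\mathsf{Mod})$ is the homotopy category with respect to quasi-isomorphisms. For $s\in H(A)$, an $A$-module $N$ is $s$-local if $H(N)\to H(N)$, $n\mapsto sn$, is an isomorphism; an $A$-module $M$ is $s$-torsion if $\mathbb{R}\mathrm{Hom}_A(M,N)=0$ (i.e. is acyclic) for every $s$-local $A$-module $N$. Definition of $eAe$: given an idempotent $e\in H_0(A)$, there is a dg algebra $A'$ quasi-isomorphic to $A$ in which $e$ is represented by a strictly idempotent $0$-cycle, still denoted $e$. Then $eAe$ denotes the dg algebra $eA'e=\{eae: a\in A'\}\cong\mathrm{Hom}_{A'}(A'e,A'e)$ (with unit $e$); it is well-defined up to quasi-isomorphism. *)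

(* Defs.v *)
From HB Require Import structures.
From mathcomp Require Import all_boot all_order all_algebra.

Set Implicit Arguments.
Unset Strict Implicit.
Unset Printing Implicit Defensive.

Import GRing.Theory.
Local Open Scope ring_scope.

(** * Categories

    Hom-sets are setoids: [heq] is the equality of morphisms. *)

Record category := Category {
  obj :> Type;
  hom : obj -> obj -> Type;
  heq : forall {x y : obj}, hom x y -> hom x y -> Prop;
  idm : forall x : obj, hom x x;
  compm : forall {x y z : obj}, hom y z -> hom x y -> hom x z;
  heq_refl : forall (x y : obj) (f : hom x y), heq f f;
  heq_sym : forall (x y : obj) (f g : hom x y), heq f g -> heq g f;
  heq_trans : forall (x y : obj) (f g h : hom x y),
    heq f g -> heq g h -> heq f h;
  compm_heq : forall (x y z : obj) (g g' : hom y z) (f f' : hom x y),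
    heq g g' -> heq f f' -> heq (compm g f) (compm g' f');
  compm_idl : forall (x y : obj) (f : hom x y), heq (compm (idm y) f) f;
  compm_idr : forall (x y : obj) (f : hom x y), heq (compm f (idm x)) f;
  compmA : forall (w x y z : obj) (h : hom y z) (g : hom x y) (f : hom w x),
    heq (compm h (compm g f)) (compm (compm h g) f)
}.

Notation "f =h g" := (heq f g) (at level 70, no associativity).
Notation "g \oc f" := (compm g f) (at level 50, left associativity).

Record functor (C D : category) := Functor {
  fobj :> C -> D;
  fhom : forall {x y : C}, hom x y -> hom (fobj x) (fobj y);
  fhom_heq : forall (x y : C) (f g : hom x y), f =h g -> fhom f =h fhom g;
  fhom_id : forall x : C, fhom (idm x) =h idm (fobj x);
  fhom_comp : forall (x y z : C) (g : hom y z) (f : hom x y),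
    fhom (g \oc f) =h fhom g \oc fhom f
}.

Program Definition functor_id (C : category) : functor C C :=
  {| fobj := fun x => x; fhom := fun x y f => f |}.
Next Obligation. by []. Qed.
Next Obligation. by move=> C x; exact: heq_refl. Qed.
Next Obligation. by move=> C x y z g f; exact: heq_refl. Qed.

Program Definition functor_comp (C D E : category)
    (G : functor D E) (F : functor C D) : functor C E :=
  {| fobj := fun x => G (F x); fhom := fun x y f => fhom G (fhom F f) |}.
Next Obligation. by move=> C D E G F x y f g fg; do 2!apply: fhom_heq. Qed.
Next Obligation.
move=> C D E G F x.
exact: heq_trans (fhom_heq G (fhom_id F x)) (fhom_id G (F x)).
Qed.
Next Obligation.
move=> C D E G F x y z g f.
exact: heq_trans (fhom_heq G (fhom_comp F g f)) (fhom_comp G _ _).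
Qed.

Definition is_iso (C : category) (x y : C) (f : hom x y) : Prop :=
  exists g : hom y x, g \oc f =h idm x /\ f \oc g =h idm y.

Definition nat_isomorphic (C D : category) (F G : functor C D) : Prop :=
  exists t : forall x : C, hom (F x) (G x),
    (forall x, is_iso (t x)) /\
    (forall (x y : C) (f : hom x y), t y \oc fhom F f =h fhom G f \oc t x).

Definition equivalent (C D : category) : Prop :=
  exists (F : functor C D) (G : functor D C),
    nat_isomorphic (functor_comp G F) (functor_id C) /\
    nat_isomorphic (functor_comp F G) (functor_id D).

Program Definition full_subcategory (C : category) (P : C -> Prop) :
    category :=
  {| obj := {x : C | P x};
     hom := fun x y => hom (sval x) (sval y);
     heq := fun x y f g => f =h g;
     idm := fun x => idm (sval x);
     compm := fun x y z g f => g \oc f |}.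
Next Obligation. by move=> C P x y f; exact: heq_refl. Qed.
Next Obligation. by move=> C P x y f g; exact: heq_sym. Qed.
Next Obligation. by move=> C P x y f g h; exact: heq_trans. Qed.
Next Obligation. by move=> C P x y z g g' f f'; exact: compm_heq. Qed.
Next Obligation. by move=> C P x y f; exact: compm_idl. Qed.
Next Obligation. by move=> C P x y f; exact: compm_idr. Qed.
Next Obligation. by move=> C P w x y z h g f; exact: compmA. Qed.

(** The Gabriel-Zisman localization [C[W^-1]]: formal composites of morphisms
    of [C] and of formal inverses of members of [W], modulo the least
    congruence making [C -> C[W^-1]] a functor and inverting [W]. *)

Section Localization.

Variables (C : category) (W : forall x y : C, hom x y -> Prop).

Inductive zigzag : C -> C -> Type :=
| zz_id (x : C) : zigzag x x
| zz_comp (x y z : C) : zigzag y z -> zigzag x y -> zigzag x z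
| zz_mor (x y : C) : hom x y -> zigzag x y
| zz_inv (x y : C) (w : hom x y) : W w -> zigzag y x.

Inductive zz_eq : forall x y : C, zigzag x y -> zigzag x y -> Prop :=
| zz_refl x y (f : zigzag x y) : zz_eq f f
| zz_sym x y (f g : zigzag x y) : zz_eq f g -> zz_eq g f
| zz_trans x y (f g h : zigzag x y) : zz_eq f g -> zz_eq g h -> zz_eq f h
| zz_congr x y z (g g' : zigzag y z) (f f' : zigzag x y) :
    zz_eq g g' -> zz_eq f f' -> zz_eq (zz_comp g f) (zz_comp g' f')
| zz_idl x y (f : zigzag x y) : zz_eq (zz_comp (zz_id y) f) f
| zz_idr x y (f : zigzag x y) : zz_eq (zz_comp f (zz_id x)) f
| zz_assoc w x y z (h : zigzag y z) (g : zigzag x y) (f : zigzag w x) :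
    zz_eq (zz_comp h (zz_comp g f)) (zz_comp (zz_comp h g) f)
| zz_mor_heq x y (f g : hom x y) : f =h g -> zz_eq (zz_mor f) (zz_mor g)
| zz_mor_id x : zz_eq (zz_mor (idm x)) (zz_id x)
| zz_mor_comp x y z (g : hom y z) (f : hom x y) :
    zz_eq (zz_mor (g \oc f)) (zz_comp (zz_mor g) (zz_mor f))
| zz_invl x y (w : hom x y) (Ww : W w) :
    zz_eq (zz_comp (zz_inv Ww) (zz_mor w)) (zz_id x)
| zz_invr x y (w : hom x y) (Ww : W w) :
    zz_eq (zz_comp (zz_mor w) (zz_inv Ww)) (zz_id y).

Definition localization : category :=
  {| obj := C; hom := zigzag; heq := zz_eq; idm := zz_id; compm := zz_comp;
     heq_refl := zz_refl; heq_sym := zz_sym; heq_trans := zz_trans;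
     compm_heq := zz_congr; compm_idl := zz_idl; compm_idr := zz_idr;
     compmA := zz_assoc |}.

End Localization.

(** * Complexes

    Indices are carried with proofs of the equations relating them (here
    [m = n + 1]; later [i + j = n]) so that no transport is ever needed.
    Since [int] has decidable equality these proofs are irrelevant. *)

Record dgcomplex (k : comPzRingType) := DGComplex {
  cx :> int -> lmodType k;
  diff : forall {m n : int}, m = n + 1 -> cx m -> cx n;
  diff_linear : forall (m n : int) (p : m = n + 1), linear (diff p);
  diff_diff : forall (l m n : int) (p : l = m + 1) (q : m = n + 1) (x : cx l),
    diff q (diff p x) = 0
}.

(* [(-1)^i x] *)
Definition ksign (k : comPzRingType) (V : lmodType k) (i : int) (x : V) : V :=
  (-1) ^+ `|i|%N *: x.

Section Homology.

Variable k : comPzRingType.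
Implicit Types C D : dgcomplex k.

Definition is_cycle C (n : int) (x : C n) : Prop :=
  forall (m : int) (p : n = m + 1), diff p x = 0.

Definition is_boundary C (n : int) (x : C n) : Prop :=
  exists (m : int) (p : m = n + 1) (y : C m), diff p y = x.

Definition homologous C (n : int) (x y : C n) : Prop := is_boundary (x - y).

Definition acyclic C : Prop :=
  forall (n : int) (x : C n), is_cycle x -> is_boundary x.

(* For an additive [g] preserving cycles and boundaries: the induced map
   [H_i(C) -> H_j(D)] is bijective. *)
Definition homology_bijective C D (i j : int) (g : C i -> D j) : Prop :=
  (forall x : C i, is_cycle x -> is_boundary (g x) -> is_boundary x) /\
  (forall y : D j, is_cycle y -> exists2 x : C i, is_cycle x & homologous (g x) y).

End Homology.

(** * Differential graded algebras and left modules *)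

Record dgalgebra (k : comPzRingType) := DGAlgebra {
  dga_cx :> dgcomplex k;
  dmul : forall {i j n : int}, i + j = n -> dga_cx i -> dga_cx j -> dga_cx n;
  done1 : dga_cx 0;
  dmul_linearl : forall (i j n : int) (p : i + j = n) (b : dga_cx j),
    linear (fun a : dga_cx i => dmul p a b);
  dmul_linearr : forall (i j n : int) (p : i + j = n) (a : dga_cx i),
    linear (dmul p a);
  dmulA : forall (i j l ij jl n : int) (p : i + j = ij) (q : ij + l = n)
      (r : j + l = jl) (s : i + jl = n)
      (a : dga_cx i) (b : dga_cx j) (c : dga_cx l),
    dmul q (dmul p a b) c = dmul s a (dmul r b c);
  dmul1l : forall (n : int) (p : 0 + n = n) (a : dga_cx n), dmul p done1 a = a;
  dmul1r : forall (n : int) (p : n + 0 = n) (a : dga_cx n), dmul p a done1 = a;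
  dmul_leibniz : forall (i j n i' j' n' : int)
      (p : i + j = n) (pl : i' + j = n') (pr : i + j' = n')
      (qi : i = i' + 1) (qj : j = j' + 1) (qn : n = n' + 1)
      (a : dga_cx i) (b : dga_cx j),
    diff qn (dmul p a b) =
      dmul pl (diff qi a) b + ksign i (dmul pr a (diff qj b))
}.

Record dga_morphism (k : comPzRingType) (A B : dgalgebra k) := DGAMorphism {
  dgaf :> forall n : int, A n -> B n;
  dgaf_linear : forall n : int, linear (@dgaf n);
  dgaf_diff : forall (m n : int) (p : m = n + 1) (a : A m),
    dgaf (diff p a) = diff p (dgaf a);
  dgaf_one : dgaf (done1 A) = done1 B;
  dgaf_mul : forall (i j n : int) (p : i + j = n) (a : A i) (b : A j),
    dgaf (dmul p a b) = dmul p (dgaf a) (dgaf b)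
}.

Definition dga_quasi_iso (k : comPzRingType) (A B : dgalgebra k)
    (f : dga_morphism A B) : Prop :=
  forall n : int, homology_bijective (@dgaf _ _ _ f n).

(* [A] and [B] are connected by a zigzag of quasi-isomorphisms of dg algebras
   under which the classes [[a]] in [H_0(A)] and [[b]] in [H_0(B)] correspond. *)
Inductive dga_quasi_isomorphic (k : comPzRingType) :
    forall A B : dgalgebra k, A 0 -> B 0 -> Prop :=
| dga_qis_map (A B : dgalgebra k) (f : dga_morphism A B) (a : A 0) (b : B 0) :
    dga_quasi_iso f -> is_cycle a -> is_cycle b -> homologous (f 0 a) b ->
    dga_quasi_isomorphic a b
| dga_qis_sym (A B : dgalgebra k) (a : A 0) (b : B 0) :
    dga_quasi_isomorphic a b -> dga_quasi_isomorphic b a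
| dga_qis_trans (A B C : dgalgebra k) (a : A 0) (b : B 0) (c : C 0) :
    dga_quasi_isomorphic a b -> dga_quasi_isomorphic b c ->
    dga_quasi_isomorphic a c.

Record dgmodule (k : comPzRingType) (A : dgalgebra k) := DGModule {
  dgm_cx :> dgcomplex k;
  act : forall {i j n : int}, i + j = n -> A i -> dgm_cx j -> dgm_cx n;
  act_linearl : forall (i j n : int) (p : i + j = n) (x : dgm_cx j),
    linear (fun a : A i => act p a x);
  act_linearr : forall (i j n : int) (p : i + j = n) (a : A i),
    linear (act p a);
  actA : forall (i j l ij jl n : int) (p : i + j = ij) (q : ij + l = n)
      (r : j + l = jl) (s : i + jl = n) (a : A i) (b : A j) (x : dgm_cx l),
    act q (dmul p a b) x = act s a (act r b x);
  act1 : forall (n : int) (p : 0 + n = n) (x : dgm_cx n),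
    act p (done1 A) x = x;
  act_leibniz : forall (i j n i' j' n' : int)
      (p : i + j = n) (pl : i' + j = n') (pr : i + j' = n')
      (qi : i = i' + 1) (qj : j = j' + 1) (qn : n = n' + 1)
      (a : A i) (x : dgm_cx j),
    diff qn (act p a x) =
      act pl (diff qi a) x + ksign i (act pr a (diff qj x))
}.

Record dgm_morphism (k : comPzRingType) (A : dgalgebra k)
    (M N : dgmodule A) := DGMMorphism {
  dgmf :> forall n : int, M n -> N n;
  dgmf_linear : forall n : int, linear (@dgmf n);
  dgmf_diff : forall (m n : int) (p : m = n + 1) (x : M m),
    dgmf (diff p x) = diff p (dgmf x);
  dgmf_act : forall (i j n : int) (p : i + j = n) (a : A i) (x : M j),
    dgmf (act p a x) = act p a (dgmf x)
}.

Definition dgm_quasi_iso (k : comPzRingType) (A : dgalgebra k)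
    (M N : dgmodule A) (f : dgm_morphism M N) : Prop :=
  forall n : int, homology_bijective (@dgmf _ _ _ _ f n).

(** * The derived category *)

Section DerivedCategory.

Variables (k : comPzRingType) (A : dgalgebra k).

Program Definition dgm_id (M : dgmodule A) : dgm_morphism M M :=
  {| dgmf := fun n x => x |}.
Next Obligation. by []. Qed.
Next Obligation. by []. Qed.
Next Obligation. by []. Qed.

Program Definition dgm_comp (M N P : dgmodule A)
    (g : dgm_morphism N P) (f : dgm_morphism M N) : dgm_morphism M P :=
  {| dgmf := fun n x => g n (f n x) |}.
Next Obligation. by move=> M N P g f n c x y; rewrite !dgmf_linear. Qed.
Next Obligation. by move=> M N P g f m n p x /=; rewrite !dgmf_diff. Qed.
Next Obligation. by move=> M N P g f i j n p a x /=; rewrite !dgmf_act. Qed.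

Program Definition dgMod : category :=
  {| obj := dgmodule A;
     hom := @dgm_morphism k A;
     heq := fun M N f g => forall (n : int) (x : M n), f n x = g n x;
     idm := dgm_id;
     compm := dgm_comp |}.
Next Obligation. by []. Qed.
Next Obligation. by move=> M N f g fg n x; rewrite fg. Qed.
Next Obligation. by move=> M N f g h fg gh n x; rewrite fg gh. Qed.
Next Obligation. by move=> M N P g g' f f' gg' ff' n x /=; rewrite ff' gg'. Qed.
Next Obligation. by []. Qed.
Next Obligation. by []. Qed.
Next Obligation. by []. Qed.

Definition Ho : category := @localization dgMod (@dgm_quasi_iso k A).

End DerivedCategory.

(** * Derived Hom *)

Section DerivedHom.

Variables (k : comPzRingType) (A : dgalgebra k).

(* The degree [n] part of the complex [Hom_A(M,N)]. *)
Record dghom (n : int) (M N : dgmodule A) := DGHom {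
  dghf :> forall i j : int, n + i = j -> M i -> N j;
  dghf_linear : forall (i j : int) (p : n + i = j), linear (dghf p);
  dghf_act : forall (i j l nj nl : int) (p : i + j = l)
      (q : n + l = nl) (r : n + j = nj) (s : i + nj = nl) (a : A i) (x : M j),
    dghf q (act p a x) = ksign (n * i) (act s a (dghf r x))
}.

(* [hom_diff_eq h f] says that the differential of [h] in [Hom_A(M,N)],
   [d \o h - (-1)^m h \o d], is [f]. *)
Definition hom_diff_eq (m n : int) (M N : dgmodule A)
    (h : dghom m M N) (f : forall i j : int, n + i = j -> M i -> N j) : Prop :=
  forall (i i' j j' : int) (p : m + i = j) (p' : m + i' = j')
      (qi : i = i' + 1) (qj : j = j' + 1) (r : n + i = j') (x : M i),
    diff qj (h i j p x) - ksign m (h i' j' p' (diff qi x)) = f i j' r x.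

Definition hom_acyclic (M N : dgmodule A) : Prop :=
  forall (l m n : int) (pm : m = l + 1) (pn : n = m + 1) (f : dghom m M N),
    @hom_diff_eq m l M N f (fun _ _ _ _ => 0) ->
    exists h : dghom n M N, @hom_diff_eq n m M N h f.

Definition K_projective (P : dgmodule A) : Prop :=
  forall N : dgmodule A, acyclic N -> hom_acyclic P N.

(* [RHom_A(M,N) = Hom_A(P,N)] for a K-projective resolution [P] of [M]; up to
   quasi-isomorphism it does not depend on the resolution. *)
Definition RHom_acyclic (M N : dgmodule A) : Prop :=
  exists (P : dgmodule A) (r : dgm_morphism P M),
    [/\ K_projective P, dgm_quasi_iso r & hom_acyclic P N].

(* [s] is a cycle representing a homogeneous class of [H(A)]. *)
Definition local (i : int) (s : A i) (N : dgmodule A) : Prop :=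
  forall (j n : int) (p : i + j = n),
    homology_bijective (fun x : N j => act p s x).

Definition torsion (i : int) (s : A i) (M : dgmodule A) : Prop :=
  forall N : dgmodule A, local s N -> RHom_acyclic M N.

End DerivedHom.

(** * The dg algebra [eAe] *)

Section Corner.

Variables (k : comPzRingType) (A : dgalgebra k) (e : A 0).

Definition sandwich (n : int) (x : A n) : A n :=
  dmul (addr0 n) (dmul (add0r n) e x) e.

Lemma sandwich_linear (n : int) : linear (@sandwich n).
Proof. by move=> c x y; rewrite /sandwich dmul_linearr dmul_linearl. Qed.

(* For [e] a strict idempotent this is [{e a e | a in A_n}]; see [cornerP]. *)
Definition corner_pred (n : int) : {pred A n} :=
  [pred x | sandwich x == x].

Lemma corner_submod_closed (n : int) : submod_closed (@corner_pred n).
Proof.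
have s0 : sandwich (0 : A n) = 0.
  have := sandwich_linear (-1) (0 : A n) 0.
  by rewrite scaler0 addr0 scaleN1r addNr.
split; first by rewrite inE s0.
by move=> c x y; rewrite !inE sandwich_linear => /eqP-> /eqP->.
Qed.

HB.instance Definition _ (n : int) :=
  GRing.isSubmodClosed.Build k (A n) (@corner_pred n)
    (@corner_submod_closed n).

Record corner_sort (n : int) := Corner {
  corner_val :> A n;
  corner_valP : corner_val \in @corner_pred n
}.

HB.instance Definition _ (n : int) := [isSub for @corner_val n].
HB.instance Definition _ (n : int) := [Choice of corner_sort n by <:].
HB.instance Definition _ (n : int) :=
  [SubChoice_isSubZmodule of corner_sort n by <:].
HB.instance Definition _ (n : int) :=
  [SubZmodule_isSubLmodule of corner_sort n by <:].

Hypothesis e_cycle : is_cycle e.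
Hypothesis e_idem : dmul (addr0 0) e e = e.

Lemma dmul_idem (p : 0 + 0 = 0 :> int) : dmul p e e = e.
Proof. by rewrite (eq_irrelevance p (addr0 0)). Qed.

Lemma sandwichE (n : int) (p q : 0 + n = n) (r s : n + 0 = n) (x : A n) :
  dmul r (dmul p e x) e = dmul q e (dmul s x e).
Proof. exact: dmulA. Qed.

Lemma sandwich_fixl (n : int) (p : 0 + n = n) (x : A n) :
  dmul p e (sandwich x) = sandwich x.
Proof.
rewrite /sandwich (sandwichE _ p _ (addr0 n)).
by rewrite -(dmulA (addr0 0) p) dmul_idem.
Qed.

Lemma sandwich_fixr (n : int) (p : n + 0 = n) (x : A n) :
  dmul p (sandwich x) e = sandwich x.
Proof. by rewrite /sandwich (dmulA _ _ (addr0 0) (addr0 n)) dmul_idem. Qed.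

Lemma cornerP (n : int) (x : A n) :
  reflect (exists a : A n, x = sandwich a) (x \in @corner_pred n).
Proof.
rewrite inE; apply: (iffP eqP) => [xE|[a ->]]; first by exists x.
by rewrite {1}/sandwich sandwich_fixl sandwich_fixr.
Qed.

Lemma corner_fixl (n : int) (p : 0 + n = n) (x : corner_sort n) :
  dmul p e (corner_val x) = corner_val x.
Proof. by have /cornerP[a ->] := corner_valP x; exact: sandwich_fixl. Qed.

Lemma corner_fixr (n : int) (p : n + 0 = n) (x : corner_sort n) :
  dmul p (corner_val x) e = corner_val x.
Proof. by have /cornerP[a ->] := corner_valP x; exact: sandwich_fixr. Qed.

Lemma corner_in (n : int) (p : 0 + n = n) (q : n + 0 = n) (x : A n) :
  dmul p e x = x -> dmul q x e = x -> x \in @corner_pred n.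
Proof.
move=> px qx; rewrite inE /sandwich.
by rewrite (eq_irrelevance (add0r n) p) (eq_irrelevance (addr0 n) q) px qx.
Qed.

Lemma dmul0r (i j n : int) (p : i + j = n) (a : A i) : dmul p a 0 = 0.
Proof.
have := dmul_linearr p a (-1) 0 0.
by rewrite scaler0 addr0 scaleN1r addNr.
Qed.

Lemma dmul0l (i j n : int) (p : i + j = n) (b : A j) : dmul p 0 b = 0.
Proof.
have := dmul_linearl p b (-1) 0 0.
by rewrite scaler0 addr0 scaleN1r addNr.
Qed.

Lemma corner_diff_in (m n : int) (p : m = n + 1) (x : corner_sort m) :
  diff p (corner_val x) \in @corner_pred n.
Proof.
have q : 0 = -1 + 1 :> int by [].
apply: (@corner_in _ (add0r n) (addr0 n)).
- have pl : -1 + m = n by rewrite p addrCA addNr addr0.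
  have := dmul_leibniz (add0r m) pl (add0r n) q p p e (corner_val x).
  by rewrite corner_fixl e_cycle dmul0l add0r /ksign expr0 scale1r.
- have pr : m + -1 = n by rewrite p addrK.
  have := dmul_leibniz (addr0 m) (addr0 n) pr p q p (corner_val x) e.
  by rewrite corner_fixr e_cycle dmul0r /ksign scaler0 addr0.
Qed.

Lemma corner_mul_in (i j n : int) (p : i + j = n)
    (x : corner_sort i) (y : corner_sort j) :
  dmul p (corner_val x) (corner_val y) \in @corner_pred n.
Proof.
apply: (@corner_in _ (add0r n) (addr0 n)).
- by rewrite -(dmulA (add0r i) p p (add0r n)) corner_fixl.
- by rewrite (dmulA p (addr0 n) (addr0 j) p) corner_fixr.
Qed.

Lemma corner_one_in : e \in @corner_pred 0.
Proof. exact: corner_in (dmul_idem (add0r 0)) (dmul_idem (addr0 0)). Qed.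

Program Definition corner_cx : dgcomplex k :=
  {| cx := fun n => corner_sort n : lmodType k;
     diff := fun m n p x => Corner (corner_diff_in p x) |}.
Next Obligation.
by move=> m n p c x y; apply: val_inj; rewrite /= diff_linear.
Qed.
Next Obligation. by move=> l m n p q x; apply: val_inj; exact: diff_diff. Qed.

Program Definition corner : dgalgebra k :=
  {| dga_cx := corner_cx;
     dmul := fun i j n p x y => Corner (corner_mul_in p x y);
     done1 := Corner corner_one_in |}.
Next Obligation.
by move=> i j n p b c x y; apply: val_inj; exact: dmul_linearl.
Qed.
Next Obligation.
by move=> i j n p a c x y; apply: val_inj; exact: dmul_linearr.
Qed.
Next Obligation.
by move=> i j l ij jl n p q r s a b c; apply: val_inj; exact: dmulA.
Qed.
Next Obligation. by move=> n p a; apply: val_inj; exact: corner_fixl. Qed.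
Next Obligation. by move=> n p a; apply: val_inj; exact: corner_fixr. Qed.
Next Obligation.
move=> i j n i' j' n' p pl pr qi qj qn a b; apply: val_inj.
exact: dmul_leibniz.
Qed.

End Corner.

(* A dg algebra quasi-isomorphic to [A] in which the class of [e] is
   represented by a strictly idempotent is_cycle. *)
Record strict_model (k : comPzRingType) (A : dgalgebra k) (e : A 0) :=
  StrictModel {
  sm_alg : dgalgebra k;
  sm_e : sm_alg 0;
  sm_cycle : is_cycle sm_e;
  sm_idem : dmul (addr0 0) sm_e sm_e = sm_e;
  sm_qis : dga_quasi_isomorphic e sm_e
}.

(* [eAe], computed from a strict model. *)
Definition eAe (k : comPzRingType) (A : dgalgebra k) (e : A 0)
    (S : strict_model e) : dgalgebra k :=
  corner (sm_cycle S) (sm_idem S).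

(* Main.v *)
From HB Require Import structures.
From mathcomp Require Import all_boot all_order all_algebra.
From mathcomp Require Import generic_quotient boolp zify.
Require Import Defs.

Set Implicit Arguments.
Unset Strict Implicit.
Unset Printing Implicit Defensive.

Import GRing.Theory.
Local Open Scope ring_scope.
Local Open Scope quotient_scope.
Local Obligation Tactic := idtac.

(** Let [B] be a dg algebra with a strictly idempotent cycle [e].  Restriction
    along [eBe -> B] is the exact functor [M |-> eM]; its derived left adjoint
    is [N |-> Be (x) QN], the tensor product being over [eBe] and [QN] being a
    semifree resolution of [N].  Four facts make this adjunction an equivalence
    onto the [(1-e)]-torsion modules.

    - The unit [QN -> e(Be (x) QN)] is a quasi-isomorphism ([unit_mor_qis]), so
      that the left adjoint is fully faithful.
    - [Hom(Be (x) QN, Y) = Hom(QN, eY)] is acyclic as soon as [eY] is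
      ([semifree_hom_acyclic]).
    - As [e] is idempotent, [1-e] acts bijectively on [H(Y)] precisely when [e]
      acts by zero, that is when [eY] is acyclic ([unit_acyclic_local],
      [local_unit_acyclic]).  Hence every [Be (x) QN] is torsion.
    - By a triangle identity the counit [Be (x) Q(eM) -> M] becomes invertible
      after applying [e], so its cone is [(1-e)]-local.  When [M] is torsion,
      neither [M] nor [Be (x) Q(eM)] has derived maps to that cone, and this
      forces the counit to be a quasi-isomorphism ([qis_of_hom_acyclic_cone]).

    The idempotent of [A] is strict only in a dg algebra [B] joined to [A] by a
    zigzag of quasi-isomorphisms, so torsion modules have to be transported
    along a quasi-isomorphism.  Both situations are instances of one: a map
    [phi : R -> B] that need not preserve units and induces a quasi-isomorphism
    from [R] to [eBe], where [e = phi 1].  The inclusion of [eBe] and a unital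
    quasi-isomorphism ([e = 1]) are the two extremes, and
    [restriction_equivalence] treats them together.  That torsion modules
    correspond in the second case follows from the adjunction
    ([hom_acyclic_adj]) and from the independence of derived Hom of the chosen
    resolution ([hom_acyclic_resolution]).

    Since [k] is an arbitrary commutative ring, tensor products are formed with
    semifree modules only, where [Be (x) Q] consists of formal sums of terms
    [b c] with [b] in [Be] and [c] a cell of [Q].  The resolution [QN] has cells
    [[x, y]] for [x] in [N] and [y] a cycle of [QN] mapping to [d x], one for
    each way of writing [y] as a formal sum; the boundary of [[x, y]] is [y].
    Thus [QN -> N] is a quasi-isomorphism by
    construction: a cycle [z] of [N] is the image of [[z, 0]], and a cycle [y]
    of [QN] with image [d x] is the boundary of [[x, y]].  Moreover [QN] depends
    functorially on [N], so the left adjoint exists before localization.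
    Freeness over the cells is used twice: a null-homotopy on [Q] is built by
    recursion on the rank of cells ([semifree_primitive]), and the unit is
    shown to be a quasi-isomorphism by removing cells one at a time
    ([unit_mor_relative_lift]). *)

(** * Linear maps, signs and complexes *)

Section LinearMaps.
Variables (k : comPzRingType) (U V : lmodType k) (f : U -> V).
Hypothesis lf : linear f.

Lemma linear_add x y : f (x + y) = f x + f y.
Proof. by have := lf 1 x y; rewrite !scale1r. Qed.
Lemma linear_zero : f 0 = 0.
Proof. by apply: (addrI (f 0)); rewrite -linear_add !addr0. Qed.
Lemma linear_scale c x : f (c *: x) = c *: f x.
Proof. by have := lf c x 0; rewrite linear_zero !addr0. Qed.
Lemma linear_opp x : f (- x) = - f x.
Proof. by rewrite -scaleN1r linear_scale scaleN1r. Qed.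
Lemma linear_sub x y : f (x - y) = f x - f y.
Proof. by rewrite linear_add linear_opp. Qed.
Lemma linear_bigsum I (r : seq I) (P : pred I) (F : I -> U) :
  f (\sum_(i <- r | P i) F i) = \sum_(i <- r | P i) f (F i).
Proof. exact: (big_morph f linear_add linear_zero). Qed.
Lemma linear_ksign i x : f (ksign i x) = ksign i (f x).
Proof. exact: linear_scale. Qed.
End LinearMaps.

Section Signs.
Variables (k : comPzRingType) (V : lmodType k).
Implicit Types (x : V) (i j : int).

(** Signs enter only through parities, which turns sign identities into case
    distinctions on booleans. *)
Definition oddz (i : int) : bool := odd `|i|%N.

Lemma ksignE i x : ksign i x = if oddz i then - x else x.
Proof. by rewrite /ksign -signr_odd scaler_sign. Qed.
Lemma oddzD i j : oddz (i + j) = oddz i (+) oddz j.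
Proof. rewrite /oddz; lia. Qed.
Lemma oddzN i : oddz (- i) = oddz i.
Proof. by rewrite /oddz abszN. Qed.
Lemma oddzM i j : oddz (i * j) = oddz i && oddz j.
Proof. by rewrite /oddz abszM oddM. Qed.
Lemma oddz_succ i j : i = j + 1 -> oddz i = ~~ oddz j.
Proof. by move=> ->; rewrite oddzD; case: (oddz j). Qed.
Lemma oddz_sum i j n : i + j = n -> oddz n = oddz i (+) oddz j.
Proof. by move=> <-; exact: oddzD. Qed.
Lemma ksign_sum i j n (x : V) : i + j = n -> ksign n x = ksign i (ksign j x).
Proof.
by move=> E; rewrite !ksignE (oddz_sum E); case: (oddz i); case: (oddz j); rewrite ?opprK.
Qed.
Lemma oddz1 : oddz 1. Proof. by []. Qed.

Lemma ksign_linear i : linear (@ksign k V i).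
Proof. by move=> c x y; rewrite /ksign scalerDr !scalerA mulrC. Qed.
Lemma ksignD i j x : ksign (i + j) x = ksign i (ksign j x).
Proof. by rewrite !ksignE oddzD; case: (oddz i); case: (oddz j); rewrite ?opprK. Qed.
Lemma ksignK i x : ksign i (ksign i x) = x.
Proof. by rewrite !ksignE; case: (oddz i); rewrite ?opprK. Qed.
Lemma ksign0 i : ksign i (0 : V) = 0.
Proof. exact: (linear_zero (ksign_linear i)). Qed.
Lemma ksign_add i x y : ksign i (x + y) = ksign i x + ksign i y.
Proof. exact: (linear_add (ksign_linear i)). Qed.
Lemma ksign_opp i x : ksign i (- x) = - ksign i x.
Proof. exact: (linear_opp (ksign_linear i)). Qed.
End Signs.

Section ComplexCalculus.
Variables (k : comPzRingType) (C : dgcomplex k).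

Lemma diff_irr m n (p q : m = n + 1) (x : C m) : diff p x = diff q x.
Proof. by rewrite (eq_irrelevance p q). Qed.
Lemma diffD m n (p : m = n + 1) (x y : C m) : diff p (x + y) = diff p x + diff p y.
Proof. exact: (linear_add (diff_linear p)). Qed.
Lemma diff0 m n (p : m = n + 1) : diff p (0 : C m) = 0.
Proof. exact: (linear_zero (diff_linear p)). Qed.
Lemma diffN m n (p : m = n + 1) (x : C m) : diff p (- x) = - diff p x.
Proof. exact: (linear_opp (diff_linear p)). Qed.
Lemma diffB m n (p : m = n + 1) (x y : C m) : diff p (x - y) = diff p x - diff p y.
Proof. exact: (linear_sub (diff_linear p)). Qed.
Lemma diff_ksign m n (p : m = n + 1) i (x : C m) :
  diff p (ksign i x) = ksign i (diff p x).
Proof. exact: (linear_ksign (diff_linear p)). Qed.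

Lemma cycle0 n : is_cycle (0 : C n).
Proof. by move=> m p; rewrite diff0. Qed.
Lemma cycleD n (x y : C n) : is_cycle x -> is_cycle y -> is_cycle (x + y).
Proof. by move=> zx zy m p; rewrite diffD zx zy addr0. Qed.
Lemma cycleN n (x : C n) : is_cycle x -> is_cycle (- x).
Proof. by move=> zx m p; rewrite diffN zx oppr0. Qed.
Lemma cycleB n (x y : C n) : is_cycle x -> is_cycle y -> is_cycle (x - y).
Proof. by move=> zx zy; apply: cycleD => //; exact: cycleN. Qed.
Lemma cycleI n m (p : n = m + 1) (x : C n) : diff p x = 0 -> is_cycle x.
Proof.
move=> dx m' p'; have E : m' = m by lia.
by subst m'; rewrite (diff_irr p' p).
Qed.

Lemma boundary0 n : is_boundary (0 : C n).
Proof. by exists (n + 1), erefl, 0; rewrite diff0. Qed.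
Lemma boundaryI n m (p : m = n + 1) (y : C m) : is_boundary (diff p y).
Proof. by exists m, p, y. Qed.
Lemma boundaryE n m (p : m = n + 1) (x : C n) :
  is_boundary x -> exists y : C m, diff p y = x.
Proof.
case=> m' [p' [y <-]]; have E : m' = m by lia.
by case: m / E p => p; exists y; rewrite (diff_irr p p').
Qed.
Lemma boundaryD n (x y : C n) : is_boundary x -> is_boundary y -> is_boundary (x + y).
Proof.
move=> /(boundaryE erefl)[x' <-] /(boundaryE erefl)[y' <-].
by rewrite -diffD; exact: boundaryI.
Qed.
Lemma boundaryN n (x : C n) : is_boundary x -> is_boundary (- x).
Proof. by move=> /(boundaryE erefl)[x' <-]; rewrite -diffN; exact: boundaryI. Qed.
Lemma boundary_cycle n (x : C n) : is_boundary x -> is_cycle x.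
Proof. by move=> /(boundaryE erefl)[y <-] m p; rewrite diff_diff. Qed.

Lemma homologous_refl n (x : C n) : homologous x x.
Proof. by rewrite /homologous subrr; exact: boundary0. Qed.
Lemma homologous_sym n (x y : C n) : homologous x y -> homologous y x.
Proof. by move=> /boundaryN; rewrite opprB. Qed.
Lemma homologous_trans n (x y z : C n) :
  homologous x y -> homologous y z -> homologous x z.
Proof. by move=> xy yz; have := boundaryD xy yz; rewrite addrA subrK. Qed.
Lemma homologous_boundary n (x y : C n) :
  homologous x y -> is_boundary x -> is_boundary y.
Proof. by move=> /homologous_sym xy bx; have := boundaryD xy bx; rewrite subrK. Qed.
End ComplexCalculus.

Section AlgebraCalculus.
Variables (k : comPzRingType) (A : dgalgebra k).

Lemma dmulBl i j n (p : i + j = n) (a b : A i) (c : A j) :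
  dmul p (a - b) c = dmul p a c - dmul p b c.
Proof. exact: (linear_sub (dmul_linearl p c)). Qed.
Lemma dmulBr i j n (p : i + j = n) (a : A i) (b c : A j) :
  dmul p a (b - c) = dmul p a b - dmul p a c.
Proof. exact: (linear_sub (dmul_linearr p a)). Qed.

(** [d 1 = d (1 * 1) = d 1 + d 1]. *)
Lemma one_cycle : is_cycle (done1 A).
Proof.
have q : 0 = -1 + 1 :> int by [].
apply: (cycleI (p := q)); set d1 := diff q (done1 A).
have := dmul_leibniz (addr0 0) (addr0 (-1)) (add0r (-1)) q q q (done1 A) (done1 A).
rewrite dmul1r -/d1 dmul1r dmul1l ksignE /= => /esym/eqP.
by rewrite -subr_eq0 addrK => /eqP.
Qed.
End AlgebraCalculus.

Section ModuleCalculus.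
Variables (k : comPzRingType) (A : dgalgebra k) (M : dgmodule A).

Lemma act_irr i j n (p q : i + j = n) (a : A i) (x : M j) : act p a x = act q a x.
Proof. by rewrite (eq_irrelevance p q). Qed.
Lemma actDr i j n (p : i + j = n) (a : A i) (x y : M j) :
  act p a (x + y) = act p a x + act p a y.
Proof. exact: (linear_add (act_linearr p a)). Qed.
Lemma actBl i j n (p : i + j = n) (a b : A i) (x : M j) :
  act p (a - b) x = act p a x - act p b x.
Proof. exact: (linear_sub (act_linearl p x)). Qed.
Lemma actBr i j n (p : i + j = n) (a : A i) (x y : M j) :
  act p a (x - y) = act p a x - act p a y.
Proof. exact: (linear_sub (act_linearr p a)). Qed.
Lemma act0l i j n (p : i + j = n) (x : M j) : act p (0 : A i) x = 0.
Proof. exact: (linear_zero (act_linearl p x)). Qed.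
Lemma act0r i j n (p : i + j = n) (a : A i) : act p a (0 : M j) = 0.
Proof. exact: (linear_zero (act_linearr p a)). Qed.
Lemma actNr i j n (p : i + j = n) (a : A i) (x : M j) : act p a (- x) = - act p a x.
Proof. exact: (linear_opp (act_linearr p a)). Qed.
Lemma act_ksign i j n (p : i + j = n) (a : A i) l (x : M j) :
  act p a (ksign l x) = ksign l (act p a x).
Proof. exact: (linear_ksign (act_linearr p a)). Qed.
Lemma act_ksignl i j n (p : i + j = n) (a : A i) l (x : M j) :
  act p (ksign l a) x = ksign l (act p a x).
Proof. exact: (linear_ksign (act_linearl p x)). Qed.

Lemma diff_act0 (e : A 0) (ze : is_cycle e) m n (p : 0 + m = m) (p' : 0 + n = n)
    (q : m = n + 1) (x : M m) :
  diff q (act p e x) = act p' e (diff q x).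
Proof.
have q0 : 0 = -1 + 1 :> int by [].
have pl : -1 + m = n by lia.
by rewrite (act_leibniz p pl p' q0 q q) ze act0l add0r ksignE.
Qed.
End ModuleCalculus.

Section MorphismCalculus.
Variables (k : comPzRingType) (A : dgalgebra k) (M N : dgmodule A).
Variable f : dgm_morphism M N.

Lemma mor0 n : f n (0 : M n) = 0.
Proof. exact: (linear_zero (dgmf_linear f (n := n))). Qed.
Lemma morB n (x y : M n) : f n (x - y) = f n x - f n y.
Proof. exact: (linear_sub (dgmf_linear f (n := n))). Qed.
Lemma morN n (x : M n) : f n (- x) = - f n x.
Proof. exact: (linear_opp (dgmf_linear f (n := n))). Qed.
Lemma mor_ksign n i (x : M n) : f n (ksign i x) = ksign i (f n x).
Proof. exact: (linear_ksign (dgmf_linear f (n := n))). Qed.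
Lemma mor_cycle n (x : M n) : is_cycle x -> is_cycle (f n x).
Proof. by move=> zx m p; rewrite -dgmf_diff zx mor0. Qed.
Lemma mor_boundary n (x : M n) : is_boundary x -> is_boundary (f n x).
Proof. by move=> /(boundaryE erefl)[y <-]; rewrite dgmf_diff; exact: boundaryI. Qed.
Lemma mor_homologous n (x y : M n) : homologous x y -> homologous (f n x) (f n y).
Proof. by move=> /mor_boundary; rewrite morB. Qed.
End MorphismCalculus.

(** * Equivalences of localized categories *)

Section Equivalences.

Lemma comp_hl (C : category) (x y z : C) (g g' : hom y z) (f : hom x y) :
  g =h g' -> g \oc f =h g' \oc f.
Proof. by move=> gg'; apply: compm_heq => //; exact: heq_refl. Qed.
Lemma comp_hr (C : category) (x y z : C) (g : hom y z) (f f' : hom x y) :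
  f =h f' -> g \oc f =h g \oc f'.
Proof. by move=> ff'; apply: compm_heq => //; exact: heq_refl. Qed.
Lemma compmAr (C : category) (w x y z : C) (h : hom y z) (g : hom x y) (f : hom w x) :
  (h \oc g) \oc f =h h \oc (g \oc f).
Proof. exact/heq_sym/compmA. Qed.

Lemma functor_iso (C D : category) (F : functor C D) (x y : C) (f : hom x y) :
  is_iso f -> is_iso (fhom F f).
Proof.
move=> [g [gf fg]]; exists (fhom F g); split.
- exact: heq_trans (heq_sym (fhom_comp F g f)) (heq_trans (fhom_heq F gf) (fhom_id F x)).
- exact: heq_trans (heq_sym (fhom_comp F f g)) (heq_trans (fhom_heq F fg) (fhom_id F y)).
Qed.

Lemma iso_comp (C : category) (x y z : C) (g : hom y z) (f : hom x y) :
  is_iso g -> is_iso f -> is_iso (g \oc f).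
Proof.
move=> [g' [g'g gg']] [f' [f'f ff']]; exists (f' \oc g'); split.
- apply: heq_trans (compmAr _ _ _) _; apply: heq_trans f'f; apply: comp_hr.
  apply: heq_trans (compmA _ _ _) _; apply: heq_trans (compm_idl f).
  exact: comp_hl.
- apply: heq_trans (compmAr _ _ _) _; apply: heq_trans gg'; apply: comp_hr.
  apply: heq_trans (compmA _ _ _) _; apply: heq_trans (compm_idl g').
  exact: comp_hl.
Qed.

Lemma equivalent_sym (C D : category) : equivalent C D -> equivalent D C.
Proof. by move=> [F [G [GF FG]]]; exists G, F. Qed.

(** The isomorphism [G G' F' F ~ G F ~ 1], used for both composites of a
    composite equivalence. *)
Lemma nat_isomorphic_conj (C D E : category) (F : functor C D) (G : functor D C)
    (F' : functor D E) (G' : functor E D) :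
  nat_isomorphic (functor_comp G F) (functor_id C) ->
  nat_isomorphic (functor_comp G' F') (functor_id D) ->
  nat_isomorphic (functor_comp (functor_comp G G') (functor_comp F' F)) (functor_id C).
Proof.
move=> [s [si sn]] [t [ti tn]].
exists (fun x : C => s x \oc fhom G (t (F x))); split=> [x|x y f].
  exact: (iso_comp (si x) (functor_iso G (ti (F x)))).
apply: heq_trans (compmAr _ _ _) _.
apply: heq_trans _ (compmAr _ _ _); apply: heq_trans _ (comp_hl _ (sn _ _ f)).
apply: heq_trans _ (compmA _ _ _); apply: comp_hr.
apply: heq_trans (heq_sym (fhom_comp G _ _)) _.
apply: heq_trans (fhom_heq G (tn _ _ (fhom F f))) _.
exact: fhom_comp.
Qed.

Lemma equivalent_trans (C D E : category) :
  equivalent C D -> equivalent D E -> equivalent C E.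
Proof.
move=> [F [G [GF FG]]] [F' [G' [GF' FG']]].
exists (functor_comp F' F), (functor_comp G G'); split.
- exact: nat_isomorphic_conj.
- exact: nat_isomorphic_conj.
Qed.

Program Definition full_inclusion (C : category) (P : C -> Prop) :
    functor (full_subcategory P) C :=
  {| fobj := fun x : full_subcategory P => sval x; fhom := fun x y f => f |}.
Next Obligation. by []. Qed.
Next Obligation. by move=> C P x; exact: heq_refl. Qed.
Next Obligation. by move=> C P x y z g f; exact: heq_refl. Qed.

Program Definition full_lift (C D : category) (F : functor C D) (P : D -> Prop)
    (FP : forall x, P (F x)) : functor C (full_subcategory P) :=
  {| fobj := fun x => exist P (F x) (FP x) : full_subcategory P;
     fhom := fun x y f => fhom F f |}.
Next Obligation. by move=> C D F P FP x y f g fg; exact: (fhom_heq F fg). Qed.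
Next Obligation. by move=> C D F P FP x; exact: (fhom_id F x). Qed.
Next Obligation. by move=> C D F P FP x y z g f; exact: (fhom_comp F g f). Qed.

Lemma id_iso (C : category) (x : C) : is_iso (idm x).
Proof. by exists (idm x); split; exact: compm_idl. Qed.

Lemma equivalent_full_True (C : category) (P : C -> Prop) :
  (forall x, P x) -> equivalent (full_subcategory P) C.
Proof.
move=> PT; exists (full_inclusion P), (full_lift (F := functor_id C) PT).
split.
- exists (fun x : full_subcategory P => idm (sval x)); split=> [x|x y f].
    by exists (idm (sval x)); split; exact: compm_idl.
  exact: heq_trans (compm_idl (c := C) _) (heq_sym (compm_idr (c := C) _)).
- exists (fun x : C => idm x); split=> [x|x y f]; first exact: id_iso.
  exact: heq_trans (compm_idl _) (heq_sym (compm_idr _)).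
Qed.
End Equivalences.

Section LocalizedFunctor.
Variables (C D : category) (W : forall x y : C, hom x y -> Prop)
  (W' : forall x y : D, hom x y -> Prop).
Variables (F : functor C D) (FW : forall (x y : C) (w : hom x y), W w -> W' (fhom F w)).

(** A functor that maps [W] into [W'] acts on formal zigzags letter by letter. *)
Fixpoint zz_map x y (f : zigzag W x y) : zigzag W' (F x) (F y) :=
  match f in zigzag _ x0 y0 return zigzag W' (F x0) (F y0) with
  | zz_id x => zz_id W' (F x)
  | zz_comp x y z g f => zz_comp (zz_map g) (zz_map f)
  | zz_mor x y f => zz_mor W' (fhom F f)
  | zz_inv x y w Ww => zz_inv (FW Ww)
  end.

Program Definition loc_functor : functor (localization W) (localization W') :=
  {| fobj := fun x : localization W => F x : localization W';
     fhom := fun x y f => zz_map f |}.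
Next Obligation.
move=> x y f g; elim=> {x y f g} /=.
- by move=> *; exact: zz_refl.
- by move=> *; exact: zz_sym.
- by move=> x y f g h _ fg _ gh; exact: zz_trans fg gh.
- by move=> *; exact: zz_congr.
- by move=> *; exact: zz_idl.
- by move=> *; exact: zz_idr.
- by move=> *; exact: zz_assoc.
- by move=> x y f g fg; apply: zz_mor_heq; exact: fhom_heq.
- by move=> x; apply: zz_trans (zz_mor_heq _ (fhom_id F x)) _; exact: zz_mor_id.
- move=> x y z g f; apply: zz_trans (zz_mor_heq _ (fhom_comp F g f)) _.
  exact: zz_mor_comp.
- by move=> *; exact: zz_invl.
- by move=> *; exact: zz_invr.
Qed.
Next Obligation. by move=> x; exact: zz_refl. Qed.
Next Obligation. by move=> x y z g f; exact: zz_refl. Qed.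
End LocalizedFunctor.

Section LocalizedNaturality.
Variables (C : category) (W : forall x y : C, hom x y -> Prop).
Notation L := (localization W).

Lemma zz_mor_iso (x y : C) (w : hom x y) : W w -> is_iso (zz_mor W w : @hom L x y).
Proof.
by move=> Ww; exists (zz_inv Ww); split; [exact: zz_invl|exact: zz_invr].
Qed.
Lemma zz_inv_iso (x y : C) (w : hom x y) (Ww : W w) : is_iso (zz_inv Ww : @hom L y x).
Proof. by exists (zz_mor W w); split; [exact: zz_invr|exact: zz_invl]. Qed.

(** The naturality squares compose, and the square of an inverted morphism is
    obtained by inverting the square of that morphism, so it is enough to have
    them for the morphisms of [C]. *)
Lemma loc_natural (F : functor L L) (t : forall x : C, @hom L (F x) x) :
  (forall (x y : C) (f : hom x y),
     t y \oc fhom F (zz_mor W f : @hom L x y) =h (zz_mor W f : @hom L x y) \oc t x) ->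
  forall (x y : C) (f : @hom L x y), t y \oc fhom F f =h f \oc t x.
Proof.
move=> tn x y f; elim: {x y} f => [x|x y z g IHg f IHf|//|x y w Ww].
- apply: heq_trans (comp_hr _ (fhom_id F x)) _.
  exact: heq_trans (compm_idr _) (heq_sym (compm_idl _)).
- apply: heq_trans (comp_hr _ (fhom_comp F _ _)) _.
  apply: heq_trans (compmA _ _ _) _; apply: heq_trans (comp_hl _ IHg) _.
  apply: heq_trans (compmAr _ _ _) _; apply: heq_trans (comp_hr _ IHf) _.
  exact: compmA.
- pose m : @hom L x y := zz_mor W w; pose i : @hom L y x := zz_inv Ww.
  have im : i \oc m =h idm (x : L) by exact: zz_invl.
  have mi : m \oc i =h idm (y : L) by exact: zz_invr.
  (* [t x \oc F i = i \oc m \oc t x \oc F i = i \oc t y \oc F m \oc F i] *)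
  apply: heq_trans (heq_sym (compm_idl _)) _.
  apply: heq_trans (comp_hl _ (heq_sym im)) _.
  apply: heq_trans (compmAr _ _ _) _; apply: comp_hr.
  apply: heq_trans (compmA _ _ _) _.
  apply: heq_trans (comp_hl _ (heq_sym (tn _ _ w))) _.
  apply: heq_trans (compmAr _ _ _) _.
  apply: heq_trans (comp_hr _ (heq_sym (fhom_comp F _ _))) _.
  apply: heq_trans (comp_hr _ (fhom_heq F mi)) _.
  exact: heq_trans (comp_hr _ (fhom_id F _)) (compm_idr _).
Qed.
End LocalizedNaturality.

(** The counit is inverted only over the objects of [P], and the unit exists only
    as a zigzag [F (G x) <- Q x -> x].  The zigzags between two objects of [P]
    may pass through objects outside [P]; naturality of the counit on all of
    [C] takes care of this. *)
Section LocalizedEquivalence.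
Variables (C D : category).
Variables (W : forall x y : C, hom x y -> Prop) (W' : forall x y : D, hom x y -> Prop).
Variables (F : functor C D) (G : functor D C).
Hypothesis FW : forall (x y : C) (w : hom x y), W w -> W' (fhom F w).
Hypothesis GW : forall (x y : D) (w : hom x y), W' w -> W (fhom G w).
Variables (P : C -> Prop) (P' : D -> Prop).
Hypothesis FP : forall x, P x -> P' (F x).
Hypothesis GP : forall x, P' x -> P (G x).

Variable counit : forall x : C, hom (G (F x)) x.
Hypothesis counit_natural : forall (x y : C) (f : hom x y),
  counit y \oc fhom G (fhom F f) =h f \oc counit x.
Hypothesis counitW : forall x, P x -> W (counit x).

Variables (Q : D -> D) (Qf : forall x y : D, hom x y -> hom (Q x) (Q y)).
Variables (u : forall x, hom (Q x) (F (G x))) (q : forall x, hom (Q x) x).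
Hypothesis u_natural : forall (x y : D) (f : hom x y),
  u y \oc Qf f =h fhom F (fhom G f) \oc u x.
Hypothesis q_natural : forall (x y : D) (f : hom x y), q y \oc Qf f =h f \oc q x.
Hypothesis uW : forall x, W' (u x).
Hypothesis qW : forall x, W' (q x).

Notation LC := (localization W).
Notation LD := (localization W').

Program Definition sub_F : functor (@full_subcategory LC P) (@full_subcategory LD P') :=
  {| fobj := fun x : @full_subcategory LC P =>
       exist P' (F (sval x)) (FP (svalP x)) : @full_subcategory LD P';
     fhom := fun x y f => fhom (loc_functor FW) f |}.
Next Obligation. by move=> x y f g; exact: (fhom_heq (loc_functor FW)). Qed.
Next Obligation. by move=> x; exact: (fhom_id (loc_functor FW)). Qed.
Next Obligation. by move=> x y z g f; exact: (fhom_comp (loc_functor FW)). Qed.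

Program Definition sub_G : functor (@full_subcategory LD P') (@full_subcategory LC P) :=
  {| fobj := fun x : @full_subcategory LD P' =>
       exist P (G (sval x)) (GP (svalP x)) : @full_subcategory LC P;
     fhom := fun x y f => fhom (loc_functor GW) f |}.
Next Obligation. by move=> x y f g; exact: (fhom_heq (loc_functor GW)). Qed.
Next Obligation. by move=> x; exact: (fhom_id (loc_functor GW)). Qed.
Next Obligation. by move=> x y z g f; exact: (fhom_comp (loc_functor GW)). Qed.

Lemma localized_equivalence :
  equivalent (@full_subcategory LC P) (@full_subcategory LD P').
Proof.
exists sub_F, sub_G; split.
- pose t (x : C) : @hom LC (G (F x)) x := zz_mor W (counit x).
  exists (fun x : @full_subcategory LC P => t (sval x)).
  split=> [x|x y f]; first exact: (zz_mor_iso (counitW (svalP x))).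
  apply: (loc_natural (F := functor_comp (loc_functor GW) (loc_functor FW)) (t := t)).
  move=> {x y f} x y f.
  apply: zz_trans (zz_sym (zz_mor_comp _ _ _)) _.
  apply: zz_trans (zz_mor_heq _ (counit_natural f)) _.
  exact: zz_mor_comp.
- pose t (x : D) : @hom LD (F (G x)) x := zz_comp (zz_mor W' (q x)) (zz_inv (uW x)).
  exists (fun x : @full_subcategory LD P' => t (sval x)); split=> [x|x y f].
    exact: (iso_comp (zz_mor_iso (qW (sval x))) (zz_inv_iso (uW (sval x)))).
  apply: (loc_natural (F := functor_comp (loc_functor FW) (loc_functor GW)) (t := t)).
  move=> {x y f} x y f.
  pose mu z : @hom LD (Q z) (F (G z)) := zz_mor W' (u z).
  pose iu z : @hom LD (F (G z)) (Q z) := zz_inv (uW z).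
  pose mq z : @hom LD (Q z) z := zz_mor W' (q z).
  pose mQ : @hom LD (Q x) (Q y) := zz_mor W' (Qf f).
  pose mF : @hom LD (F (G x)) (F (G y)) := zz_mor W' (fhom F (fhom G f)).
  pose mf : @hom LD x y := zz_mor W' f.
  have uN : mu y \oc mQ =h mF \oc mu x.
    apply: zz_trans (zz_sym (zz_mor_comp _ _ _)) _.
    apply: zz_trans (zz_mor_heq _ (u_natural f)) _; exact: zz_mor_comp.
  have qN : mq y \oc mQ =h mf \oc mq x.
    apply: zz_trans (zz_sym (zz_mor_comp _ _ _)) _.
    apply: zz_trans (zz_mor_heq _ (q_natural f)) _; exact: zz_mor_comp.
  have iu1 z : iu z \oc mu z =h idm (Q z : LD) by exact: zz_invl.
  have iu2 z : mu z \oc iu z =h idm (F (G z) : LD) by exact: zz_invr.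
  have iuN : iu y \oc mF =h mQ \oc iu x.
    apply: heq_trans (heq_sym (compm_idr _)) _.
    apply: heq_trans (comp_hr _ (heq_sym (iu2 x))) _.
    apply: heq_trans (compmA _ _ _) _; apply: comp_hl.
    apply: heq_trans (compmAr _ _ _) _; apply: heq_trans (comp_hr _ (heq_sym uN)) _.
    apply: heq_trans (compmA _ _ _) _; apply: heq_trans (comp_hl _ (iu1 y)) _.
    exact: compm_idl.
  change ((mq y \oc iu y) \oc mF =h mf \oc (mq x \oc iu x)).
  apply: heq_trans (compmAr _ _ _) _; apply: heq_trans (comp_hr _ iuN) _.
  apply: heq_trans (compmA _ _ _) _; apply: heq_trans (comp_hl _ qN) _.
  exact: compmAr.
Qed.
End LocalizedEquivalence.

(** * Cones and Hom complexes *)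

(** Transport along an equality of degrees is needed where the shifted module
    [M (n - 1)] meets [M], whose indices do not agree by computation. *)
Definition recast (k : comPzRingType) (C : dgcomplex k) (i j : int) (E : i = j)
  (x : C i) : C j := ecast l (C l) E x.

Lemma recast_id (k : comPzRingType) (C : dgcomplex k) (i : int) (E : i = i) (x : C i) :
  recast E x = x.
Proof. by rewrite (eq_irrelevance E erefl). Qed.

Section RecastCalculus.
Variables (k : comPzRingType) (A : dgalgebra k) (M N : dgmodule A).

Lemma recast_linear i j (E : i = j) : linear (@recast _ M _ _ E).
Proof. by subst j. Qed.
Lemma diff_recast m n m' n' (p : m = n + 1) (p' : m' = n' + 1) (E : m = m') (E' : n = n')
    (x : M m) : diff p' (recast E x) = recast E' (diff p x).
Proof. by case: m' / E p' => p'; case: n' / E' p' => p'; exact: diff_irr. Qed.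
Lemma mor_recast (f : dgm_morphism M N) i j (E : i = j) (x : M i) :
  f j (recast E x) = recast E (f i x).
Proof. by subst j. Qed.
Lemma act_recast i j j' n n' (p : i + j = n) (p' : i + j' = n') (E : j = j') (E' : n = n')
    (a : A i) (x : M j) : act p' a (recast E x) = recast E' (act p a x).
Proof. by case: j' / E p' => p'; case: n' / E' p' => p'; exact: act_irr. Qed.
End RecastCalculus.

Lemma ksign_pair (k : comPzRingType) (U V : lmodType k) i (u : U) (v : V) :
  ksign i ((u, v) : (U * V)%type) = (ksign i u, ksign i v).
Proof. by []. Qed.

Section Cone.
Variables (k : comPzRingType) (A : dgalgebra k) (M N : dgmodule A).
Variable g : dgm_morphism M N.

Lemma cone_idx1 (m n : int) : m = n + 1 -> m - 1 = n. Proof. lia. Qed.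
Lemma cone_idx2 (m n : int) : m = n + 1 -> m - 1 = n - 1 + 1. Proof. lia. Qed.
Lemma cone_idx3 (i j n : int) : i + j = n -> i + (j - 1) = n - 1. Proof. lia. Qed.

(** [N] plus the shift of [M], so that a sign appears in the differential and in
    the action on the second summand. *)
Program Definition cone_complex : dgcomplex k :=
  {| cx := fun n => (N n * M (n - 1))%type : lmodType k;
     diff := fun m n p z =>
       (diff p z.1 + g n (recast (cone_idx1 p) z.2), - diff (cone_idx2 p) z.2) |}.
Next Obligation.
move=> m n p c [y x] [y' x'] /=; congr pair => /=.
  rewrite diff_linear recast_linear dgmf_linear.
  by rewrite scalerDr addrACA.
by rewrite diff_linear opprD scalerN.
Qed.
Next Obligation.
move=> l m n p q [y x] /=; congr pair => /=; last by rewrite diffN diff_diff !oppr0.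
rewrite diffD diff_diff add0r -dgmf_diff.
rewrite (diff_recast (cone_idx2 p) q (cone_idx1 p) (cone_idx1 q)).
by rewrite (linear_opp (recast_linear (M := M) (cone_idx1 q))) morN addrN.
Qed.

Program Definition cone : dgmodule A :=
  {| dgm_cx := cone_complex;
     act := fun i j n p a z => (act p a z.1, ksign i (act (cone_idx3 p) a z.2)) |}.
Next Obligation.
move=> i j n p [y x] c a b /=; congr pair => /=; first by rewrite act_linearl.
by rewrite act_linearl ksign_linear.
Qed.
Next Obligation.
move=> i j n p a c [y x] [y' x'] /=; congr pair => /=; first by rewrite act_linearr.
by rewrite act_linearr ksign_linear.
Qed.
Next Obligation.
move=> i j l ij jl n p q r s a b [y x] /=; congr pair => /=; first exact: actA.
rewrite act_ksign -ksignD p; congr ksign; exact: actA.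
Qed.
Next Obligation. by move=> n p [y x] /=; rewrite !act1 ksignE. Qed.
Next Obligation.
move=> i j n i' j' n' p pl pr qi qj qn a [y x] /=; rewrite ksign_pair; congr pair => /=.
  rewrite (act_leibniz p pl pr qi qj qn) actDr ksign_add addrA; congr (_ + _).
  rewrite (linear_ksign (recast_linear (M := M) (cone_idx1 qn))) mor_ksign; congr ksign.
  by rewrite -(act_recast (cone_idx3 p) pr (cone_idx1 qj)) dgmf_act.
rewrite diff_ksign (act_leibniz (cone_idx3 p) (cone_idx3 pl) (cone_idx3 pr) qi
  (cone_idx2 qj) (cone_idx2 qn)) actNr ksign_add opprD; congr (_ + _).
- by rewrite !ksignE (oddz_succ qi); case: (oddz i'); rewrite /= ?opprK.
- by rewrite !ksign_opp.
Qed.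

End Cone.

Section HomComplex.
Variables (k : comPzRingType) (A : dgalgebra k).
Implicit Types (M N P : dgmodule A).

Lemma dghf_irr n M N (f : dghom n M N) i j (p q : n + i = j) (x : M i) :
  f i j p x = f i j q x.
Proof. by rewrite (eq_irrelevance p q). Qed.
Lemma dghfD n M N (f : dghom n M N) i j (p : n + i = j) (x y : M i) :
  f i j p (x + y) = f i j p x + f i j p y.
Proof. exact: (linear_add (dghf_linear f p)). Qed.
Lemma dghf0 n M N (f : dghom n M N) i j (p : n + i = j) : f i j p 0 = 0.
Proof. exact: (linear_zero (dghf_linear f p)). Qed.
Lemma dghfB n M N (f : dghom n M N) i j (p : n + i = j) (x y : M i) :
  f i j p (x - y) = f i j p x - f i j p y.
Proof. exact: (linear_sub (dghf_linear f p)). Qed.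
Lemma dghf_ksign n M N (f : dghom n M N) i j (p : n + i = j) l (x : M i) :
  f i j p (ksign l x) = ksign l (f i j p x).
Proof. exact: (linear_ksign (dghf_linear f p)). Qed.
Lemma dghf_recast n M N (f : dghom n M N) i i' j j' (p : n + i = j) (p' : n + i' = j')
    (E : i = i') (E' : j = j') (x : M i) :
  f i' j' p' (recast E x) = recast E' (f i j p x).
Proof. by case: i' / E p' => p'; case: j' / E' p' => p'; exact: dghf_irr. Qed.

Lemma hdiff_idx1 (m n i j : int) : m = n + 1 -> n + i = j -> m + i = j + 1.
Proof. lia. Qed.
Lemma hdiff_idx2 (m n i j : int) : m = n + 1 -> n + i = j -> m + (i - 1) = j.
Proof. lia. Qed.
Lemma hdiff_idx3 (i : int) : i = i - 1 + 1. Proof. lia. Qed.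

Lemma dghf_diffE m M N (f : dghom m M N) i j (x : M i) j1 j2 (p : m + i = j1)
    (q : j1 = j + 1) (p' : m + i = j2) (q' : j2 = j + 1) :
  diff q (f _ _ p x) = diff q' (f _ _ p' x).
Proof.
have E : j1 = j2 by rewrite q q'.
by case: j2 / E p' q' => p' q'; rewrite (diff_irr q q') (dghf_irr f p p').
Qed.

Program Definition hdiff M N m n (s : m = n + 1) (f : dghom m M N) : dghom n M N :=
  {| dghf := fun i j r x =>
       diff erefl (f _ _ (hdiff_idx1 s r) x) -
       ksign m (f _ _ (hdiff_idx2 s r) (diff (hdiff_idx3 i) x)) |}.
Next Obligation.
move=> M N m n s f i j r c x y.
rewrite diff_linear !dghf_linear diff_linear ksign_linear.
by rewrite scalerBr opprD addrACA.
Qed.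
Next Obligation.
move=> M N m n s f i j l nj nl p q r t a x.
have e1 : i - 1 + j = l - 1 by lia.
have e2 : i + (j - 1) = l - 1 by lia.
have e3 : i + (nj + 1) = nl + 1 by lia.
have e4 : i - 1 + (nj + 1) = nl by lia.
have e5 : m + j = nj + 1 by lia.
rewrite (dghf_act f _ (hdiff_idx1 s q) (hdiff_idx1 s r) e3) diff_ksign.
rewrite (act_leibniz e3 e4 t (hdiff_idx3 i) erefl erefl).
rewrite (act_leibniz p e1 e2 (hdiff_idx3 i) (hdiff_idx3 j) (hdiff_idx3 l)).
rewrite dghfD dghf_ksign.
rewrite (dghf_act f e1 (hdiff_idx2 s q) (hdiff_idx1 s r) e4).
rewrite (dghf_act f e2 (hdiff_idx2 s q) (hdiff_idx2 s r) t).
rewrite actBr act_ksign !ksignE.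
move: (act e4 _ _) (act t a (diff _ _)) (act t a (f _ _ _ _)) => u v w.
rewrite !oddzM (oddz_succ s) oddzD oddzN oddz1.
by case: (oddz n); case: (oddz i);
  rewrite /= ?opprD ?opprK addrACA ?addrN ?addNr add0r.
Qed.

Lemma hdiffE M N m n (s : m = n + 1) (f : dghom m M N) i j (r : n + i = j) (x : M i)
    i' j' (p : m + i = j') (p' : m + i' = j) (qi : i = i' + 1) (qj : j' = j + 1) :
  hdiff s f _ _ r x = diff qj (f _ _ p x) - ksign m (f _ _ p' (diff qi x)).
Proof.
have E : i' = i - 1 by lia.
subst i'; rewrite /=; congr (_ - ksign m _).
  exact: dghf_diffE.
by rewrite (diff_irr (hdiff_idx3 i) qi); exact: dghf_irr.
Qed.

(** [hom_diff_eq] relates a map to its differential in [Hom_A(M,N)]; working with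
    the differential as an operation makes linearity and [d d = 0] available. *)
Lemma hom_diff_eqP M N m n (s : m = n + 1) (h : dghom m M N)
    (f : forall i j : int, n + i = j -> M i -> N j) :
  hom_diff_eq h f <-> (forall i j (r : n + i = j) x, hdiff s h _ _ r x = f i j r x).
Proof.
split=> [hf i j r x|hf i i' j j' p p' qi qj r x]; first exact: hf.
by rewrite -hf (hdiffE s h r x p p' qi qj).
Qed.

(** Equality of elements of [Hom_A(M,N)] is taken pointwise here and below. *)
Definition hcycle M N m (f : dghom m M N) : Prop :=
  forall n (s : m = n + 1) i j (r : n + i = j) x, hdiff s f _ _ r x = 0.

Lemma hcycleI M N m n (s : m = n + 1) (f : dghom m M N) :
  (forall i j (r : n + i = j) x, hdiff s f _ _ r x = 0) -> hcycle f.
Proof.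
move=> df n' s'; have E : n' = n by lia.
by subst n'; rewrite (eq_irrelevance s' s).
Qed.

Lemma hcycleE M N m (f : dghom m M N) i i' j j' (p : m + i = j) (p' : m + i' = j')
    (qi : i = i' + 1) (qj : j = j' + 1) (x : M i) :
  hcycle f -> diff qj (f _ _ p x) = ksign m (f _ _ p' (diff qi x)).
Proof.
have s : m = m - 1 + 1 by lia.
have r : m - 1 + i = j' by lia.
move=> /(_ _ s _ _ r x); rewrite (hdiffE s f r x p p' qi qj) => /eqP.
by rewrite subr_eq0 => /eqP.
Qed.

Definition hboundary M N m (f : dghom m M N) : Prop :=
  exists (n : int) (s : n = m + 1) (h : dghom n M N),
    forall i j (r : m + i = j) x, hdiff s h _ _ r x = f _ _ r x.

Lemma hboundaryE M N m n (s : n = m + 1) (f : dghom m M N) :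
  hboundary f -> exists h : dghom n M N,
    forall i j (r : m + i = j) x, hdiff s h _ _ r x = f _ _ r x.
Proof.
case=> n' [s' [h hh]]; have E : n' = n by rewrite s s'.
case: n / E s => s; exists h => i j r x.
by rewrite -hh (eq_irrelevance s s').
Qed.

Lemma hom_acyclicP M N :
  hom_acyclic M N <-> (forall m (f : dghom m M N), hcycle f -> hboundary f).
Proof.
split=> [MN m f zf|MN l m n pm pn f /(hom_diff_eqP pm) zf].
  have s : m = m - 1 + 1 by lia.
  case: (MN (m - 1) m (m + 1) s erefl f) => [|h /(hom_diff_eqP erefl) hh].
    by apply/(hom_diff_eqP s) => i j r x; exact: zf.
  by exists (m + 1), erefl, h.
have /(hboundaryE pn)[h hh] := MN m f (hcycleI zf).
by exists h; apply/(hom_diff_eqP pn).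
Qed.

Program Definition hsub M N m (f g : dghom m M N) : dghom m M N :=
  {| dghf := fun i j p x => f i j p x - g i j p x |}.
Next Obligation.
by move=> M N m f g i j p c x y; rewrite !dghf_linear scalerBr opprD addrACA.
Qed.
Next Obligation.
move=> M N m f g i j l nj nl p q r s a x.
rewrite /= (dghf_act f p q r s) (dghf_act g p q r s) actBr.
by rewrite ksign_add ksign_opp.
Qed.

Program Definition hopp M N m (f : dghom m M N) : dghom m M N :=
  {| dghf := fun i j p x => - f i j p x |}.
Next Obligation.
by move=> M N m f i j p c x y; rewrite !dghf_linear scalerN opprD.
Qed.
Next Obligation.
move=> M N m f i j l nj nl p q r s a x.
by rewrite /= (dghf_act f p q r s) actNr ksign_opp.
Qed.

Program Definition hzero M N m : dghom m M N := {| dghf := fun i j p x => 0 |}.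
Next Obligation. by move=> M N m i j p c x y; rewrite scaler0 addr0. Qed.
Next Obligation.
by move=> M N m i j l nj nl p q r s a x; rewrite act0r ksign0.
Qed.

Lemma hdiff_sub M N m n (s : m = n + 1) (f g : dghom m M N) i j (r : n + i = j) x :
  hdiff s (hsub f g) _ _ r x = hdiff s f _ _ r x - hdiff s g _ _ r x.
Proof. by rewrite /= diffB ksign_add ksign_opp !opprD addrACA. Qed.
Lemma hdiff_opp M N m n (s : m = n + 1) (f : dghom m M N) i j (r : n + i = j) x :
  hdiff s (hopp f) _ _ r x = - hdiff s f _ _ r x.
Proof. by rewrite /= diffN ksign_opp opprD. Qed.
Lemma hdiff_zero M N m n (s : m = n + 1) i j (r : n + i = j) x :
  hdiff s (hzero M N m) _ _ r x = 0.
Proof. by rewrite /= diff0 ksign0 subr0. Qed.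

Lemma hsub_cycle M N m (f g : dghom m M N) : hcycle f -> hcycle g -> hcycle (hsub f g).
Proof. by move=> zf zg n s i j r x; rewrite hdiff_sub zf zg subr0. Qed.

Lemma hcomp_idx (m n l i j : int) : m + n = l -> l + i = j -> m + (n + i) = j.
Proof. lia. Qed.

Program Definition hcomp M N P m n l (p : m + n = l) (f : dghom m N P) (g : dghom n M N) :
    dghom l M P :=
  {| dghf := fun i j q x => f _ _ (hcomp_idx p q) (g _ _ erefl x) |}.
Next Obligation. by move=> M N P m n l p f g i j q c x y; rewrite !dghf_linear. Qed.
Next Obligation.
move=> M N P m n l p f g i j t nj nl q r s u a x.
have e1 : i + (n + j) = n + t by lia.
rewrite (dghf_act g q erefl erefl e1) dghf_ksign.
rewrite (dghf_act f e1 (hcomp_idx p r) (hcomp_idx p s) u).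
rewrite !ksignE !oddzM (oddz_sum p).
by case: (oddz m); case: (oddz n); case: (oddz i); rewrite /= ?opprK.
Qed.

Lemma hcompE M N P m n l (p : m + n = l) (f : dghom m N P) (g : dghom n M N) i i' j
    (q : l + i = j) (r : m + i' = j) (s : n + i = i') x :
  hcomp p f g _ _ q x = f _ _ r (g _ _ s x).
Proof. by subst i'; rewrite /=; exact: dghf_irr. Qed.

Lemma hdiff_comp M N P m n l m' n' l' (p : m + n = l) (f : dghom m N P) (g : dghom n M N)
    (pl : m' + n = l') (pr : m + n' = l')
    (sm : m = m' + 1) (sn : n = n' + 1) (sl : l = l' + 1) i j (r : l' + i = j) x :
  hdiff sl (hcomp p f g) _ _ r x =
  hcomp pl (hdiff sm f) g _ _ r x + ksign m (hcomp pr f (hdiff sn g) _ _ r x).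
Proof.
have e1 : l + i = j + 1 by lia.
have e2 : i = i - 1 + 1 by lia.
have e3 : l + (i - 1) = j by lia.
have e4 : m + (n + i) = j + 1 by lia.
have e5 : m + (n + i - 1) = j by lia.
have e6 : n + (i - 1) = n + i - 1 by lia.
have e7 : m' + (n + i) = j by lia.
have e8 : n + i = n + i - 1 + 1 by lia.
have e9 : n' + i = n + i - 1 by lia.
rewrite (hdiffE sl _ r x e1 e3 e2 erefl).
rewrite (hcompE p f g e1 e4 erefl) (hcompE p f g e3 e5 e6).
rewrite (hcompE pl _ g r e7 erefl) (hcompE pr f _ r e5 e9).
rewrite (hdiffE sm f e7 _ e4 e5 e8 erefl) (hdiffE sn g e9 x erefl e6 e2 e8).
rewrite dghfB ksign_add ksign_opp dghf_ksign -(ksign_sum _ p).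
by rewrite addrA subrK.
Qed.

Lemma hmor_idx (i j : int) : 0 + i = j -> i = j. Proof. lia. Qed.

Program Definition hmor M N (g : dgm_morphism M N) : dghom 0 M N :=
  {| dghf := fun i j p x => recast (hmor_idx p) (g i x) |}.
Next Obligation.
move=> M N g i j p c x y; rewrite dgmf_linear.
exact: (recast_linear (M := N)).
Qed.
Next Obligation.
move=> M N g i j l nj nl p q r s a x.
rewrite mul0r ksignE /= dgmf_act.
by rewrite (act_recast p s (hmor_idx r) (hmor_idx q)).
Qed.

Lemma hmorE M N (g : dgm_morphism M N) i (p : 0 + i = i) x : hmor g _ _ p x = g i x.
Proof. exact: recast_id. Qed.

Lemma hmor_cycle M N (g : dgm_morphism M N) : hcycle (hmor g).
Proof.
have s : 0 = -1 + 1 :> int by [].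
apply: (hcycleI (s := s)) => i j r x.
have E : i = j + 1 by lia.
subst i.
by rewrite (hdiffE s _ r x (add0r (j + 1)) (add0r j) erefl erefl) !hmorE dgmf_diff ksignE subrr.
Qed.

(** Cycles of degree [0] are the same thing as morphisms. *)
Program Definition mor_of_hcycle M N (f : dghom 0 M N) (zf : hcycle f) : dgm_morphism M N :=
  {| dgmf := fun n x => f _ _ (add0r n) x |}.
Next Obligation. by move=> M N f zf n; exact: dghf_linear. Qed.
Next Obligation.
move=> M N f zf m n p x.
by rewrite (hcycleE (add0r m) (add0r n) p p x zf) ksignE.
Qed.
Next Obligation.
move=> M N f zf i j n p a x.
by rewrite /= (dghf_act f p (add0r n) (add0r j) p) mul0r ksignE.
Qed.

End HomComplex.

(** * Lifting through quasi-isomorphisms *)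

Section QuasiIsos.
Variables (k : comPzRingType) (A : dgalgebra k).
Implicit Types M N P : dgmodule A.

Lemma qis_comp M N P (g : dgm_morphism N P) (f : dgm_morphism M N) :
  dgm_quasi_iso g -> dgm_quasi_iso f -> dgm_quasi_iso (dgm_comp g f).
Proof.
move=> qg qf n; split=> [x zx /=|z zz].
  move=> /(proj1 (qg n) _ (mor_cycle f zx)); exact: (proj1 (qf n)).
have [y zy gy] := proj2 (qg n) z zz; have [x zx fx] := proj2 (qf n) y zy.
exists x => //=; apply: homologous_trans gy; exact: mor_homologous.
Qed.

Lemma qis_cancel_left M N P (g : dgm_morphism N P) (f : dgm_morphism M N) :
  dgm_quasi_iso g -> dgm_quasi_iso (dgm_comp g f) -> dgm_quasi_iso f.
Proof.
move=> qg qgf n; split=> [x zx bx|y zy].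
  exact: (proj1 (qgf n) x zx (mor_boundary g bx)).
have [x zx gfx] := proj2 (qgf n) _ (mor_cycle g zy).
exists x => //; rewrite /homologous; have bi := proj1 (qg n) (f n x - y).
by apply: bi; [apply: cycleB => //; exact: mor_cycle | rewrite morB].
Qed.

Lemma qis_cancel_right M N P (g : dgm_morphism N P) (f : dgm_morphism M N) :
  dgm_quasi_iso f -> dgm_quasi_iso (dgm_comp g f) -> dgm_quasi_iso g.
Proof.
move=> qf qgf n; split=> [y zy bgy|z zz].
  have [x zx fx] := proj2 (qf n) y zy.
  apply: (homologous_boundary fx); apply: mor_boundary.
  apply: (proj1 (qgf n)) => //=.
  by apply: homologous_boundary bgy; apply/homologous_sym/mor_homologous.
have [x zx gfx] := proj2 (qgf n) z zz.
by exists (f n x) => //; exact: mor_cycle.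
Qed.

Lemma qis_ext M N (f g : dgm_morphism M N) :
  (forall n x, f n x = g n x) -> dgm_quasi_iso f -> dgm_quasi_iso g.
Proof.
move=> fg qf n; split=> [x zx|y zy]; first by rewrite -fg; exact: (proj1 (qf n)).
by have [x zx fx] := proj2 (qf n) y zy; exists x; rewrite -?fg.
Qed.

Lemma qis_id M : dgm_quasi_iso (dgm_id M).
Proof. by move=> n; split=> // x zx; exists x => //; exact: homologous_refl. Qed.

(** Given a cycle [(y, x)], the cycle [x] bounds some [x0] because [g x = - d y]
    bounds, and [y + g x0] is a cycle, homologous to [g x1] for a cycle [x1];
    then [x1 - x0] is the second component of a primitive. *)
Lemma cone_acyclic M N (g : dgm_morphism M N) : dgm_quasi_iso g -> acyclic (cone g).
Proof.
move=> qg n [y x] zyx.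
have s : n = n - 1 + 1 by lia.
have [dy dx] : diff s y + g _ (recast (cone_idx1 s) x) = 0 /\ diff (cone_idx2 s) x = 0.
  have /= [E1 E2] := zyx _ s; split => //; apply: oppr_inj; by rewrite E2 oppr0.
set x' := recast (cone_idx1 s) x.
have zx' : is_cycle x'.
  have s1 : n - 1 = n - 1 - 1 + 1 by lia.
  apply: (cycleI (p := s1)).
  by rewrite (diff_recast (cone_idx2 s) s1 (cone_idx1 s) erefl) dx.
have gx' : is_boundary (g _ x').
  have -> : g _ x' = diff s (- y).
    by apply: (addrI (diff s y)); rewrite diffN addrN; exact: dy.
  exact: boundaryI.
have /(boundaryE s)[x0 dx0] := proj1 (qg _) x' zx' gx'.
have zyx0 : is_cycle (y + g _ x0).
  by apply: (cycleI (p := s)); rewrite diffD -dgmf_diff dx0.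
have [x1 zx1 /(boundaryE erefl)[y1 dy1]] := proj2 (qg _) _ zyx0.
have E : n = n + 1 - 1 by lia.
exists (n + 1), erefl, (- y1, recast E (x1 - x0)) => /=; congr pair.
  have -> : recast (cone_idx1 erefl) (recast E (x1 - x0)) = x1 - x0.
    rewrite -(recast_id (C := M) erefl (x1 - x0)).
    by rewrite /recast; case: _ / E (cone_idx1 _) => E; rewrite (eq_irrelevance E erefl).
  by rewrite diffN dy1 morB opprB addrA subrK addrK.
rewrite (diff_recast s (cone_idx2 erefl) E erefl) /= diffB zx1 sub0r opprK dx0.
exact: recast_id.
Qed.
End QuasiIsos.

Section RelativeLifting.
Variables (k : comPzRingType) (A : dgalgebra k).
Implicit Types M N P : dgmodule A.

Program Definition hpost M N P n (g : dgm_morphism N P) (f : dghom n M N) : dghom n M P :=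
  {| dghf := fun i j p x => g j (f i j p x) |}.
Next Obligation. by move=> M N P n g f i j p c x y; rewrite dghf_linear dgmf_linear. Qed.
Next Obligation.
move=> M N P n g f i j l nj nl p q r s a x /=.
by rewrite (dghf_act f p q r s) mor_ksign dgmf_act.
Qed.

Program Definition hpre M N P n (f : dghom n N P) (g : dgm_morphism M N) : dghom n M P :=
  {| dghf := fun i j p x => f i j p (g i x) |}.
Next Obligation. by move=> M N P n f g i j p c x y; rewrite dgmf_linear dghf_linear. Qed.
Next Obligation.
move=> M N P n f g i j l nj nl p q r s a x /=.
by rewrite dgmf_act (dghf_act f p q r s).
Qed.

Lemma hdiff_post M N P m n (s : m = n + 1) (g : dgm_morphism N P) (f : dghom m M N)
    i j (r : n + i = j) x :
  hdiff s (hpost g f) _ _ r x = g _ (hdiff s f _ _ r x).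
Proof. by rewrite /= morB dgmf_diff mor_ksign. Qed.
Lemma hdiff_pre M N P m n (s : m = n + 1) (f : dghom m N P) (g : dgm_morphism M N)
    i j (r : n + i = j) x :
  hdiff s (hpre f g) _ _ r x = hdiff s f _ _ r (g _ x).
Proof. by rewrite /= dgmf_diff. Qed.

Lemma hboundary_ext M N m (f g : dghom m M N) :
  (forall i j (p : m + i = j) x, f _ _ p x = g _ _ p x) -> hboundary f -> hboundary g.
Proof. by move=> fg [n [s [h hh]]]; exists n, s, h => i j r x; rewrite hh fg. Qed.
Lemma hboundary_sub M N m (f g : dghom m M N) :
  hboundary f -> hboundary g -> hboundary (hsub f g).
Proof.
move=> /(hboundaryE erefl)[h hh] /(hboundaryE erefl)[h' hh'].
by exists (m + 1), erefl, (hsub h h') => i j r x; rewrite hdiff_sub hh hh'.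
Qed.
Lemma hboundary_opp M N m (f : dghom m M N) : hboundary f -> hboundary (hopp f).
Proof.
move=> /(hboundaryE erefl)[h hh].
by exists (m + 1), erefl, (hopp h) => i j r x; rewrite hdiff_opp hh.
Qed.
Lemma hboundary_post M N P m (g : dgm_morphism N P) (f : dghom m M N) :
  hboundary f -> hboundary (hpost g f).
Proof.
by move=> [n [s [h hh]]]; exists n, s, (hpost g h) => i j r x; rewrite hdiff_post hh.
Qed.
Lemma hboundary_pre M N P m (f : dghom m N P) (g : dgm_morphism M N) :
  hboundary f -> hboundary (hpre f g).
Proof.
by move=> [n [s [h hh]]]; exists n, s, (hpre h g) => i j r x; rewrite hdiff_pre hh.
Qed.
Lemma hboundary_comp M N P m n l (p : m + n = l) (f : dghom m N P) (g : dghom n M N) :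
  hcycle f -> hboundary g -> hboundary (hcomp p f g).
Proof.
move=> zf /(hboundaryE erefl)[h hh].
have s : m = m - 1 + 1 by lia.
have p1 : m + (n + 1) = l + 1 by lia.
have p2 : m - 1 + (n + 1) = l by lia.
have E i j (r : l + i = j) x :
    hdiff erefl (hcomp p1 f h) _ _ r x = ksign m (hcomp p f g _ _ r x).
  rewrite (hdiff_comp p1 f h p2 p s erefl erefl r).
  rewrite (hcompE p2 _ h r (hcomp_idx p2 r) erefl) zf add0r; congr (ksign m _).
  by rewrite !(hcompE p _ _ r (hcomp_idx p r) erefl) hh.
have [om|om] := boolP (oddz m).
  exists (l + 1), erefl, (hopp (hcomp p1 f h)) => i j r x.
  by rewrite hdiff_opp E ksignE om opprK.
exists (l + 1), erefl, (hcomp p1 f h) => i j r x.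
by rewrite E ksignE (negbTE om).
Qed.
Lemma hcycle_post M N P m (g : dgm_morphism N P) (f : dghom m M N) :
  hcycle f -> hcycle (hpost g f).
Proof. by move=> zf n s i j r x; rewrite hdiff_post zf mor0. Qed.
Lemma hcycle_pre M N P m (f : dghom m N P) (g : dgm_morphism M N) :
  hcycle f -> hcycle (hpre f g).
Proof. by move=> zf n s i j r x; rewrite hdiff_pre zf. Qed.

Lemma lift_idx1 (m n i j : int) : m = n + 1 -> m + i = j -> n + i = j - 1.
Proof. lia. Qed.
Lemma lift_idx2 (m n i j : int) : n = m + 1 -> m + i = j -> n + i = j + 1.
Proof. lia. Qed.
Lemma lift_idx3 (j : int) : j + 1 - 1 = j. Proof. lia. Qed.

(** The pair [(f, - y)]; its differential vanishes exactly when [d y = 0] and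
    [d f = g y], which is why [y] is negated. *)
Program Definition hcone M N P (g : dgm_morphism M N) m n (s : m = n + 1)
    (f : dghom m P N) (y : dghom n P M) : dghom m P (cone g) :=
  {| dghf := fun i j p x => (f i j p x, - y i (j - 1) (lift_idx1 s p) x) |}.
Next Obligation.
move=> M N P g m n s f y i j p c u v; rewrite !dghf_linear opprD -scalerN.
by [].
Qed.
Next Obligation.
move=> M N P g m n s f y i j l nj nl p q r t a x /=.
rewrite ksign_pair (dghf_act f p q r t); congr pair.
rewrite (dghf_act y p (lift_idx1 s q) (lift_idx1 s r) (cone_idx3 t)) actNr.
rewrite !ksign_opp !ksignE !oddzM (oddz_succ s).
by case: (oddz n); case: (oddz i); rewrite /= ?opprK.
Qed.

Program Definition hfst M N P (g : dgm_morphism M N) m (h : dghom m P (cone g)) : dghom m P N :=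
  {| dghf := fun i j p x => (h i j p x).1 |}.
Next Obligation. by move=> M N P g m h i j p c u v; rewrite dghf_linear. Qed.
Next Obligation.
by move=> M N P g m h i j l nj nl p q r t a x /=; rewrite (dghf_act h p q r t).
Qed.

Program Definition hsnd M N P (g : dgm_morphism M N) m n (s : n = m + 1)
    (h : dghom n P (cone g)) : dghom m P M :=
  {| dghf := fun i j p x => recast (lift_idx3 j) (h i (j + 1) (lift_idx2 s p) x).2 |}.
Next Obligation.
move=> M N P g m n s h i j p c u v; rewrite dghf_linear.
exact: (recast_linear (M := M)).
Qed.
Next Obligation.
move=> M N P g m n s h i j l nj nl p q r t a x /=.
have e : i + (nj + 1) = nl + 1 by lia.
rewrite (dghf_act h p (lift_idx2 s q) (lift_idx2 s r) e) /=.
rewrite (linear_ksign (recast_linear (M := M) (lift_idx3 nl))).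
rewrite (linear_ksign (recast_linear (M := M) (lift_idx3 nl))).
rewrite -(act_recast (cone_idx3 e) t (lift_idx3 nj) (lift_idx3 nl)).
rewrite !ksignE !oddzM (oddz_succ s).
by case: (oddz m); case: (oddz i); rewrite /= ?opprK.
Qed.

Lemma hsndE M N P (g : dgm_morphism M N) m n (s : n = m + 1) (h : dghom n P (cone g))
    i j (p : m + i = j) j' (q : n + i = j') (E : j' - 1 = j) x :
  hsnd s h _ _ p x = recast E (h _ _ q x).2.
Proof.
have E' : j + 1 = j' by lia.
case: j' / E' q E => q E /=; rewrite (dghf_irr h _ q).
by rewrite (eq_irrelevance (lift_idx3 j) E).
Qed.

(** This spells out the acyclicity of [Hom(P, cone g)]: a cycle there is a pair
    [(f, - y)] with [d y = 0] and [d f = g y], and a primitive of it is a pair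
    [(h, x)] with [d x = y] and [d h + g x = f]. *)
Lemma relative_lift M N P (g : dgm_morphism M N) m n (s : m = n + 1)
    (f : dghom m P N) (y : dghom n P M) :
  hom_acyclic P (cone g) -> hcycle y ->
  (forall i j (r : n + i = j) x, hdiff s f _ _ r x = g _ (y _ _ r x)) ->
  exists x : dghom m P M,
    (forall i j (r : n + i = j) u, hdiff s x _ _ r u = y _ _ r u) /\
    hboundary (hsub (hpost g x) f).
Proof.
move=> /hom_acyclicP PC zy dfy.
have zF : hcycle (hcone g s f y).
  apply: (hcycleI (s := s)) => i j r x.
  have sn : n = n - 1 + 1 by lia.
  have e1 : m + i = j + 1 by lia.
  have e2 : i = i - 1 + 1 by lia.
  have e3 : m + (i - 1) = j by lia.
  have e4 : n + i = j + 1 - 1 by lia.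
  have e5 : n + (i - 1) = j - 1 by lia.
  rewrite (hdiffE s _ r x e1 e3 e2 erefl) /= ksign_pair; congr pair => /=.
    rewrite (linear_opp (recast_linear (M := M) (cone_idx1 erefl))).
    have <- : y _ _ r x = recast (cone_idx1 erefl) (y i _ (lift_idx1 s e1) x).
      exact: (dghf_recast y (lift_idx1 s e1) r erefl (cone_idx1 erefl) x).
    rewrite morN -dfy (hdiffE s f r x e1 e3 e2 erefl).
    by rewrite opprB addrCA subrr addr0 subrr.
  rewrite diffN opprK (hcycleE (lift_idx1 s e1) (lift_idx1 s e3) e2 (cone_idx2 erefl) x zy).
  rewrite ksign_opp opprK !ksignE (oddz_succ s).
  by case: (oddz n); rewrite /= ?addNr ?addrN.
have [H hH] := hboundaryE erefl (PC _ _ zF).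
have dH i j (r : m + i = j) x :
    hdiff erefl (hfst H) _ _ r x + g _ (hsnd erefl H _ _ r x) = f _ _ r x /\
    hdiff s (hsnd erefl H) _ _ (lift_idx1 s r) x = y _ _ (lift_idx1 s r) x.
  have e1 : m + 1 + i = j + 1 by lia.
  have e2 : i = i - 1 + 1 by lia.
  have e3 : m + 1 + (i - 1) = j by lia.
  have e4 : m + (i - 1) = j - 1 by lia.
  have := hH _ _ r x; rewrite (hdiffE erefl H r x e1 e3 e2 erefl) => E.
  have E1 := congr1 fst E; have E2 := congr1 snd E; rewrite /= in E1 E2; split.
    rewrite (hdiffE erefl (hfst H) r x e1 e3 e2 erefl) -E1.
    by rewrite (hsndE erefl H r e1 (cone_idx1 erefl)) addrAC.
  have q : j = j - 1 + 1 by lia.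
  apply: oppr_inj; rewrite -E2 -/(ksign _ _).
  rewrite (hdiffE s (hsnd erefl H) _ x r e4 e2 q) opprD opprK.
  rewrite (hsndE erefl H e4 e3 erefl) recast_id.
  rewrite (hsndE erefl H r e1 (lift_idx3 j)).
  rewrite (diff_recast (cone_idx2 erefl) q (lift_idx3 j) erefl) recast_id.
  congr (_ + _); rewrite !ksignE oddzD oddz1.
  by case: (oddz m); rewrite /= ?opprK.
exists (hsnd erefl H); split=> [i j r u|].
  have r' : m + i = j + 1 by lia.
  have e : j + 1 - 1 = j by lia.
  rewrite (dghf_recast (hdiff s (hsnd erefl H)) (lift_idx1 s r') r erefl e u).
  by rewrite (proj2 (dH _ _ r' u)) (dghf_recast y (lift_idx1 s r') r erefl e u).
exists (m + 1), erefl, (hopp (hfst H)) => i j r x.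
rewrite hdiff_opp -[RHS]/(g _ (hsnd erefl H _ _ r x) - f _ _ r x).
by rewrite -(proj1 (dH _ _ r x)) [RHS]addrC [- (_ + g _ _)]opprD subrK.
Qed.
End RelativeLifting.

Section Homotopy.
Variables (k : comPzRingType) (A : dgalgebra k).
Implicit Types M N P : dgmodule A.

Definition homotopic M N (f g : dgm_morphism M N) : Prop :=
  hboundary (hsub (hmor f) (hmor g)).

Lemma homotopic_trans M N (f g h : dgm_morphism M N) :
  homotopic f g -> homotopic g h -> homotopic f h.
Proof.
move=> fg /hboundary_opp gh; have := hboundary_sub fg gh.
by apply: hboundary_ext => i j p x /=; rewrite opprK addrA subrK.
Qed.
Lemma homotopic_comp_right M N P (f g : dgm_morphism N P) (h : dgm_morphism M N) :
  homotopic f g -> homotopic (dgm_comp f h) (dgm_comp g h).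
Proof. by move=> /(hboundary_pre h); apply: hboundary_ext => i j p x /=. Qed.

Lemma homotopic_homologous M N (f g : dgm_morphism M N) n (x : M n) :
  homotopic f g -> is_cycle x -> homologous (f n x) (g n x).
Proof.
move=> [n' [s [h hh]]] zx.
have e1 : n' + n = n + 1 by lia.
have e2 : n = n - 1 + 1 by lia.
have e3 : n' + (n - 1) = n by lia.
have := hh _ _ (add0r n) x; rewrite (hdiffE s h (add0r n) x e1 e3 e2 erefl).
rewrite zx dghf0 ksign0 subr0 /= !recast_id => fgx.
by exists (n + 1), erefl, (h _ _ e1 x).
Qed.

(** If [Hom(P, cone g)] is acyclic then [g] induces a quasi-isomorphism from
    [Hom(P, M)] to [Hom(P, N)]; surjectivity in degree [0] is the existence of
    lifts up to homotopy, and injectivity their uniqueness. *)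
Lemma homotopy_lift M N P (g : dgm_morphism M N) (f : dgm_morphism P N) :
  hom_acyclic P (cone g) -> exists t : dgm_morphism P M, homotopic (dgm_comp g t) f.
Proof.
move=> PC; have s : 0 = -1 + 1 :> int by [].
have [||t [zt ht]] := relative_lift (s := s) (f := hmor f) (y := hzero P M (-1)) PC.
- by move=> n s' i j r x; rewrite hdiff_zero.
- by move=> i j r x; rewrite hmor_cycle mor0.
have {}zt : hcycle t by apply: (hcycleI (s := s)).
exists (mor_of_hcycle zt); apply: hboundary_ext ht => i j p x.
have E : i = j by lia.
by case: j / E p => p; rewrite /= !recast_id (dghf_irr t p (add0r i)).
Qed.

Lemma homotopy_lift_unique M N P (g : dgm_morphism M N) (t t' : dgm_morphism P M) :
  hom_acyclic P (cone g) -> homotopic (dgm_comp g t) (dgm_comp g t') -> homotopic t t'.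
Proof.
move=> PC /(hboundaryE (erefl : 1 = 0 + 1 :> int))[h hh].
have [||x [dx _]] := relative_lift (s := (erefl : 1 = 0 + 1 :> int)) (f := h)
   (y := hsub (hmor t) (hmor t')) PC.
- by apply: hsub_cycle; exact: hmor_cycle.
- by move=> i j r x; rewrite hh /= morB !mor_recast.
by exists 1, erefl, x.
Qed.

Lemma hom_acyclic_forward M N P (g : dgm_morphism M N) :
  hom_acyclic P (cone g) -> hom_acyclic P M -> hom_acyclic P N.
Proof.
move=> PC /hom_acyclicP PM; apply/hom_acyclicP => m f zf.
have s : m = m - 1 + 1 by lia.
have [||x [dx hx]] := relative_lift (s := s) (f := f) (y := hzero P M (m - 1)) PC.
- by move=> n s' i j r x; rewrite hdiff_zero.
- by move=> i j r x; rewrite zf mor0.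
have /(hboundary_post g) bx : hboundary x by apply: PM; apply: (hcycleI (s := s)).
have := hboundary_sub bx hx; apply: hboundary_ext => i j p u /=.
by rewrite opprB addrC subrK.
Qed.

Lemma hom_acyclic_backward M N P (g : dgm_morphism M N) :
  hom_acyclic P (cone g) -> hom_acyclic P N -> hom_acyclic P M.
Proof.
move=> PC /hom_acyclicP PN; apply/hom_acyclicP => m f zf.
have [h hh] := hboundaryE erefl (PN _ _ (hcycle_post g zf)).
have [//|x [dx _]] := relative_lift (s := erefl) (f := h) (y := f) PC zf.
by exists (m + 1), erefl, x.
Qed.

Lemma K_projective_cone M N P (g : dgm_morphism M N) :
  K_projective P -> dgm_quasi_iso g -> hom_acyclic P (cone g).
Proof. by move=> KP qg; apply: KP; exact: cone_acyclic. Qed.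

(** Lifting [r] and [r'] through each other gives maps [t : P' -> P] and
    [t' : P -> P'] with [t' t] homotopic to the identity.  A cycle [f] on [P']
    is then homologous to [f t' t], and [f t'] bounds. *)
Lemma hom_acyclic_resolution M N P P' (r : dgm_morphism P M) (r' : dgm_morphism P' M) :
  K_projective P -> K_projective P' -> dgm_quasi_iso r -> dgm_quasi_iso r' ->
  hom_acyclic P N -> hom_acyclic P' N.
Proof.
move=> KP KP' qr qr' /hom_acyclicP PN; apply/hom_acyclicP => m f zf.
have [t rt] := homotopy_lift r' (K_projective_cone KP' qr).
have [t' r't'] := homotopy_lift r (K_projective_cone KP qr').
have tt : homotopic (dgm_comp t' t) (dgm_id P').
  apply: homotopy_lift_unique (K_projective_cone KP' qr') _.
  have h1 := homotopic_comp_right t r't'.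
  exact: homotopic_trans h1 rt.
have /(hboundary_pre t) b1 := PN _ _ (hcycle_pre t' zf).
have b2 := hboundary_comp (addr0 m) zf tt.
have := hboundary_sub b1 b2; apply: hboundary_ext => i j p x.
have e : 0 + i = i by lia.
have E : hcomp (addr0 m) f (hsub (hmor (dgm_comp t' t)) (hmor (dgm_id P'))) _ _ p x
         = f _ _ p (t' _ (t _ x)) - f _ _ p x.
  by rewrite (hcompE (addr0 m) f _ p p e) /= !recast_id dghfB.
by rewrite -[LHS]/(f _ _ p (t' _ (t _ x)) - hcomp _ _ _ _ _ p x) E opprB addrC subrK.
Qed.

Lemma RHom_acyclicE M N P (r : dgm_morphism P M) :
  K_projective P -> dgm_quasi_iso r -> RHom_acyclic M N -> hom_acyclic P N.
Proof.
move=> KP qr [P0 [r0 [KP0 qr0 P0N]]].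
exact: (hom_acyclic_resolution KP0 KP qr0 qr).
Qed.

(** The resolution [r : P -> Y] lifts through [g] to some [u : P -> X], because
    [P] has no maps to the cone of [g], and [g] lifts through [r] to some
    [t : X -> P], because [X] is K-projective.  Then [g u t] is homotopic to
    [g], and since [X] has no maps to the cone either, [u t] is homotopic to the
    identity.  So [g u ~ r] makes [H(g)] surjective, and [u t ~ 1] makes it
    injective. *)
Lemma qis_of_hom_acyclic_cone X Y P (g : dgm_morphism X Y) (r : dgm_morphism P Y) :
  K_projective X -> dgm_quasi_iso r ->
  hom_acyclic P (cone g) -> hom_acyclic X (cone g) -> dgm_quasi_iso g.
Proof.
move=> KX qr PC XC.
have [u gu] := homotopy_lift r PC.
have [t rt] := homotopy_lift g (K_projective_cone KX qr).
have ut : homotopic (dgm_comp u t) (dgm_id X).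
  apply: homotopy_lift_unique XC _.
  have h1 := homotopic_comp_right t gu.
  exact: homotopic_trans h1 rt.
move=> n; split=> [x zx bgx|y zy].
  apply: (homologous_boundary (homotopic_homologous ut zx)).
  apply: (mor_boundary u); apply: (proj1 (qr n)); first exact: mor_cycle.
  apply: homologous_boundary bgx; apply: homologous_sym.
  exact: (homotopic_homologous rt zx).
have [p zp rp] := proj2 (qr n) y zy.
exists (u n p); first exact: mor_cycle.
exact: homologous_trans (homotopic_homologous gu zp) rp.
Qed.
End Homotopy.

(** * Formal sums of cells *)

Section FreeModule.

Variables (k : comPzRingType) (B : dgalgebra k) (e : B 0) (X : int -> Type).

(** A term [b c] of total degree [n]. *)
Record gen (n : int) := Gen {
  gen_i : int; gen_j : int;
  gen_deg : gen_i + gen_j = n;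
  gen_coef : B gen_i;
  gen_cell : X gen_j
}.

(** Balanced functionals are the linear maps out of [Be (x) k[X]] in degree [n]:
    they do not distinguish [b] from [b e]. *)
Record balanced (n : int) (Y : lmodType k) := Balanced {
  balf :> forall i j : int, i + j = n -> B i -> X j -> Y;
  bal_linear : forall i j (p : i + j = n) (c : X j), linear (fun b => balf p b c);
  bal_unit : forall i j (p : i + j = n) (q : i + 0 = i) (b : B i) (c : X j),
    balf p (dmul q b e) c = balf p b c
}.

HB.instance Definition _ (n : int) := gen_eqMixin (gen n).
HB.instance Definition _ (n : int) := gen_choiceMixin (gen n).

Definition bal_sum n (Y : lmodType k) (h : balanced n Y) (s : seq (gen n)) : Y :=
  \sum_(g <- s) h _ _ (gen_deg g) (gen_coef g) (gen_cell g).

Definition gen_opp n (g : gen n) := Gen (gen_deg g) (- gen_coef g) (gen_cell g).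
Definition gen_scale (a : k) n (g : gen n) :=
  Gen (gen_deg g) (a *: gen_coef g) (gen_cell g).

Lemma bal_sum_cat n (Y : lmodType k) (h : balanced n Y) s t :
  bal_sum h (s ++ t) = bal_sum h s + bal_sum h t.
Proof. exact: big_cat. Qed.
Lemma bal_sum_opp n (Y : lmodType k) (h : balanced n Y) s :
  bal_sum h (map (@gen_opp n) s) = - bal_sum h s.
Proof.
rewrite /bal_sum big_map -sumrN; apply: eq_bigr => g _.
exact: (linear_opp (bal_linear h (gen_deg g) (gen_cell g))).
Qed.
Lemma bal_sum_scale n (Y : lmodType k) (h : balanced n Y) a s :
  bal_sum h (map (@gen_scale a n) s) = a *: bal_sum h s.
Proof.
rewrite /bal_sum big_map scaler_sumr; apply: eq_bigr => g _.
exact: (linear_scale (bal_linear h (gen_deg g) (gen_cell g))).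
Qed.

(** Two lists of terms represent the same element of [Be (x) k[X]] when no
    balanced functional separates them.  The quotient thus has its universal
    property by definition ([free_lift]) and all identities between formal sums
    can be checked on terms. *)
Definition bal_eq n : rel (seq (gen n)) := fun s t =>
  `[< forall (Y : lmodType k) (h : balanced n Y), bal_sum h s = bal_sum h t >].

Lemma bal_eq_equiv n : equiv_class_of (@bal_eq n).
Proof.
split=> [s|s t|t s u].
- by apply/asboolP.
- by apply/asboolP/asboolP => st Y h; rewrite st.
- by move=> /asboolP st /asboolP tu; apply/asboolP => Y h; rewrite st tu.
Qed.

Canonical bal_eq_rel n := EquivRelPack (bal_eq_equiv n).

Definition freemod n := {eq_quot (@bal_eq n)}.
HB.instance Definition _ n := Choice.on (freemod n).
HB.instance Definition _ n := EqQuotient.on (freemod n).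

Lemma free_piP n (s t : seq (gen n)) :
  (forall (Y : lmodType k) (h : balanced n Y), bal_sum h s = bal_sum h t) <->
  \pi_(freemod n) s = \pi_(freemod n) t.
Proof.
split=> [st|/eqquotP /asboolP//].
by apply/eqquotP/asboolP.
Qed.

Definition free_lift n (Y : lmodType k) (h : balanced n Y) (x : freemod n) : Y :=
  bal_sum h (repr x).

Lemma free_lift_pi n (Y : lmodType k) (h : balanced n Y) s :
  free_lift h (\pi_(freemod n) s) = bal_sum h s.
Proof. by have /free_piP := reprK (\pi_(freemod n) s); apply. Qed.

Lemma free_eqP n (x y : freemod n) :
  (forall (Y : lmodType k) (h : balanced n Y), free_lift h x = free_lift h y) -> x = y.
Proof. by move=> xy; rewrite -[x]reprK -[y]reprK; apply/free_piP. Qed.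

Definition free_add n (x y : freemod n) : freemod n := \pi_(freemod n) (repr x ++ repr y).
Definition free_opp n (x : freemod n) : freemod n := \pi_(freemod n) (map (@gen_opp n) (repr x)).
Definition free_zero n : freemod n := \pi_(freemod n) [::].
Definition free_scale n (a : k) (x : freemod n) : freemod n :=
  \pi_(freemod n) (map (@gen_scale a n) (repr x)).

Lemma free_liftD n (Y : lmodType k) (h : balanced n Y) x y :
  free_lift h (free_add x y) = free_lift h x + free_lift h y.
Proof. by rewrite free_lift_pi bal_sum_cat. Qed.
Lemma free_liftN n (Y : lmodType k) (h : balanced n Y) x :
  free_lift h (free_opp x) = - free_lift h x.
Proof. by rewrite free_lift_pi bal_sum_opp. Qed.
Lemma free_lift0 n (Y : lmodType k) (h : balanced n Y) :
  free_lift h (free_zero n) = 0.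
Proof. by rewrite free_lift_pi /bal_sum big_nil. Qed.
Lemma free_liftZ n (Y : lmodType k) (h : balanced n Y) a x :
  free_lift h (free_scale a x) = a *: free_lift h x.
Proof. by rewrite free_lift_pi bal_sum_scale. Qed.

Fact free_addA n : associative (@free_add n).
Proof. by move=> x y z; apply: free_eqP => Y h; rewrite !free_liftD addrA. Qed.
Fact free_addC n : commutative (@free_add n).
Proof. by move=> x y; apply: free_eqP => Y h; rewrite !free_liftD addrC. Qed.
Fact free_add0 n : left_id (free_zero n) (@free_add n).
Proof. by move=> x; apply: free_eqP => Y h; rewrite free_liftD free_lift0 add0r. Qed.
Fact free_addN n : left_inverse (free_zero n) (@free_opp n) (@free_add n).
Proof.
by move=> x; apply: free_eqP => Y h; rewrite free_liftD free_liftN free_lift0 addNr.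
Qed.

HB.instance Definition _ n := GRing.isZmodule.Build (freemod n)
  (@free_addA n) (@free_addC n) (@free_add0 n) (@free_addN n).

Fact free_scaleA n (a b : k) (x : freemod n) :
  free_scale a (free_scale b x) = free_scale (a * b) x.
Proof. by apply: free_eqP => Y h; rewrite !free_liftZ scalerA. Qed.
Fact free_scale1 n : left_id 1 (@free_scale n).
Proof. by move=> x; apply: free_eqP => Y h; rewrite free_liftZ scale1r. Qed.
Fact free_scaleDr n : right_distributive (@free_scale n) +%R.
Proof.
move=> a x y; apply: free_eqP => Y h.
by rewrite free_liftZ !free_liftD !free_liftZ scalerDr.
Qed.
Fact free_scaleDl n (x : freemod n) : {morph (@free_scale n)^~ x : a b / a + b}.
Proof.
move=> a b; apply: free_eqP => Y h.
by rewrite free_liftZ !free_liftD !free_liftZ scalerDl.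
Qed.

HB.instance Definition _ n := GRing.Zmodule_isLmodule.Build k (freemod n)
  (@free_scaleA n) (@free_scale1 n) (@free_scaleDr n) (@free_scaleDl n).

Lemma free_lift_linear n (Y : lmodType k) (h : balanced n Y) : linear (free_lift h).
Proof. by move=> a x y; rewrite free_liftD free_liftZ. Qed.

Definition fterm n i j (p : i + j = n) (b : B i) (c : X j) : freemod n :=
  \pi_(freemod n) [:: Gen p b c].

Lemma free_lift_gen n (Y : lmodType k) (h : balanced n Y) i j (p : i + j = n) b (c : X j) :
  free_lift h (fterm p b c) = h i j p b c.
Proof. by rewrite free_lift_pi /bal_sum big_seq1. Qed.

Lemma fterm_linear n i j (p : i + j = n) (c : X j) : linear (fun b => fterm p b c).
Proof.
move=> a x y; apply: free_eqP => Y h.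
by rewrite free_liftD free_liftZ !free_lift_gen (bal_linear h p c).
Qed.

Lemma fterm_unit n i j (p : i + j = n) (q : i + 0 = i) (b : B i) (c : X j) :
  fterm p (dmul q b e) c = fterm p b c.
Proof. by apply: free_eqP => Y h; rewrite !free_lift_gen bal_unit. Qed.

Lemma free_ind n (P : freemod n -> Prop) :
  P 0 ->
  (forall i j (p : i + j = n) (b : B i) (c : X j) x, P x -> P (fterm p b c + x)) ->
  forall x, P x.
Proof.
move=> P0 PS x; rewrite -[x]reprK; elim: (repr x) => [|[i j p b c] s IHs] //.
suff -> : \pi_(freemod n) (Gen p b c :: s) = fterm p b c + \pi_(freemod n) s by exact: PS.
apply: free_eqP => Y h; rewrite free_liftD free_lift_gen !free_lift_pi.
by rewrite /bal_sum big_cons.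
Qed.

Lemma free_linear_eq n (Y : lmodType k) (f g : freemod n -> Y) :
  linear f -> linear g ->
  (forall i j (p : i + j = n) (b : B i) (c : X j), f (fterm p b c) = g (fterm p b c)) ->
  f =1 g.
Proof.
move=> lf lg fg; apply: free_ind => [|i j p b c x IHx].
  by rewrite (linear_zero lf) (linear_zero lg).
by rewrite (linear_add lf) (linear_add lg) fg IHx.
Qed.

Lemma ftermD n i j (p : i + j = n) (a b : B i) (c : X j) :
  fterm p (a + b) c = fterm p a c + fterm p b c.
Proof. exact: (linear_add (fterm_linear p c)). Qed.
Lemma ftermB n i j (p : i + j = n) (a b : B i) (c : X j) :
  fterm p (a - b) c = fterm p a c - fterm p b c.
Proof. exact: (linear_sub (fterm_linear p c)). Qed.
Lemma fterm0 n i j (p : i + j = n) (c : X j) : fterm p 0 c = 0.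
Proof. exact: (linear_zero (fterm_linear p c)). Qed.
Lemma fterm_ksign n i j (p : i + j = n) l b (c : X j) :
  fterm p (ksign l b) c = ksign l (fterm p b c).
Proof. exact: (linear_ksign (fterm_linear p c)). Qed.
Lemma fterm_irr n i j (p q : i + j = n) b (c : X j) : fterm p b c = fterm q b c.
Proof. by rewrite (eq_irrelevance p q). Qed.

End FreeModule.

(** * Cell complexes *)

(** The image of [1] is an idempotent cycle, such as [e] for the inclusion of
    [eBe] into [B]. *)
Record nonunital_morphism (k : comPzRingType) (R B : dgalgebra k) := NonunitalMorphism {
  nuf :> forall n : int, R n -> B n;
  nuf_linear : forall n : int, linear (@nuf n);
  nuf_diff : forall (m n : int) (p : m = n + 1) (a : R m),
    nuf (diff p a) = diff p (nuf a);
  nuf_mul : forall (i j n : int) (p : i + j = n) (a : R i) (b : R j),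
    nuf (dmul p a b) = dmul p (nuf a) (nuf b)
}.

Definition nu_id (k : comPzRingType) (R : dgalgebra k) : nonunital_morphism R R :=
  @NonunitalMorphism k R R (fun n x => x) (fun _ _ _ _ => erefl)
    (fun _ _ _ _ => erefl) (fun _ _ _ _ _ _ => erefl).

Section NonunitalCalculus.
Variables (k : comPzRingType) (R B : dgalgebra k) (phi : nonunital_morphism R B).

Definition nu_unit : B 0 := phi 0 (done1 R).

Lemma nu_unit_mull n (p : 0 + n = n) (r : R n) : dmul p nu_unit (phi n r) = phi n r.
Proof. by rewrite -nuf_mul dmul1l. Qed.
Lemma nu_unit_mulr n (p : n + 0 = n) (r : R n) : dmul p (phi n r) nu_unit = phi n r.
Proof. by rewrite -nuf_mul dmul1r. Qed.
Lemma nu_unit_idem (p : 0 + 0 = 0 :> int) : dmul p nu_unit nu_unit = nu_unit.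
Proof. exact: nu_unit_mull. Qed.
Lemma nuf0 n : phi n 0 = 0.
Proof. exact: (linear_zero (nuf_linear phi (n := n))). Qed.
Lemma nufB n x y : phi n (x - y) = phi n x - phi n y.
Proof. exact: (linear_sub (nuf_linear phi (n := n))). Qed.
Lemma nu_cycle n (x : R n) : is_cycle x -> is_cycle (phi n x).
Proof. by move=> zx m p; rewrite -nuf_diff zx nuf0. Qed.
Lemma nu_unit_cycle : is_cycle nu_unit.
Proof. apply: nu_cycle; exact: one_cycle. Qed.
End NonunitalCalculus.

(** For [psi : B1 -> B2] with [psi e1 = e2], the pairing
    [a * (b c) = (a psi(b)) c] of [B2] with formal sums over [B1].  It is the
    action of [B2] on formal sums when [psi] is the identity, and [a = e2] gives
    the change of coefficients along [psi]. *)
Section Push.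
Variables (k : comPzRingType) (B1 B2 : dgalgebra k) (e1 : B1 0) (e2 : B2 0).
Variables (X : int -> Type) (psi : nonunital_morphism B1 B2).
Hypothesis psi_e : psi 0 e1 = e2.

Program Definition push_bal i n m (p : i + n = m) (a : B2 i) :
    balanced e1 X n (freemod e2 X m) :=
  {| balf := fun i' j' q b c =>
       @fterm _ _ e2 X m (i + i') j' _ (dmul erefl a (psi i' b)) c |}.
Next Obligation. by move=> *; lia. Qed.
Next Obligation.
move=> i n m p a i' j' q c x b b'.
by rewrite (nuf_linear psi) dmul_linearr fterm_linear.
Qed.
Next Obligation.
move=> i n m p a i' j' q r b c /=.
rewrite nuf_mul psi_e -(dmulA erefl (addr0 (i + i'))).
by rewrite fterm_unit.
Qed.

Definition push i n m (p : i + n = m) (a : B2 i) : freemod e1 X n -> freemod e2 X m :=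
  free_lift (push_bal p a).

Lemma push_linear i n m (p : i + n = m) (a : B2 i) : linear (push p a).
Proof. exact: free_lift_linear. Qed.

Lemma push_gen i n m (p : i + n = m) (a : B2 i) i' j' (q : i' + j' = n) b (c : X j')
    l (r : l + j' = m) (s : i + i' = l) :
  push p a (fterm e1 q b c) = fterm e2 r (dmul s a (psi i' b)) c.
Proof. by subst l; rewrite /push free_lift_gen /=; exact: fterm_irr. Qed.

Lemma push_linearl i n m (p : i + n = m) (x : freemod e1 X n) :
  linear (fun a => push p a x).
Proof.
move=> u a b; move: x; apply: free_linear_eq => [||i' j' q x c].
- exact: push_linear.
- move=> v x y; rewrite !push_linear !scalerDr !scalerA addrACA.
  by rewrite [u * v]mulrC.
have r : i + i' + j' = m by lia.
by rewrite !(push_gen p _ q _ _ r erefl) dmul_linearl fterm_linear.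
Qed.

Lemma pushD i n m (p : i + n = m) a x y : push p a (x + y) = push p a x + push p a y.
Proof. exact: (linear_add (push_linear p a)). Qed.
Lemma push0 i n m (p : i + n = m) a : push p a 0 = 0.
Proof. exact: (linear_zero (push_linear p a)). Qed.
Lemma push0l i n m (p : i + n = m) x : push p 0 x = 0.
Proof. exact: (linear_zero (push_linearl p x)). Qed.
Lemma push_ksign i n m (p : i + n = m) a l x :
  push p a (ksign l x) = ksign l (push p a x).
Proof. exact: (linear_ksign (push_linear p a)). Qed.
Lemma push_irr i n m (p q : i + n = m) a x : push p a x = push q a x.
Proof. by rewrite (eq_irrelevance p q). Qed.
End Push.

Lemma push_push (k : comPzRingType) (B1 B2 B3 : dgalgebra k) (e1 : B1 0) (e2 : B2 0)
    (e3 : B3 0) (X : int -> Type) (psi : nonunital_morphism B1 B2)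
    (psi' : nonunital_morphism B2 B3) (psi'' : nonunital_morphism B1 B3)
    (h : psi 0 e1 = e2) (h' : psi' 0 e2 = e3) (h'' : psi'' 0 e1 = e3)
    (E : forall n (x : B1 n), psi'' n x = psi' n (psi n x))
    i j l ij jl n (p : i + j = ij) (q : ij + l = n) (r : j + l = jl) (s : i + jl = n)
    a b (x : freemod e1 X l) :
  push h'' q (dmul p a (psi' j b)) x = push h' s a (push h r b x).
Proof.
move: x; apply: free_linear_eq => [||i' j' t y c].
- exact: push_linear.
- by move=> u x y; rewrite !push_linear.
have p1 : ij + i' + j' = n by lia.
have p2 : j + i' + j' = jl by lia.
have p3 : i + (j + i') = ij + i' by lia.
rewrite (push_gen h'' q _ t _ _ p1 erefl) (push_gen h r _ t _ _ p2 erefl).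
rewrite (push_gen h' s _ p2 _ _ p1 p3) nuf_mul E.
by rewrite (dmulA p erefl erefl p3).
Qed.

(** Boundaries of cells have coefficients in [R], whatever coefficients are used
    for formal sums of cells later. *)
Record cell_system (k : comPzRingType) (R : dgalgebra k) := CellSystem {
  cells :> int -> Type;
  cell_bd : forall m n : int, m = n + 1 -> cells m -> freemod (nu_unit (nu_id R)) cells n
}.

Section CellComplex.
Variables (k : comPzRingType) (R : dgalgebra k) (X : cell_system R).

Section Differential.
Variables (B : dgalgebra k) (phi : nonunital_morphism R B).

Notation cellmod := (freemod (nu_unit phi) X).

Lemma pred_succ (m n i : int) : m = n + 1 -> i = i - 1 + 1 :> int.
Proof. lia. Qed.

(** [d (b c) = (d b) c + (-1)^|b| b (d c)]. *)
Program Definition celld_bal m n (p : m = n + 1) :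
    balanced (nu_unit phi) X m (cellmod n) :=
  {| balf := fun i j q b c =>
       @fterm _ _ _ _ n (i - 1) j _ (diff (pred_succ i p) b) c +
       ksign i (@push _ _ _ _ _ X phi erefl i (j - 1) n _ b
                  (cell_bd (pred_succ j p) c)) |}.
Next Obligation. by move=> *; lia. Qed.
Next Obligation. by move=> *; lia. Qed.
Next Obligation.
move=> m n p i j q c u x y.
by rewrite diff_linear fterm_linear push_linearl ksign_linear scalerDr addrACA.
Qed.
Next Obligation.
move=> m n p i j q r b c /=; congr (_ + ksign i _).
- have pr : i + -1 = i - 1 by lia.
  rewrite (dmul_leibniz r (addr0 (i - 1)) pr (pred_succ i p) (erefl : 0 = -1 + 1 :> int)
    (pred_succ i p)).
  by rewrite nu_unit_cycle dmul0r ksign0 addr0 fterm_unit.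
- move: (cell_bd _ c); apply: free_linear_eq => [||i' j' s x c'].
  + exact: push_linear.
  + exact: push_linear.
  have p1 : i + i' + j' = n by lia.
  rewrite !(push_gen _ _ _ s _ _ p1 erefl).
  by rewrite (dmulA r erefl (add0r i') erefl) nu_unit_mull.
Qed.

Definition celld m n (p : m = n + 1) : cellmod m -> cellmod n :=
  free_lift (celld_bal p).

Lemma celld_linear m n (p : m = n + 1) : linear (celld p).
Proof. exact: free_lift_linear. Qed.

Lemma celld_gen m n (p : m = n + 1) i j (q : i + j = m) b (c : X j)
    i' (q' : i' + j = n) (s : i = i' + 1) j' (t : i + j' = n) (u : j = j' + 1) :
  celld p (fterm _ q b c) =
  fterm _ q' (diff s b) c + ksign i (push erefl t b (cell_bd u c)).
Proof.
have E : i' = i - 1 by lia.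
have E' : j' = j - 1 by lia.
subst i' j'; rewrite /celld free_lift_gen /=.
congr (_ + ksign i _).
- by rewrite (diff_irr _ s); exact: fterm_irr.
- by rewrite (eq_irrelevance (pred_succ j p) u); exact: push_irr.
Qed.

Lemma celldD m n (p : m = n + 1) x y : celld p (x + y) = celld p x + celld p y.
Proof. exact: (linear_add (celld_linear p)). Qed.
Lemma celld_ksign m n (p : m = n + 1) i x : celld p (ksign i x) = ksign i (celld p x).
Proof. exact: (linear_ksign (celld_linear p)). Qed.
End Differential.
Arguments celld [B] phi [m n] p x.

(** The Leibniz rule for all pairings at once. *)
Lemma celld_push (B1 B2 : dgalgebra k) (phi1 : nonunital_morphism R B1)
    (phi2 : nonunital_morphism R B2) (psi : nonunital_morphism B1 B2)
    (h : psi 0 (nu_unit phi1) = nu_unit phi2)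
    (E : forall n (x : R n), phi2 n x = psi n (phi1 n x))
    i j n i' j' n' (p : i + j = n) (pl : i' + j = n') (pr : i + j' = n')
    (qi : i = i' + 1) (qj : j = j' + 1) (qn : n = n' + 1)
    (a : B2 i) (x : freemod (nu_unit phi1) X j) :
  celld phi2 qn (push h p a x) =
    push h pl (diff qi a) x + ksign i (push h pr a (celld phi1 qj x)).
Proof.
move: x; apply: free_linear_eq => [||i1 j1 s b c].
- by move=> u x y; rewrite push_linear celld_linear.
- move=> u x y; rewrite celld_linear !push_linear ksign_linear.
  by rewrite scalerDr addrACA.
have e1 : i + i1 + j1 = n by lia.
have e2 : i + i1 + (j1 - 1) = n' by lia.
have e3 : j1 = j1 - 1 + 1 by lia.
have e4 : i + i1 - 1 + j1 = n' by lia.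
have e5 : i + i1 = i + i1 - 1 + 1 by lia.
have e6 : i1 - 1 + j1 = j' by lia.
have e7 : i1 = i1 - 1 + 1 by lia.
have e8 : i1 + (j1 - 1) = j' by lia.
have e9 : i' + i1 = i + i1 - 1 by lia.
have e10 : i + (i1 - 1) = i + i1 - 1 by lia.
rewrite (push_gen h p a s b c e1 erefl).
rewrite (celld_gen phi2 qn e1 _ c e4 e5 e2 e3).
rewrite (celld_gen phi1 qj s b c e6 e7 e8 e3).
rewrite pushD (push_gen h pr a e6 _ c e4 e10).
rewrite (push_gen h pl _ s b c e4 e9).
rewrite (dmul_leibniz erefl e9 e10 qi e7) ftermD fterm_ksign -nuf_diff.
rewrite ksign_add -addrA; congr (_ + (_ + _)).
rewrite push_ksign -ksignD; congr ksign.
by rewrite (push_push (erefl : phi1 0 _ = _) h (erefl : phi2 0 _ = _) E erefl e2 e8 pr).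
Qed.

Hypothesis bd_cycle : forall l m n (p : l = m + 1) (q : m = n + 1) (c : X l),
  celld (nu_id R) q (cell_bd p c) = 0.

Lemma celld_celld (B : dgalgebra k) (phi : nonunital_morphism R B)
    l m n (p : l = m + 1) (q : m = n + 1) x :
  celld phi q (celld phi p x) = 0.
Proof.
move: x; apply: free_linear_eq => [||i j s b c].
- by move=> u x y; rewrite !celld_linear.
- by move=> u x y; rewrite scaler0 addr0.
have e1 : i - 1 + j = m by lia.
have e2 : i = i - 1 + 1 by lia.
have e3 : i + (j - 1) = m by lia.
have e4 : j = j - 1 + 1 by lia.
have e5 : i - 1 - 1 + j = n by lia.
have e6 : i - 1 = i - 1 - 1 + 1 by lia.
have e7 : i - 1 + (j - 1) = n by lia.
have e8 : j - 1 = j - 1 - 1 + 1 by lia.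
have e9 : i + (j - 1 - 1) = n by lia.
rewrite (celld_gen phi p s b c e1 e2 e3 e4) celldD celld_ksign.
rewrite (celld_gen phi q e1 _ c e5 e6 e7 e4).
rewrite (celld_push (phi1 := nu_id R) _ (fun _ _ => erefl) e3 e7 e9 e2 e8).
rewrite bd_cycle push0 ksign0 addr0 diff_diff fterm0 add0r.
move: (push _ _ _ _) => z; rewrite !ksignE oddzD oddzN oddz1.
by case: (oddz i); rewrite /= ?addrN ?addNr.
Qed.

Section CellModule.
Variables (B : dgalgebra k) (phi : nonunital_morphism R B).

Program Definition cell_complex : dgcomplex k :=
  {| cx := fun n => freemod (nu_unit phi) X n;
     diff := fun m n p x => celld phi p x |}.
Next Obligation. by move=> *; exact: celld_linear. Qed.
Next Obligation. by move=> *; exact: celld_celld. Qed.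

Program Definition cell_module : dgmodule B :=
  {| dgm_cx := cell_complex;
     act := fun i j n p a x => push (psi := nu_id B) erefl p a x |}.
Next Obligation. by move=> i j n p x; exact: push_linearl. Qed.
Next Obligation. by move=> i j n p a; exact: push_linear. Qed.
Next Obligation.
move=> i j l ij jl n p q r s a b x.
exact: (@push_push _ _ _ _ _ _ _ X (nu_id B) (nu_id B) (nu_id B)).
Qed.
Next Obligation.
move=> n p; apply: free_linear_eq => [||i j q b c].
- exact: push_linear.
- by [].
by rewrite (push_gen _ p _ q b c q (add0r i)) /= dmul1l.
Qed.
Next Obligation.
move=> i j n i' j' n' p pl pr qi qj qn a x.
exact: celld_push.
Qed.
End CellModule.
End CellComplex.
Arguments celld [k R X B] phi [m n] p x.

(** * Restriction *)

Section Restriction.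

Variables (k : comPzRingType) (R B : dgalgebra k) (phi : nonunital_morphism R B).
Variable M : dgmodule B.
Notation e := (nu_unit phi).

Definition restr_pred (n : int) : {pred M n} := [pred x | act (add0r n) e x == x].

Lemma restr_submod_closed (n : int) : submod_closed (@restr_pred n).
Proof.
split; first by rewrite inE act0r.
by move=> c x y; rewrite !inE act_linearr => /eqP-> /eqP->.
Qed.

HB.instance Definition _ (n : int) :=
  GRing.isSubmodClosed.Build k (M n) (@restr_pred n) (@restr_submod_closed n).

Record restr_sort (n : int) := Restr {
  restr_val :> M n;
  restr_valP : restr_val \in @restr_pred n
}.

HB.instance Definition _ (n : int) := [isSub for @restr_val n].
HB.instance Definition _ (n : int) := [Choice of restr_sort n by <:].
HB.instance Definition _ (n : int) := [SubChoice_isSubZmodule of restr_sort n by <:].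
HB.instance Definition _ (n : int) := [SubZmodule_isSubLmodule of restr_sort n by <:].

Lemma restrP (n : int) (p : 0 + n = n) (x : M n) :
  reflect (act p e x = x) (x \in @restr_pred n).
Proof. by rewrite inE (act_irr _ p); exact: eqP. Qed.

Lemma restr_fix (n : int) (p : 0 + n = n) (x : restr_sort n) :
  act p e (restr_val x) = restr_val x.
Proof. by apply/restrP/restr_valP. Qed.

Lemma act_unit_in (n : int) (p : 0 + n = n) (x : M n) : act p e x \in @restr_pred n.
Proof. by apply/(restrP p); rewrite -(actA (add0r 0) p) nu_unit_idem. Qed.

Lemma restr_diff_in (m n : int) (p : m = n + 1) (x : restr_sort m) :
  diff p (restr_val x) \in @restr_pred n.
Proof.
apply/(restrP (add0r n)).
by rewrite -(diff_act0 (nu_unit_cycle phi) (add0r m)) restr_fix.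
Qed.

Lemma restr_act_in (i j n : int) (p : i + j = n) (r : R i) (x : restr_sort j) :
  act p (phi i r) (restr_val x) \in @restr_pred n.
Proof. by apply/(restrP (add0r n)); rewrite -(actA (add0r i) p) nu_unit_mull. Qed.

Program Definition restr_cx : dgcomplex k :=
  {| cx := fun n => restr_sort n : lmodType k;
     diff := fun m n p x => Restr (restr_diff_in p x) |}.
Next Obligation. by move=> m n p c x y; apply: val_inj; exact: diff_linear. Qed.
Next Obligation. by move=> l m n p q x; apply: val_inj; exact: diff_diff. Qed.

Program Definition restr : dgmodule R :=
  {| dgm_cx := restr_cx;
     act := fun i j n p r x => Restr (restr_act_in p r x) |}.
Next Obligation.
move=> i j n p x c r s; apply: val_inj => /=.
by rewrite nuf_linear; exact: act_linearl.
Qed.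
Next Obligation.
by move=> i j n p r c x y; apply: val_inj; exact: act_linearr.
Qed.
Next Obligation.
move=> i j l ij jl n p q r s a b x; apply: val_inj => /=.
by rewrite nuf_mul; exact: actA.
Qed.
Next Obligation. by move=> n p x; apply: val_inj; exact: restr_fix. Qed.
Next Obligation.
move=> i j n i' j' n' p pl pr qi qj qn a x; apply: val_inj => /=.
by rewrite nuf_diff; exact: act_leibniz.
Qed.

Lemma restr_cycle n (x : restr n) : is_cycle x <-> is_cycle (restr_val x).
Proof.
split=> zx m p; first by have := congr1 (@restr_val m) (zx m p).
by apply: val_inj; exact: zx.
Qed.

(** Multiplication by [e] retracts the complex [M] onto [eM]. *)
Lemma restr_boundary n (x : restr n) : is_boundary x <-> is_boundary (restr_val x).
Proof.
split=> [/(boundaryE erefl)[y <-]|/(boundaryE erefl)[y dy]].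
  by exists (n + 1), erefl, (restr_val y).
exists (n + 1), erefl, (Restr (act_unit_in (add0r _) y)); apply: val_inj => /=.
by rewrite (diff_act0 (nu_unit_cycle phi) _ (add0r n)) dy restr_fix.
Qed.

Lemma restr_homologous n (x y : restr n) :
  homologous x y <-> homologous (restr_val x) (restr_val y).
Proof. exact: restr_boundary. Qed.

End Restriction.

Section RestrictionFunctor.
Variables (k : comPzRingType) (R B : dgalgebra k) (phi : nonunital_morphism R B).
Implicit Types M N : dgmodule B.
Notation e := (nu_unit phi).

Lemma restr_mor_in M N (f : dgm_morphism M N) n (x : restr phi M n) :
  f n (restr_val x) \in @restr_pred _ _ _ phi N n.
Proof. by apply/(restrP phi (add0r n)); rewrite -dgmf_act restr_fix. Qed.

Program Definition restr_mor M N (f : dgm_morphism M N) :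
    dgm_morphism (restr phi M) (restr phi N) :=
  {| dgmf := fun n x => Restr (restr_mor_in f x) |}.
Next Obligation. by move=> M N f n c x y; apply: val_inj; exact: dgmf_linear. Qed.
Next Obligation. by move=> M N f m n p x; apply: val_inj; exact: dgmf_diff. Qed.
Next Obligation. by move=> M N f i j n p a x; apply: val_inj; exact: dgmf_act. Qed.

Program Definition restr_functor : functor (dgMod B) (dgMod R) :=
  {| fobj := fun M => restr phi M : dgMod R;
     fhom := fun M N f => restr_mor f |}.
Next Obligation. by move=> M N f g fg n x; apply: val_inj => /=; exact: fg. Qed.
Next Obligation. by move=> M n x; apply: val_inj. Qed.
Next Obligation. by move=> M N P g f n x; apply: val_inj. Qed.

(** [H(eM)] is the direct summand [e H(M)] of [H(M)]. *)
Lemma restr_qis M N (f : dgm_morphism M N) :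
  dgm_quasi_iso f -> dgm_quasi_iso (restr_mor f).
Proof.
move=> qf n; split=> [x /restr_cycle zx /restr_boundary bfx|y /restr_cycle zy].
  by apply/restr_boundary; exact: (proj1 (qf n)).
have [x zx fxy] := proj2 (qf n) _ zy.
exists (Restr (act_unit_in phi (add0r n) x)).
  apply/restr_cycle => m p /=.
  by rewrite (diff_act0 (nu_unit_cycle phi) _ (add0r m)) zx act0r.
apply/restr_homologous => /=; rewrite dgmf_act -(restr_fix (add0r n) y).
rewrite /homologous -actBr; move: fxy => /(boundaryE erefl)[z dz].
exists (n + 1), erefl, (act (add0r _) e z).
by rewrite (diff_act0 (nu_unit_cycle phi) _ (add0r n)) dz.
Qed.

(** Acyclicity of [eM], phrased inside [M]: this avoids identifying
    [e (cone g)] with the cone of [e g]. *)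
Definition unit_acyclic M : Prop :=
  forall n (x : M n), act (add0r n) e x = x -> is_cycle x -> is_boundary x.

Lemma unit_acyclicP M : unit_acyclic M <-> acyclic (restr phi M).
Proof.
split=> [Ma n x /restr_cycle zx|Ma n x ex zx].
  by apply/restr_boundary; apply: Ma => //; exact: restr_fix.
have xin : x \in @restr_pred _ _ _ phi M n by apply/(restrP phi (add0r n)).
apply/(restr_boundary (Restr xin)); apply: Ma.
by apply/restr_cycle.
Qed.

Lemma acyclic_unit M : acyclic M -> unit_acyclic M.
Proof. by move=> Ma n x _; exact: Ma. Qed.

Lemma unit_acyclic_cone M N (g : dgm_morphism M N) :
  dgm_quasi_iso (restr_mor g) -> unit_acyclic (cone g).
Proof.
move=> /cone_acyclic Ca n [y x] eyx zyx.
have := congr1 fst eyx; have := congr1 snd eyx => /= ex ey.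
rewrite ksignE /= in ex.
have yin : y \in @restr_pred _ _ _ phi N n by apply/(restrP phi (add0r n)).
have xin : x \in @restr_pred _ _ _ phi M (n - 1) 
  by apply/(restrP phi (cone_idx3 (add0r n))); exact: ex.
have val_recast (P : dgmodule B) i j (E : i = j) (z : restr phi P i) :
    restr_val (recast E z) = recast E (restr_val z) by subst j.
have [|m [p [[y' x'] /= [dy dx]]]] := Ca n (Restr yin, Restr xin).
  move=> m p; have /= [dy dx] := zyx m p.
  congr pair; apply: val_inj => //=.
  by rewrite -dy val_recast.
exists m, p, (restr_val y', restr_val x') => /=.
rewrite -dy -dx /=; congr pair.
by rewrite val_recast.
Qed.

(** On homology [1 - e] is the projection with kernel [e H(M)], which vanishes. *)
Lemma unit_acyclic_local M : unit_acyclic M -> local (done1 B - e) M.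
Proof.
move=> Ma j n p; have E : j = n by lia.
case: n / E p => p.
have act1e (x : M j) : act p (done1 B - e) x = x - act p e x by rewrite actBl act1.
have be (x : M j) : is_cycle x -> is_boundary (act p e x).
  move=> zx; rewrite (act_irr p (add0r j)); apply: Ma.
    by rewrite -(actA (add0r 0) (add0r j)) nu_unit_idem.
  move=> m q; by rewrite (diff_act0 (nu_unit_cycle phi) _ (add0r m)) zx act0r.
split=> [x zx|y zy].
  by rewrite act1e => bx; have := boundaryD bx (be _ zx); rewrite subrK.
exists y => //; rewrite /homologous act1e addrAC subrr add0r.
by apply: boundaryN; exact: be.
Qed.

Lemma local_unit_acyclic M : local (done1 B - e) M -> unit_acyclic M.
Proof.
move=> Ml n x ex zx; apply: (proj1 (Ml n n (add0r n))) => //.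
by rewrite actBl act1 ex subrr; exact: boundary0.
Qed.
End RestrictionFunctor.

(** * Semifree modules *)

Section Support.
Variables (k : comPzRingType) (B : dgalgebra k) (e : B 0) (X : int -> Type).
Implicit Types S : forall j, X j -> Prop.

Inductive supp S n : freemod e X n -> Prop :=
| supp0 : supp S 0
| suppS i j (p : i + j = n) b (c : X j) x :
    S j c -> supp S x -> supp S (fterm e p b c + x).

Lemma supp_add S n (x y : freemod e X n) : supp S x -> supp S y -> supp S (x + y).
Proof.
move=> Sx Sy; elim: Sx => [|i j p b c u Sc _ IHu]; first by rewrite add0r.
by rewrite -addrA; exact: suppS.
Qed.
Lemma supp_gen S n i j (p : i + j = n) b (c : X j) : S j c -> supp S (fterm e p b c).
Proof. by move=> Sc; rewrite -[fterm _ _ _ _]addr0; apply: suppS => //; exact: supp0. Qed.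
Lemma supp_opp S n (x : freemod e X n) : supp S x -> supp S (- x).
Proof.
elim=> [|i j p b c u Sc _ IHu]; first by rewrite oppr0; exact: supp0.
rewrite opprD -(linear_opp (fterm_linear e p c)); exact: suppS.
Qed.
Lemma supp_ksign S n i (x : freemod e X n) : supp S x -> supp S (ksign i x).
Proof. by rewrite ksignE => Sx; case: (oddz i) => //; exact: supp_opp. Qed.
Lemma supp_sum S n (I : Type) (r : seq I) (F : I -> freemod e X n) :
  (forall l, supp S (F l)) -> supp S (\sum_(l <- r) F l).
Proof. by move=> SF; elim/big_ind: _ => //; [exact: supp0|exact: supp_add]. Qed.
Lemma supp_mono S S' n (x : freemod e X n) :
  (forall j c, S j c -> S' j c) -> supp S x -> supp S' x.
Proof.
move=> SS'; elim=> [|i j p b c u Sc _ IHu]; first exact: supp0.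
by apply: suppS => //; exact: SS'.
Qed.

Lemma supp_linear_eq S n (Y : lmodType k) (f g : freemod e X n -> Y) (x : freemod e X n) :
  linear f -> linear g ->
  (forall i j (p : i + j = n) b (c : X j), S j c ->
     f (fterm e p b c) = g (fterm e p b c)) ->
  supp S x -> f x = g x.
Proof.
move=> lf lg fg; elim=> [|i j p b c u Sc _ IHu].
  by rewrite (linear_zero lf) (linear_zero lg).
by rewrite (linear_add lf) (linear_add lg) fg // IHu.
Qed.
End Support.

Lemma supp_push (k : comPzRingType) (B1 B2 : dgalgebra k) (e1 : B1 0) (e2 : B2 0)
    (X : int -> Type) (psi : nonunital_morphism B1 B2) (h : psi 0 e1 = e2)
    (S : forall j, X j -> Prop) i n m (p : i + n = m) a (x : freemod e1 X n) :
  supp S x -> supp S (push h p a x).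
Proof.
elim=> [|i' j' q b c u Sc _ IHu]; first by rewrite push0; exact: supp0.
rewrite pushD; have r : i + i' + j' = m by lia.
by rewrite (push_gen h p a q b c r erefl); exact: suppS.
Qed.

Section CellMap.
Variables (k : comPzRingType) (B : dgalgebra k) (e : B 0) (X X' : int -> Type).
Variable f : forall j, X j -> X' j.

Program Definition cellmap_bal n : balanced e X n (freemod e X' n) :=
  {| balf := fun i j p b c => fterm e p b (f c) |}.
Next Obligation. by move=> n i j p c; exact: fterm_linear. Qed.
Next Obligation. by move=> n i j p q b c; exact: fterm_unit. Qed.

Definition cellmap n : freemod e X n -> freemod e X' n := free_lift (cellmap_bal n).

Lemma cellmap_linear n : linear (@cellmap n).
Proof. exact: free_lift_linear. Qed.
Lemma cellmap_gen n i j (p : i + j = n) b (c : X j) :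
  cellmap (fterm e p b c) = fterm e p b (f c).
Proof. exact: free_lift_gen. Qed.
End CellMap.

Lemma cellmap_push (k : comPzRingType) (B1 B2 : dgalgebra k) (e1 : B1 0) (e2 : B2 0)
    (X X' : int -> Type) (f : forall j, X j -> X' j)
    (psi : nonunital_morphism B1 B2) (h : psi 0 e1 = e2)
    i n m (p : i + n = m) a (x : freemod e1 X n) :
  cellmap f (push h p a x) = push h p a (cellmap f x).
Proof.
move: x; apply: free_linear_eq => [||i' j' q b c].
- by move=> u x y; rewrite push_linear cellmap_linear.
- by move=> u x y; rewrite cellmap_linear push_linear.
have r : i + i' + j' = m by lia.
by rewrite (push_gen h p a q b c r erefl) !cellmap_gen (push_gen h p a q b _ r erefl).
Qed.

Lemma cellmap_celld (k : comPzRingType) (R : dgalgebra k) (X X' : cell_system R)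
    (f : forall j, X j -> X' j)
    (fbd : forall m n (p : m = n + 1) c, cell_bd p (f m c) = cellmap f (cell_bd p c))
    (B : dgalgebra k) (phi : nonunital_morphism R B) m n (p : m = n + 1)
    (x : freemod (nu_unit phi) X m) :
  cellmap f (celld phi p x) = celld phi p (cellmap f x).
Proof.
move: x; apply: free_linear_eq => [||i j q b c].
- by move=> u x y; rewrite celld_linear cellmap_linear.
- by move=> u x y; rewrite cellmap_linear celld_linear.
have e1 : i - 1 + j = n by lia.
have e2 : i = i - 1 + 1 by lia.
have e3 : i + (j - 1) = n by lia.
have e4 : j = j - 1 + 1 by lia.
rewrite cellmap_gen !(celld_gen phi p q b _ e1 e2 e3 e4).
rewrite (linear_add (@cellmap_linear _ _ _ _ _ _ _)).
rewrite (linear_ksign (@cellmap_linear _ _ _ _ _ _ _)).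
by rewrite cellmap_gen cellmap_push fbd.
Qed.

Record semifree_system (k : comPzRingType) (R : dgalgebra k) := SemifreeSystem {
  sf_cells :> cell_system R;
  sf_bd_cycle : forall l m n (p : l = m + 1) (q : m = n + 1) (c : sf_cells l),
    celld (nu_id R) q (cell_bd p c) = 0;
  sf_rank : forall j, sf_cells j -> nat;
  sf_bd_rank : forall m n (p : m = n + 1) (c : sf_cells m),
    supp (fun j c' => (sf_rank c' < sf_rank c)%N) (cell_bd p c)
}.

(** The dg module [Be (x) Q], where [Q] is the [R]-module of formal sums of cells
    of [X] with coefficients in [R]. *)
Definition semifree (k : comPzRingType) (R B : dgalgebra k) (X : semifree_system R)
  (phi : nonunital_morphism R B) : dgmodule B := cell_module (@sf_bd_cycle _ _ X) phi.

Section Semifree.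
Variables (k : comPzRingType) (R B : dgalgebra k) (X : semifree_system R).
Variable phi : nonunital_morphism R B.
Notation e := (nu_unit phi).
Notation G := (semifree X phi).
Notation Q := (semifree X (nu_id R)).

Definition cell_el j (c : X j) : G j := fterm e (add0r j) e c.

Lemma fterm_cell_el n i j (p : i + j = n) (b : B i) (c : X j) :
  fterm e p b c = act p b (cell_el c) :> G n.
Proof.
by rewrite [RHS](push_gen _ p b (add0r j) _ c p (addr0 i)) fterm_unit.
Qed.

Lemma diff_cell_el m n (p : m = n + 1) (c : X m) :
  diff p (cell_el c) = push (erefl : phi 0 _ = e) (add0r n) e (cell_bd p c) :> G n.
Proof.
have q : 0 = -1 + 1 :> int by [].
have r : -1 + m = n by lia.
rewrite [LHS](celld_gen phi p (add0r m) e c r q (add0r n) p).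
by rewrite nu_unit_cycle fterm0 add0r ksignE.
Qed.

(** The term [b c] is [b] times the cell [c]. *)
Lemma dghom_cell_eq Y m (f g : dghom m G Y) :
  (forall j (c : X j) j' (p : m + j = j'), f _ _ p (cell_el c) = g _ _ p (cell_el c)) ->
  forall i j (p : m + i = j) x, f _ _ p x = g _ _ p x.
Proof.
move=> fg i j p; apply: free_linear_eq => [||i' j' q b c].
- exact: (dghf_linear f p).
- exact: (dghf_linear g p).
rewrite fterm_cell_el; have r : i' + (m + j') = j by lia.
by rewrite (dghf_act f q p erefl r) (dghf_act g q p erefl r) fg.
Qed.

Lemma mor_cell_eq Y (f g : dgm_morphism G Y) :
  (forall j (c : X j), f j (cell_el c) = g j (cell_el c)) ->
  forall n (x : G n), f n x = g n x.
Proof.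
move=> fg n; apply: free_linear_eq => [||i j p b c].
- exact: (dgmf_linear f (n := n)).
- exact: (dgmf_linear g (n := n)).
by rewrite fterm_cell_el !dgmf_act fg.
Qed.

Section Extension.
Variables (Y : dgmodule B) (m : int) (h : forall j, X j -> Y (m + j)).
Hypothesis eh : forall j (c : X j) (p : 0 + (m + j) = m + j), act p e (h c) = h c.

Lemma cell_ext_idx (i j n l : int) : i + j = n -> m + n = l -> i + (m + j) = l.
Proof. lia. Qed.

(** The map of degree [m] sending [b c] to [(-1)^(m |b|) b h(c)]; it is balanced
    because [h] takes its values in [eY]. *)
Program Definition cell_ext_bal n l (q : m + n = l) : balanced e X n (Y l) :=
  {| balf := fun i j p b c => ksign (m * i) (act (cell_ext_idx p q) b (h c)) |}.
Next Obligation.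
move=> n l q i j p c a x y; rewrite act_linearl.
by rewrite ksign_linear.
Qed.
Next Obligation.
move=> n l q i j p r b c /=; congr ksign.
by rewrite (actA r _ (add0r _) (cell_ext_idx p q)) eh.
Qed.

Program Definition cell_ext : dghom m G Y :=
  {| dghf := fun i j p x => free_lift (cell_ext_bal p) x |}.
Next Obligation. by move=> i j p; exact: free_lift_linear. Qed.
Next Obligation.
move=> i j l nj nl p q r s a; apply: free_linear_eq => [||i' j' t b c].
- move=> u x y; rewrite act_linearr.
  exact: free_lift_linear.
- move=> u x y; rewrite free_lift_linear act_linearr.
  by rewrite ksign_linear.
have e1 : i + i' + j' = l by lia.
rewrite [act p a _](push_gen _ p a t b c e1 erefl) !free_lift_gen /=.
rewrite act_ksign mulrDr ksignD; congr (ksign _ (ksign _ _)).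
exact: actA.
Qed.

Lemma cell_ext_gen n l (q : m + n = l) i j (p : i + j = n) b (c : X j)
    (r : i + (m + j) = l) :
  cell_ext _ _ q (fterm e p b c) = ksign (m * i) (act r b (h c)).
Proof. by rewrite [LHS]free_lift_gen /=; congr ksign; exact: act_irr. Qed.

Lemma cell_ext_el j (c : X j) : cell_ext _ _ erefl (cell_el c) = h c.
Proof. by rewrite (cell_ext_gen _ _ _ _ (add0r _)) eh mulr0 ksignE. Qed.
End Extension.
End Semifree.

(** * The adjunction between induction and restriction *)

Section Adjunction.
Variables (k : comPzRingType) (R B : dgalgebra k) (X : semifree_system R).
Variable phi : nonunital_morphism R B.
Notation e := (nu_unit phi).
Notation G := (semifree X phi).
Notation Q := (semifree X (nu_id R)).

Lemma unit_mor_in n (x : Q n) :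
  (push (erefl : phi 0 _ = e) (add0r n) e x : G n) \in @restr_pred _ _ _ phi G n.
Proof.
apply/(restrP phi (add0r n)).
rewrite -[LHS](push_push (psi' := nu_id B) (psi'' := phi) (erefl : phi 0 _ = e) _ erefl (fun _ _ => erefl)
  (addr0 0) (add0r n)).
by rewrite /= (nu_unit_idem phi).
Qed.

Program Definition unit_mor : dgm_morphism Q (restr phi G) :=
  {| dgmf := fun n x => Restr (unit_mor_in x) |}.
Next Obligation. by move=> n c x y; apply: val_inj => /=; exact: push_linear. Qed.
Next Obligation.
move=> m n p x; apply: val_inj => /=.
have q : 0 = -1 + 1 :> int by [].
have r : -1 + m = n by lia.
rewrite (celld_push (phi1 := nu_id R) _ (fun _ _ => erefl) (add0r m) r (add0r n) q p).
by rewrite nu_unit_cycle push0l add0r ksignE.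
Qed.
Next Obligation.
move=> i j n p a x; apply: val_inj => /=.
rewrite -(push_push (psi := nu_id R) (psi'' := phi) erefl erefl (erefl : phi 0 _ = e) (fun _ _ => erefl)
  (add0r i) p p (add0r n)).
rewrite -[RHS](push_push (psi' := nu_id B) (psi'' := phi) (erefl : phi 0 _ = e) erefl (erefl : phi 0 _ = e)
  (fun _ _ => erefl) (addr0 i) p).
by rewrite /= nu_unit_mull nu_unit_mulr.
Qed.

Lemma unit_mor_gen n i j (p : i + j = n) (r : R i) (c : X j) :
  restr_val (unit_mor n (fterm _ p r c)) = fterm e p (phi i r) c.
Proof. by rewrite /= (push_gen _ _ _ p _ c p (add0r i)) nu_unit_mull. Qed.

Lemma unit_mor_el j (c : X j) :
  restr_val (unit_mor j (cell_el (nu_id R) c)) = cell_el phi c.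
Proof. exact: unit_mor_gen. Qed.

Section Sharp.
Variables (Y : dgmodule B) (m : int).

(** The bijection from [Hom(Q, eY)] to [Hom(Be (x) Q, Y)] and its inverse, in
    each degree. *)
Definition sharp_val (f : dghom m Q (restr phi Y)) j (c : X j) : Y (m + j) :=
  restr_val (f _ _ erefl (cell_el (nu_id R) c)).

Lemma sharp_fix f j (c : X j) (p : 0 + (m + j) = m + j) :
  act p e (sharp_val f c) = sharp_val f c.
Proof. exact: restr_fix. Qed.

Definition sharp (f : dghom m Q (restr phi Y)) : dghom m G Y := cell_ext (sharp_fix f).

(** This characterizes [sharp f]: the cells of [Be (x) Q] come from [Q]. *)
Lemma sharp_unit f i j (p : m + i = j) (x : Q i) :
  sharp f _ _ p (restr_val (unit_mor i x)) = restr_val (f _ _ p x).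
Proof.
move: x; apply: free_linear_eq => [||i' j' q r c].
- move=> u x y; rewrite dgmf_linear.
  exact: (dghf_linear (sharp f) p).
- by move=> u x y; rewrite (dghf_linear f p).
have s : i' + (m + j') = j by lia.
rewrite unit_mor_gen (cell_ext_gen (sharp_fix f) p q _ c s).
rewrite (fterm_cell_el (nu_id R)) (dghf_act f q p erefl s).
by rewrite !ksignE; case: (oddz _).
Qed.

Program Definition flat (f : dghom m G Y) : dghom m Q (restr phi Y) :=
  {| dghf := fun i j p x => @Restr _ _ _ phi Y j (f _ _ p (restr_val (unit_mor i x))) _ |}.
Next Obligation.
move=> f i j p x; apply/(restrP phi (add0r j)).
have := dghf_act f (add0r i) p p (add0r j) e (restr_val (unit_mor i x)).
by rewrite restr_fix mulr0 ksignE.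
Qed.
Next Obligation.
move=> f i j p c x y; apply: val_inj => /=.
rewrite push_linear; exact: (dghf_linear f p).
Qed.
Next Obligation.
move=> f i j l nj nl p q r s a x; apply: val_inj.
have E : restr_val (unit_mor l (act p a x)) = act p (phi i a) (restr_val (unit_mor j x)).
  by rewrite dgmf_act.
rewrite -[LHS]/(f _ _ q (restr_val (unit_mor l (act p a x)))) E (dghf_act f p q r s).
by rewrite !ksignE; case: (oddz _).
Qed.

Lemma flatE f i j (p : m + i = j) (x : Q i) :
  restr_val (flat f _ _ p x) = f _ _ p (restr_val (unit_mor i x)).
Proof. by []. Qed.
End Sharp.

Lemma hdiff_sharp Y m n (s : m = n + 1) (f : dghom m Q (restr phi Y)) i j
    (p : n + i = j) (x : Q i) :
  hdiff s (sharp f) _ _ p (restr_val (unit_mor i x)) = restr_val (hdiff s f _ _ p x).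
Proof.
have e1 : m + i = j + 1 by lia.
have e2 : i = i - 1 + 1 by lia.
have e3 : m + (i - 1) = j by lia.
have E : diff e2 (restr_val (unit_mor i x)) = restr_val (unit_mor _ (diff e2 x)).
  by rewrite dgmf_diff.
rewrite (hdiffE s (sharp f) p _ e1 e3 e2 erefl) (hdiffE s f p x e1 e3 e2 erefl).
rewrite E !sharp_unit.
by rewrite !ksignE; case: (oddz _).
Qed.

Lemma hdiff_flat Y m n (s : m = n + 1) (f : dghom m G Y) i j (p : n + i = j) (x : Q i) :
  restr_val (hdiff s (flat f) _ _ p x) = hdiff s f _ _ p (restr_val (unit_mor i x)).
Proof.
have e1 : m + i = j + 1 by lia.
have e2 : i = i - 1 + 1 by lia.
have e3 : m + (i - 1) = j by lia.
have E : diff e2 (restr_val (unit_mor i x)) = restr_val (unit_mor _ (diff e2 x)).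
  by rewrite dgmf_diff.
rewrite (hdiffE s f p _ e1 e3 e2 erefl) (hdiffE s (flat f) p x e1 e3 e2 erefl).
rewrite E.
by rewrite !ksignE; case: (oddz _).
Qed.

(** [sharp] and [flat] commute with differentials, so they identify the two Hom
    complexes. *)
Lemma hom_acyclic_adj Y : hom_acyclic G Y <-> hom_acyclic Q (restr phi Y).
Proof.
split=> /hom_acyclicP Ha; apply/hom_acyclicP => m f zf.
- have /Ha/(hboundaryE erefl)[h hh] : hcycle (sharp f).
    move=> n s i j r x; rewrite -(hdiff_zero Y s r x).
    move: i j r x; apply: dghom_cell_eq => j c j' p.
    by rewrite -unit_mor_el hdiff_sharp zf hdiff_zero.
  exists (m + 1), erefl, (flat h) => i j r x; apply: val_inj.
  by rewrite -[LHS]/(restr_val _) hdiff_flat hh sharp_unit.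
- have /Ha/(hboundaryE erefl)[h hh] : hcycle (flat f).
    move=> n s i j r x; apply: val_inj.
    by rewrite -[LHS]/(restr_val _) hdiff_flat zf.
  exists (m + 1), erefl, (sharp h); apply: dghom_cell_eq => j c j' p.
  by rewrite -unit_mor_el hdiff_sharp hh flatE.
Qed.

Section Adjoint.
Variables (Y : dgmodule B) (v : dgm_morphism Q (restr phi Y)).

Lemma adjoint_cycle : hcycle (sharp (hmor v)).
Proof.
move=> n s i j r x; rewrite -(hdiff_zero Y s r x).
move: i j r x; apply: dghom_cell_eq => j c j' p.
by rewrite -unit_mor_el hdiff_sharp hmor_cycle hdiff_zero.
Qed.

Definition adjoint : dgm_morphism G Y := mor_of_hcycle adjoint_cycle.

Lemma adjoint_unit n (x : Q n) : adjoint n (restr_val (unit_mor n x)) = restr_val (v n x).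
Proof. by rewrite [LHS]sharp_unit hmorE. Qed.

Lemma adjoint_el j (c : X j) :
  adjoint j (cell_el phi c) = restr_val (v j (cell_el (nu_id R) c)).
Proof. by rewrite -unit_mor_el adjoint_unit. Qed.
End Adjoint.
End Adjunction.

(** * K-projectivity of semifree modules *)

Section KProjective.
Variables (k : comPzRingType) (R : dgalgebra k) (X : semifree_system R).
Notation Q := (semifree X (nu_id R)).
Notation el := (cell_el (nu_id R)).
Variables (Y : dgmodule R) (Y_acyclic : acyclic Y).
Variables (m : int) (f : dghom m Q Y).
Hypothesis zf : hcycle f.

Definition primitive n (v : Y n) : Y (n + 1) :=
  if pselect (exists y : Y (n + 1), diff erefl y = v) is left w then sval (cid w) else 0.

Lemma diff_primitive n (v : Y n) : is_cycle v -> diff erefl (primitive v) = v.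
Proof.
move=> /Y_acyclic/(boundaryE erefl) w; rewrite /primitive.
by case: pselect => // w'; exact: svalP (cid w').
Qed.

Notation cellfun := (forall j, X j -> Y (m + 1 + j)).

Lemma cellfun_fix (h : cellfun) j (c : X j) (p : 0 + (m + 1 + j) = m + 1 + j) :
  act p (nu_unit (nu_id R)) (h j c) = h j c.
Proof. exact: act1. Qed.

Definition extend (h : cellfun) : dghom (m + 1) Q Y := cell_ext (cellfun_fix h).

Lemma kp_idx1 (j : int) : j = j - 1 + 1. Proof. lia. Qed.
Lemma kp_idx2 (j : int) : m + 1 + (j - 1) = m + j. Proof. lia. Qed.
Lemma kp_idx3 (j : int) : m + j + 1 = m + 1 + j. Proof. lia. Qed.

(** The equation [d (h c) = target h c] says that the extension of [h] is a
    primitive of [f] at the cell [c]; its right-hand side involves only cells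
    of rank lower than that of [c]. *)
Definition target (h : cellfun) j (c : X j) : Y (m + j) :=
  f _ _ erefl (el c) +
  ksign (m + 1) (extend h _ _ (kp_idx2 j) (diff (kp_idx1 j) (el c))).

Lemma extend_supp_eq (S : forall j, X j -> Prop) (h h' : cellfun) i j
    (p : m + 1 + i = j) (x : Q i) :
  (forall j c, S j c -> h j c = h' j c) -> supp S x ->
  extend h _ _ p x = extend h' _ _ p x.
Proof.
move=> hh'; apply: supp_linear_eq => [||i' j' q b c Sc].
- exact: (dghf_linear (extend h) p).
- exact: (dghf_linear (extend h') p).
have r : i' + (m + 1 + j') = j by lia.
rewrite (cell_ext_gen (cellfun_fix h) p q b c r).
by rewrite (cell_ext_gen (cellfun_fix h') p q b c r) hh'.
Qed.

Lemma diff_el_supp j n (p : j = n + 1) (c : X j) :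
  supp (fun j c' => (sf_rank c' < sf_rank c)%N) (diff p (el c) : Q n).
Proof. by rewrite diff_cell_el; apply: supp_push; exact: sf_bd_rank. Qed.

Lemma target_eq (h h' : cellfun) j (c : X j) :
  (forall j' (c' : X j'), (sf_rank c' < sf_rank c)%N -> h j' c' = h' j' c') ->
  target h c = target h' c.
Proof.
move=> hh'; congr (_ + ksign _ _); apply: extend_supp_eq hh' _.
exact: diff_el_supp.
Qed.

Definition step (h : cellfun) : cellfun :=
  fun j c => recast (kp_idx3 j) (primitive (target h c)).

(** The values at the cells of rank less than [n] are final from stage [n] on. *)
Fixpoint stage (n : nat) : cellfun :=
  if n is n'.+1 then step (stage n') else fun _ _ => 0.

Definition solution : cellfun := fun j c => stage (sf_rank c).+1 c.

Lemma stage_stable n j (c : X j) : (sf_rank c < n)%N -> stage n c = solution c.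
Proof.
elim/ltn_ind: n j c => [[//|n]] IH j c; rewrite ltnS => cn.
rewrite /solution /= /step; congr (recast _ (primitive _)); apply: target_eq.
move=> j' c' c'c; rewrite (IH n) //; last exact: leq_trans cn.
by rewrite (IH (sf_rank c)).
Qed.

Lemma solutionE j (c : X j) : solution c = step solution c.
Proof.
rewrite {1}/solution /= /step; congr (recast _ (primitive _)); apply: target_eq.
by move=> j' c' c'c; exact: stage_stable.
Qed.

(** By induction on the rank, [d (solution c) = target solution c] has a solution
    because the right-hand side is a cycle: the solution restricts to a
    primitive of [f] on the boundary of [c], and [f] is a cycle. *)
Lemma diff_solution n j (c : X j) (s : m + 1 = m + 1) : (sf_rank c < n)%N ->
  hdiff s (extend solution) _ _ erefl (el c) = f _ _ erefl (el c).
Proof.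
elim/ltn_ind: n j c => n IH j c cn.
have e1 : m + 1 + j = m + j + 1 by lia.
set bd := diff (kp_idx1 j) (el c).
have e3 : m + (j - 1) = m + j - 1 by lia.
have e4 : m + j = m + j - 1 + 1 by lia.
have e5 : j - 1 = j - 1 - 1 + 1 by lia.
have e6 : m + 1 + (j - 1 - 1) = m + j - 1 by lia.
have bdE : hdiff s (extend solution) _ _ e3 bd = f _ _ e3 bd.
  move: (diff_el_supp (kp_idx1 j) c); apply: supp_linear_eq => [||i' j' q b c' c'c].
  - exact: (dghf_linear (hdiff s (extend solution)) e3).
  - exact: (dghf_linear f e3).
  have r : i' + (m + j') = m + j - 1 by lia.
  rewrite (fterm_cell_el (nu_id R)) (dghf_act (hdiff s _) q e3 erefl r).
  by rewrite (dghf_act f q e3 erefl r) (IH (sf_rank c)).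
have ztarget : is_cycle (target solution c).
  apply: (cycleI (p := e4)); rewrite diffD diff_ksign.
  rewrite (hcycleE erefl e3 (kp_idx1 j) e4 _ zf) -/bd -bdE.
  rewrite (hdiffE s _ e3 bd (kp_idx2 j) e6 e5 e4) diff_diff dghf0 ksign0 subr0.
  rewrite !ksignE oddzD oddz1.
  by case: (oddz m); rewrite /= ?addNr ?addrN.
rewrite (hdiffE s _ erefl (el c) e1 (kp_idx2 j) (kp_idx1 j) erefl) -/bd.
have -> : extend solution _ _ e1 (el c) = primitive (target solution c).
  have -> : extend solution _ _ e1 (el c)
            = recast e1 (extend solution _ _ erefl (el c)).
    exact: (dghf_recast (extend solution) erefl e1 erefl e1).
  rewrite [extend _ _ _ _ _]cell_ext_el solutionE /step.
  move: (primitive _) => y; rewrite /recast.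
  by case: _ / (kp_idx3 j) e1 => e1; rewrite (eq_irrelevance e1 erefl).
by rewrite diff_primitive // addrK.
Qed.

Lemma semifree_primitive : hboundary f.
Proof.
exists (m + 1), erefl, (extend solution); apply: dghom_cell_eq => j c j' p.
subst j'; exact: (diff_solution erefl (ltnSn _)).
Qed.
End KProjective.

Lemma semifree_id_K_projective (k : comPzRingType) (R : dgalgebra k)
    (X : semifree_system R) : K_projective (semifree X (nu_id R)).
Proof.
move=> Y Ya; apply/hom_acyclicP => m f zf.
exact: semifree_primitive.
Qed.

Section Consequences.
Variables (k : comPzRingType) (R B : dgalgebra k) (X : semifree_system R).
Variable phi : nonunital_morphism R B.

Lemma semifree_hom_acyclic Y : unit_acyclic phi Y -> hom_acyclic (semifree X phi) Y.
Proof. by move=> /unit_acyclicP Ya; apply/hom_acyclic_adj/semifree_id_K_projective. Qed.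

Lemma semifree_K_projective : K_projective (semifree X phi).
Proof. by move=> Y Ya; apply: semifree_hom_acyclic; exact: acyclic_unit. Qed.
End Consequences.

(** * The unit is a quasi-isomorphism *)

(** Transports a property of a cell along an equality in the total space, where
    degrees cannot be rewritten separately. *)
Lemma existT_ind (X : int -> Type) (P : forall j, X j -> Prop) j (c : X j) j' (c' : X j') :
  existT X j' c' = existT X j c -> P j c -> P j' c'.
Proof.
move=> E Pc; pose P' (t : {j : int & X j}) := P (projT1 t) (projT2 t).
by rewrite -[P j' c']/(P' (existT X j' c')) E.
Qed.

Section Coefficients.
Variables (k : comPzRingType) (B : dgalgebra k) (e : B 0) (X : int -> Type).
Hypothesis e_idem : dmul (addr0 0) e e = e.
Variables (j : int) (c : X j).

Lemma coef_idx (i n i' j' : int) : i + j = n -> i' + j' = n -> j' = j -> i' = i.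
Proof. lia. Qed.

Lemma dmul_unit_unit i (p q : i + 0 = i) (b : B i) :
  dmul q (dmul p b e) e = dmul p b e.
Proof. by rewrite (dmulA p q (addr0 0) p) e_idem. Qed.

(** Formal sums know the coefficient [b] of [c] only through [b e]. *)
Definition coef_fun n i (q : i + j = n) i' j' (p : i' + j' = n) (b : B i') (c' : X j') :
    B i :=
  if pselect (existT X j' c' = existT X j c) is left E
  then recast (coef_idx q p (congr1 (@projT1 _ _) E)) (dmul (addr0 i') b e)
  else 0.

Program Definition coef_bal n i (q : i + j = n) : balanced e X n (B i) :=
  {| balf := coef_fun q |}.
Next Obligation.
move=> n i q i' j' p c' a x y; rewrite /coef_fun; case: pselect => E.
  move: (coef_idx _ _ _) => Ei; case: i / Ei q => q; rewrite !recast_id.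
  by rewrite dmul_linearl.
by rewrite scaler0 addr0.
Qed.
Next Obligation.
move=> n i q i' j' p r b c'; rewrite /coef_fun; case: pselect => // E.
by rewrite dmul_unit_unit (eq_irrelevance r (addr0 i')).
Qed.

Definition coef n i (q : i + j = n) : freemod e X n -> B i := free_lift (coef_bal q).

Lemma coef_linear n i (q : i + j = n) : linear (coef q).
Proof. exact: free_lift_linear. Qed.
Lemma coef_same n i (q : i + j = n) (r : i + 0 = i) b :
  coef q (fterm e q b c) = dmul r b e.
Proof.
rewrite /coef free_lift_gen /= /coef_fun; case: pselect => // E.
by rewrite recast_id (eq_irrelevance r (addr0 i)).
Qed.
Lemma coef_supp (S : forall j, X j -> Prop) n i (q : i + j = n) (x : freemod e X n) :
  ~ S j c -> supp S x -> coef q x = 0.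
Proof.
move=> nSc; elim=> [|i' j' p b c' u Sc' _ IHu]; first exact: (linear_zero (coef_linear q)).
rewrite (linear_add (coef_linear q)) IHu addr0 /coef free_lift_gen /= /coef_fun.
case: pselect => // E; case: nSc.
by apply: (existT_ind (P := S) (esym E)).
Qed.

(** Collects the terms at [c]. *)
Lemma supp_split (S : forall j, X j -> Prop) n i (q : i + j = n) (x : freemod e X n) :
  supp (fun j' c' => S j' c' \/ existT X j' c' = existT X j c) x ->
  exists (b : B i) (x' : freemod e X n), supp S x' /\ x = fterm e q b c + x'.
Proof.
elim=> [|i' j' p b c' u Sc' _ [b0 [x0 [Sx0 ->]]]].
  by exists 0, 0; split; [exact: supp0|rewrite fterm0 addr0].
case: Sc' => [Sc'|E].
  by exists b0, (fterm e p b c' + x0); split; [exact: suppS|rewrite addrCA].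
have [b' ->] : exists b', fterm e p b c' = fterm e q b' c.
  move: i' p b; apply: (existT_ind (P := fun j' c' => forall i' (p : i' + j' = n) b,
    exists b', fterm e p b c' = fterm e q b' c) E) => i' p b.
  have Ei : i = i' by lia.
  by subst i'; exists b; exact: fterm_irr.
by exists (b' + b0), x0; rewrite addrA -ftermD.
Qed.
End Coefficients.

Lemma supp_empty (k : comPzRingType) (B : dgalgebra k) (e : B 0) (X : int -> Type) n
  (x : freemod e X n) : supp (fun _ _ => False) x -> x = 0.
Proof. by elim. Qed.

Lemma supp_all (k : comPzRingType) (B : dgalgebra k) (e : B 0) (X : int -> Type) n
  (x : freemod e X n) : supp (fun _ _ => True) x.
Proof. by move: x; apply: free_ind => [|*]; [exact: supp0|exact: suppS]. Qed.

Section Attachment.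
Variables (k : comPzRingType) (R : dgalgebra k) (X : semifree_system R).
Implicit Types S : forall j, X j -> Prop.

(** Finite sets of cells obtained by attaching one cell at a time, each along
    a boundary supported on the cells already present. *)
Inductive attachable : (forall j, X j -> Prop) -> Prop :=
| attach0 : attachable (fun _ _ => False)
| attachS S j (c : X j) :
    attachable S -> ~ S j c ->
    (forall n (p : j = n + 1), supp S (cell_bd p c)) ->
    attachable (fun j' c' => S j' c' \/ existT X j' c' = existT X j c).

Lemma attachable_closed S : attachable S ->
  forall m n (p : m = n + 1) (c : X m), S m c -> supp S (cell_bd p c).
Proof.
elim=> [//|{}S j c _ IHS _ Sc] m n p c' [Sc'|E].
  by apply: supp_mono (IHS _ _ _ _ Sc') => *; left.
move: n p; apply: (existT_ind (P := fun m c' => forall n (p : m = n + 1),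
  supp _ (cell_bd p c')) E) => n p.
by apply: supp_mono (Sc n p) => *; left.
Qed.

Lemma supp_celld (B : dgalgebra k) (phi : nonunital_morphism R B) S m n (p : m = n + 1)
    (x : freemod (nu_unit phi) X m) :
  (forall m n (p : m = n + 1) (c : X m), S m c -> supp S (cell_bd p c)) ->
  supp S x -> supp S (celld phi p x).
Proof.
move=> Sbd; elim=> [|i j q b c u Sc _ IHu].
  by rewrite (linear_zero (celld_linear p)); exact: supp0.
have e1 : i - 1 + j = n by lia.
have e2 : i = i - 1 + 1 by lia.
have e3 : i + (j - 1) = n by lia.
have e4 : j = j - 1 + 1 by lia.
rewrite celldD (celld_gen phi p q b c e1 e2 e3 e4); apply: supp_add => //.
apply: supp_add; first exact: supp_gen.
by apply: supp_ksign; apply: supp_push; exact: Sbd.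
Qed.

(** Induction on the rank: the finitely many cells of the boundary of [c] are
    attached first. *)
Lemma attachable_cell S j (c : X j) : attachable S ->
  exists S', [/\ attachable S', forall i c', S i c' -> S' i c' & S' j c].
Proof.
have [r] := ubnP (sf_rank c); elim: r S j c => // r IHr S j c /ltnSE cr aS.
have p0 : j = j - 1 + 1 by lia.
have [S1 [aS1 SS1 S1bd]] : exists S1, [/\ attachable S1,
    forall i c', S i c' -> S1 i c' & supp S1 (cell_bd p0 c)].
  elim: (sf_bd_rank p0 c) => [|i' j' q b c' x c'c _ [S1 [aS1 SS1 S1x]]].
    by exists S; split=> //; exact: supp0.
  have [S2 [aS2 S12 S2c']] := IHr S1 _ c' (leq_trans c'c cr) aS1.
  exists S2; split=> // [i d /SS1/S12//|].
  by apply: suppS => //; exact: supp_mono S1x.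
have [S1c|S1c] := pselect (S1 j c); first by exists S1.
exists (fun j' c' => S1 j' c' \/ existT X j' c' = existT X j c); split.
- apply: attachS => // n p; have E : n = j - 1 by lia.
  by subst n; rewrite (eq_irrelevance p p0).
- by move=> i c' /SS1; left.
- by right.
Qed.

Lemma attachable_supp (B : dgalgebra k) (e : B 0) n (x : freemod e X n) S : attachable S ->
  exists S', [/\ attachable S', forall i c', S i c' -> S' i c' & supp S' x].
Proof.
move=> aS; elim: (supp_all x) => [|i' j' q b c' u _ _ [S1 [aS1 SS1 S1x]]].
  by exists S; split=> //; exact: supp0.
have [S2 [aS2 S12 S2c']] := attachable_cell c' aS1.
exists S2; split=> // [i d /SS1/S12//|].
by apply: suppS => //; exact: supp_mono S1x.
Qed.
End Attachment.

Lemma diff_fterm (k : comPzRingType) (R B : dgalgebra k) (X : semifree_system R)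
    (phi : nonunital_morphism R B) m n (p : m = n + 1) i j (q : i + j = m) b (c : X j)
    i' (q' : i' + j = n) (s : i = i' + 1) j' (t : i + j' = n) (u : j = j' + 1) :
  diff p (fterm _ q b c : semifree X phi m) =
  fterm _ q' (diff s b) c + ksign i (push (erefl : phi 0 _ = _) t b (cell_bd u c)).
Proof. exact: celld_gen. Qed.

Section UnitQuasiIso.
Variables (k : comPzRingType) (R B : dgalgebra k) (X : semifree_system R).
Variable phi : nonunital_morphism R B.
Notation e := (nu_unit phi).
Notation G := (semifree X phi).
Notation Q := (semifree X (nu_id R)).

(** [phi] induces a quasi-isomorphism from [R] to [eBe]. *)
Definition corner_quasi_iso : Prop :=
  (forall n (r : R n), is_cycle r -> is_boundary (phi n r) -> is_boundary r) /\
  (forall n (b : B n), is_cycle b ->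
     dmul (add0r n) e b = b -> dmul (addr0 n) b e = b ->
     exists2 r : R n, is_cycle r & homologous (phi n r) b).

Hypothesis phi_qis : corner_quasi_iso.

Lemma diff_unit_mul m n (p : m = n + 1) (b : B m) :
  diff p (dmul (add0r m) e b) = dmul (add0r n) e (diff p b).
Proof.
have q : 0 = -1 + 1 :> int by [].
have pl : -1 + m = n by lia.
rewrite (dmul_leibniz (add0r m) pl (add0r n) q p p) nu_unit_cycle.
by rewrite dmul0l add0r ksignE.
Qed.
Lemma diff_mul_unit m n (p : m = n + 1) (b : B m) :
  diff p (dmul (addr0 m) b e) = dmul (addr0 n) (diff p b) e.
Proof.
have q : 0 = -1 + 1 :> int by [].
have pr : m + -1 = n by lia.
rewrite (dmul_leibniz (addr0 m) (addr0 n) pr p q p) nu_unit_cycle.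
by rewrite dmul0r ksign0 addr0.
Qed.

(** The cone of [R -> eBe] is acyclic, in terms of elements. *)
Lemma corner_relative_lift l m n (p : m = n + 1) (q : l = m + 1) (y : R n) (w : B m) :
  is_cycle y -> dmul (add0r m) e w = w -> dmul (addr0 m) w e = w ->
  diff p w = phi n y ->
  exists (r : R m) (v : B l),
    [/\ diff p r = y, phi m r - w = diff q v & dmul (add0r l) e v = v].
Proof.
move=> zy ew we dw.
have /(boundaryE p)[r0 dr0] : is_boundary y.
  by apply: (proj1 phi_qis) => //; rewrite -dw; exact: boundaryI.
have [|||r1 zr1 /(boundaryE q)[v dv]] := proj2 phi_qis m (phi m r0 - w).
- by apply: (cycleI (p := p)); rewrite diffB dw -nuf_diff dr0 subrr.
- by rewrite dmulBr nu_unit_mull ew.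
- by rewrite dmulBl nu_unit_mulr we.
exists (r0 - r1), (dmul (add0r l) e (- v)); split.
- by rewrite diffB dr0 zr1 subr0.
- rewrite diff_unit_mul diffN dv opprB !dmulBr !nu_unit_mull ew nufB.
  by rewrite addrAC.
- by rewrite -(dmulA (add0r 0) (add0r l)) nu_unit_idem.
Qed.

(** The acyclicity of the cone of [Q -> e(Be (x) Q)], for elements [y] and [w]
    supported on an attachable set of cells.  The last cell [c] of the set lies
    in the boundary of no other cell of the set, so the coefficients [a] and [b]
    of [y] and [w] at [c] satisfy [d a = 0] and [d b = phi a].  Then
    [corner_relative_lift] gives [r] and [v] with [d r = a] and
    [phi r - b = d v], and correcting [y] and [w] by [r c] and [v c] removes [c]
    from their supports. *)
Lemma unit_mor_relative_lift (S : forall j, X j -> Prop) : attachable S ->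
  forall l m n (p : m = n + 1) (q : l = m + 1) (y : Q n) (w : G m),
  supp S y -> supp S w -> is_cycle y -> act (add0r m) e w = w ->
  diff p w = restr_val (unit_mor X phi n y) ->
  exists (x : Q m) (v : G l), diff p x = y /\ restr_val (unit_mor X phi m x) - w = diff q v.
Proof.
elim=> [|{}S j c aS IHS nSc Sc] l m n p q y w Sy Sw zy ew dw.
  exists 0, 0; rewrite !diff0 mor0 (supp_empty Sy) (supp_empty Sw).
  by split=> //; rewrite subr0.
have Sbd := attachable_closed aS.
have q1 : n - j + j = n by lia.
have q2 : m - j + j = m by lia.
have q3 : l - j + j = l by lia.
have q0 : n - j - 1 + j = n - 1 by lia.
have s1 : m - j = n - j + 1 by lia.
have s2 : l - j = m - j + 1 by lia.
have s0 : n - j = n - j - 1 + 1 by lia.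
have sn : n = n - 1 + 1 by lia.
have sj : j = j - 1 + 1 by lia.
have t0 : n - j + (j - 1) = n - 1 by lia.
have t1 : m - j + (j - 1) = n by lia.
have t2 : l - j + (j - 1) = m by lia.
have [a [y' [Sy' yE]]] := supp_split q1 Sy.
have [b0 [w0 [Sw0 wE0]]] := supp_split q2 Sw.
(* [w] is fixed by [e], so its coefficient may be replaced by [e b0 e]. *)
pose b : B (m - j) := dmul (addr0 _) (dmul (add0r _) e b0) e.
pose w' : G m := act (add0r m) e (w0 : G m).
have wE : w = fterm e q2 b c + w'.
  rewrite -ew wE0 actDr; congr (_ + _).
  by rewrite [LHS](push_gen _ _ _ q2 b0 c q2 (add0r _)) fterm_unit.
have Sw' : supp S w' by exact: supp_push.
have eb : dmul (add0r _) e b = b.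
  rewrite /b -(dmulA (add0r _) (addr0 _) (addr0 _) (add0r _)).
  by rewrite -(dmulA (add0r 0) (add0r _)) nu_unit_idem.
have be : dmul (addr0 _) b e = b by exact: dmul_unit_unit (nu_unit_idem phi _) _ _ _ _.
have idR : dmul (addr0 0) (nu_unit (nu_id R)) (nu_unit (nu_id R)) = nu_unit (nu_id R).
  exact: nu_unit_idem.
have za : is_cycle a.
  apply: (cycleI (p := s0)).
  have := zy _ sn; rewrite yE diffD.
  rewrite (diff_fterm (nu_id R) sn q1 a c q0 s0 t0 sj).
  move=> /(congr1 (coef idR c q0)).
  rewrite (linear_zero (coef_linear _ _ _)) !(linear_add (coef_linear _ _ _)).
  rewrite (coef_same _ _ _ (addr0 _)) dmul1r.
  rewrite (coef_supp _ _ nSc); last by apply/supp_ksign/supp_push/Sc.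
  rewrite (coef_supp _ _ nSc); last exact: supp_celld.
  by rewrite !addr0.
have eI := nu_unit_idem phi (addr0 0).
have db : diff s1 b = phi _ a.
  have := dw; rewrite wE yE diffD.
  rewrite (diff_fterm phi p q2 b c q1 s1 t1 sj).
  rewrite (linear_add (dgmf_linear (unit_mor X phi) (n := n))).
  move=> /(congr1 (coef eI c q1)).
  rewrite -[restr_val (_ + _)]/(restr_val (unit_mor X phi n _) + restr_val (unit_mor X phi n _)).
  rewrite unit_mor_gen !(linear_add (coef_linear _ _ _)) !(coef_same _ _ _ (addr0 _)).
  rewrite (coef_supp _ _ nSc); last by apply/supp_ksign/supp_push/Sc.
  rewrite (coef_supp _ _ nSc); last exact: supp_celld.
  rewrite (coef_supp _ _ nSc); last exact: supp_push.
  by rewrite !addr0 -diff_mul_unit be nu_unit_mulr.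
have [r [v0 [dr rv0 ev0]]] := corner_relative_lift s2 za eb be db.
pose rc : Q m := fterm _ q2 r c.
pose vc : G l := fterm e q3 v0 c.
have drc : diff p rc = fterm _ q1 a c + ksign (m - j) (push erefl t1 r (cell_bd sj c)).
  by rewrite [LHS](celld_gen (nu_id R) p q2 r c q1 s1 t1 sj) dr.
have dvc : diff q vc = fterm e q2 (diff s2 v0) c
    + ksign (l - j) (push (erefl : phi 0 _ = e) t2 v0 (cell_bd sj c)).
  exact: (celld_gen phi q q3 v0 c q2 s2 t2 sj).
pose w2 : G m := w - restr_val (unit_mor X phi m rc) + diff q vc.
have urc : diff p (restr_val (unit_mor X phi m rc)) = restr_val (unit_mor X phi n (diff p rc)).
  by rewrite dgmf_diff.
have uD n1 (x1 x2 : Q n1) : restr_val (unit_mor X phi n1 (x1 - x2)) =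
    restr_val (unit_mor X phi n1 x1) - restr_val (unit_mor X phi n1 x2).
  by rewrite morB.
have [|||||x2 [v2 [dx2 uxv2]]] := IHS _ _ _ p q (y - diff p rc) w2.
- rewrite yE drc opprD addrACA subrr add0r; apply: supp_add => //.
  by apply/supp_opp/supp_ksign/supp_push/Sc.
- rewrite /w2 wE unit_mor_gen dvc -rv0 ftermB addrA subrKA.
  rewrite [_ + w']addrC addrK.
  by apply: supp_add => //; apply/supp_ksign/supp_push/Sc.
- by apply: cycleB => //; apply: boundary_cycle; exact: boundaryI.
- rewrite /w2 actDr actBr ew restr_fix; congr (_ + _).
  rewrite -(diff_act0 (nu_unit_cycle phi) (add0r l)); congr diff.
  by rewrite [LHS](push_gen _ _ _ q3 v0 c q3 (add0r _)) ev0.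
- by rewrite /w2 diffD diffB dw urc diff_diff addr0 uD.
exists (x2 + rc), (v2 + vc); split; first by rewrite diffD dx2 subrK.
rewrite diffD -uxv2 -[rc]opprK uD.
have -> : restr_val (unit_mor X phi m (- rc)) = - restr_val (unit_mor X phi m rc).
  by rewrite morN.
by rewrite opprK /w2 opprD addrA subrK opprB addrA.
Qed.

(** Finitely many cells occur in given elements, so an attachable set contains
    them.  Injectivity uses the lift for [d w = y], surjectivity for [y = 0]. *)
Lemma unit_mor_qis : dgm_quasi_iso (unit_mor X phi).
Proof.
move=> n; split=> [y zy /(boundaryE erefl)[w dw]|w zw].
  have [S1 [aS1 _ S1y]] := attachable_supp y (attach0 X).
  have [S [aS S1S Sw]] := attachable_supp (restr_val w) aS1.
  have [|||||x [v [dx _]]] := unit_mor_relative_lift aS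
      erefl (p := erefl) (y := y) (w := restr_val w).
  - exact: supp_mono S1y.
  - by [].
  - by [].
  - exact: restr_fix.
  - by rewrite -dw.
  by exists (n + 1), erefl, x.
have p : n = n - 1 + 1 by lia.
have [S [aS _ Sw]] := attachable_supp (restr_val w) (attach0 X).
have [|||||x [v [dx xv]]] := unit_mor_relative_lift aS
    erefl (p := p) (y := 0) (w := restr_val w).
- exact: supp0.
- by [].
- exact: cycle0.
- exact: restr_fix.
- by rewrite (proj1 (restr_cycle w) zw) mor0.
exists x; first exact: (cycleI (p := p)).
by apply/restr_homologous; exists (n + 1), erefl, v.
Qed.
End UnitQuasiIso.

(** * The functorial semifree resolution *)

Section RawCells.
Variables (k : comPzRingType) (R : dgalgebra k).

(** A cell over [x] with boundary the formal sum of the terms [r l * c l].  The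
    requirement that this sum be a cycle lying over [d x] refers to the
    boundaries of the cells [c l], so it is imposed afterwards: see [good]. *)
Inductive rcell (N : dgmodule R) : int -> Type :=
  RCell (n : int) (x : N n) (sz : nat) (di dj : 'I_sz -> int)
    (p : forall l, di l + dj l + 1 = n) (r : forall l, R (di l))
    (c : forall l, rcell N (dj l)) : rcell N n.

Notation one := (nu_unit (nu_id R)).

Lemma rcell_idx (i j m n : int) : i + j + 1 = m -> m = n + 1 -> i + j = n.
Proof. lia. Qed.

Definition rcell_bd N m n (q : m = n + 1) (c : rcell N m) : freemod one (rcell N) n :=
  match c in rcell _ m0 return m0 = n + 1 -> freemod one (rcell N) n with
  | RCell m0 _ sz di dj p r c' => fun q =>
      \sum_(l < sz) fterm one (rcell_idx (p l) q) (r l) (c' l)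
  end q.

Definition raw_system N : cell_system R := CellSystem (@rcell_bd N).

Definition rcell_val N m (c : rcell N m) : N m :=
  match c with RCell _ x _ _ _ _ _ _ => x end.

Fixpoint rcell_rank N m (c : rcell N m) : nat :=
  match c with
  | RCell _ _ sz di dj p r c' => \max_(l < sz) (rcell_rank (c' l)).+1
  end.

Section Augmentation.
Variables (N : dgmodule R) (X : int -> Type) (val : forall j, X j -> N j).

(** The map to [N] sending [r c] to [r] times the point [val c] under the cell
    [c]. *)
Program Definition aug_bal n : balanced one X n (N n) :=
  {| balf := fun i j p r c => act p r (val c) |}.
Next Obligation. by move=> n i j p c a x y; rewrite act_linearl. Qed.
Next Obligation.
by move=> n i j p q r c /=; rewrite dmul1r.
Qed.

Definition aug n : freemod one X n -> N n := free_lift (aug_bal n).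

Lemma aug_linear n : linear (@aug n).
Proof. exact: free_lift_linear. Qed.
Lemma aug_gen n i j (p : i + j = n) r (c : X j) : aug (fterm one p r c) = act p r (val c).
Proof. exact: free_lift_gen. Qed.
End Augmentation.

Definition cell_condition N m (c : rcell N m) : Prop :=
  forall n (q : m = n + 1),
    aug (@rcell_val N) (rcell_bd q c) = diff q (rcell_val c) /\
    forall l (s : n = l + 1), celld (X := raw_system N) (nu_id R) s (rcell_bd q c) = 0.

(** Hereditary, so that the boundary of a good cell is a sum of good cells. *)
Fixpoint good N m (c : rcell N m) : Prop :=
  match c with
  | RCell _ _ _ _ _ _ _ c' => forall l, good (c' l)
  end /\ cell_condition c.

Lemma good_condition N m (c : rcell N m) : good c -> cell_condition c.
Proof. by case: m / c => ? ? ? ? ? ? ? ? []. Qed.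

Lemma good_bd N m n (q : m = n + 1) (c : rcell N m) : good c -> supp (@good N) (rcell_bd q c).
Proof.
case: m / c q => m x sz di dj p r c q [gc _] /=.
apply: supp_sum => l; apply: supp_gen; exact: gc.
Qed.

Lemma rank_bd N m n (q : m = n + 1) (c : rcell N m) :
  supp (fun j c' => (rcell_rank c' < rcell_rank c)%N) (rcell_bd q c).
Proof.
case: m / c q => m x sz di dj p r c q /=.
apply: supp_sum => l; apply: supp_gen.
exact: (@leq_bigmax _ (fun l => (rcell_rank (c l)).+1) l).
Qed.

Section GoodCells.
Variable N : dgmodule R.

Definition gcell j : Type := {c : rcell N j | good c}.
Definition gcell_raw j (c : gcell j) : rcell N j := sval c.

Definition restrict_fun n i j (p : i + j = n) (r : R i) (c : rcell N j) : freemod one gcell n :=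
  if pselect (good c) is left g then fterm one p r (exist _ c g : gcell j) else 0.

Program Definition restrict_bal n : balanced one (rcell N) n (freemod one gcell n) :=
  {| balf := @restrict_fun n |}.
Next Obligation.
move=> n i j p c a x y; rewrite /restrict_fun; case: pselect => g.
  by rewrite fterm_linear.
by rewrite scaler0 addr0.
Qed.
Next Obligation.
move=> n i j p q r c; rewrite /restrict_fun; case: pselect => // g.
by rewrite fterm_unit.
Qed.

(** A left inverse of the inclusion of formal sums of good cells into all formal
    sums.  It shows that this inclusion is injective, so that identities such as
    [d d = 0] can be checked among raw cells. *)
Definition restrict_good n : freemod one (rcell N) n -> freemod one gcell n :=
  free_lift (restrict_bal n).

Lemma restrict_linear n : linear (@restrict_good n).
Proof. exact: free_lift_linear. Qed.

Lemma restrict_gen n i j (p : i + j = n) r (c : gcell j) :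
  restrict_good (fterm one p r (gcell_raw c)) = fterm one p r c.
Proof.
rewrite /restrict_good free_lift_gen /= /restrict_fun.
case: c => c g /=; case: pselect => // g'.
by rewrite (Prop_irrelevance g' g).
Qed.

Lemma restrictK n (x : freemod one gcell n) : restrict_good (cellmap gcell_raw x) = x.
Proof.
move: x; apply: free_linear_eq => [||i j p r c].
- move=> a x y; rewrite cellmap_linear.
  exact: restrict_linear.
- by [].
by rewrite cellmap_gen restrict_gen.
Qed.

Lemma raw_restrict n (x : freemod one (rcell N) n) :
  supp (@good N) x -> cellmap gcell_raw (restrict_good x) = x.
Proof.
elim=> [|i j p b c u gc _ IHu].
  by rewrite (linear_zero (@restrict_linear n)) (linear_zero (@cellmap_linear _ _ _ _ _ _ n)).
rewrite (linear_add (@restrict_linear n)) (linear_add (@cellmap_linear _ _ _ _ _ _ n)) IHu.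
by rewrite -[c]/(gcell_raw (exist _ c gc : gcell j)) restrict_gen cellmap_gen.
Qed.

Definition gcell_bd m n (q : m = n + 1) (c : gcell m) : freemod one gcell n :=
  restrict_good (rcell_bd q (gcell_raw c)).

Definition good_system : cell_system R := CellSystem gcell_bd.

Lemma raw_gcell_bd m n (q : m = n + 1) (c : gcell m) :
  cellmap gcell_raw (gcell_bd q c) = rcell_bd q (gcell_raw c).
Proof. by apply: raw_restrict; apply: good_bd; exact: svalP c. Qed.

Lemma raw_celld m n (p : m = n + 1) (x : freemod one gcell m) :
  cellmap gcell_raw (celld (X := good_system) (nu_id R) p x) =
  celld (X := raw_system N) (nu_id R) p (cellmap gcell_raw x).
Proof.
apply: (cellmap_celld (X := good_system) (X' := raw_system N) (f := gcell_raw)).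
by move=> m' n' p' c; rewrite /= raw_gcell_bd.
Qed.

Lemma gcell_bd_cycle l m n (p : l = m + 1) (q : m = n + 1) (c : gcell l) :
  celld (X := good_system) (nu_id R) q (gcell_bd p c) = 0.
Proof.
rewrite -[LHS]restrictK raw_celld raw_gcell_bd.
rewrite (proj2 (good_condition (svalP c) p)).
exact: (linear_zero (@restrict_linear n)).
Qed.

Lemma gcell_bd_rank m n (p : m = n + 1) (c : gcell m) :
  supp (fun j c' => (rcell_rank (gcell_raw c') < rcell_rank (gcell_raw c))%N) (gcell_bd p c).
Proof.
rewrite /gcell_bd; elim: (rank_bd p (gcell_raw c)) => [|i j q b c' u c'c _ IHu].
  by rewrite (linear_zero (@restrict_linear n)); exact: supp0.
rewrite (linear_add (@restrict_linear n)); apply: supp_add => //.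
rewrite /restrict_good free_lift_gen /= /restrict_fun; case: pselect => [g|_].
  exact: supp_gen.
exact: supp0.
Qed.

Definition resolution_system : semifree_system R :=
  @SemifreeSystem _ _ good_system gcell_bd_cycle
    (fun j c => rcell_rank (gcell_raw c)) gcell_bd_rank.

Definition gcell_val j (c : gcell j) : N j := rcell_val (gcell_raw c).

Lemma aug_raw n (x : freemod one gcell n) :
  aug (@rcell_val N) (cellmap gcell_raw x) = aug gcell_val x.
Proof.
move: x; apply: free_linear_eq => [||i j p r c].
- move=> a x y; rewrite cellmap_linear; exact: aug_linear.
- exact: aug_linear.
by rewrite cellmap_gen !aug_gen.
Qed.

Lemma aug_gcell_bd m n (p : m = n + 1) (c : gcell m) :
  aug gcell_val (gcell_bd p c) = diff p (gcell_val c).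
Proof.
by rewrite -aug_raw raw_gcell_bd (proj1 (good_condition (svalP c) p)).
Qed.

Notation Q := (semifree resolution_system (nu_id R)).

Lemma aug_push i n m (p : i + n = m) (a : R i) (x : freemod one gcell n) :
  aug gcell_val (push (psi := nu_id R) erefl p a x) = act p a (aug gcell_val x).
Proof.
move: x; apply: free_linear_eq => [||i' j' q r c].
- move=> u x y; rewrite push_linear; exact: aug_linear.
- by move=> u x y; rewrite aug_linear act_linearr.
have s : i + i' + j' = m by lia.
rewrite (push_gen _ p a q r c s erefl) !aug_gen.
exact: actA.
Qed.

Program Definition resolution_mor : dgm_morphism Q N :=
  {| dgmf := fun n x => aug gcell_val x |}.
Next Obligation. by move=> n; exact: aug_linear. Qed.
Next Obligation.
move=> m n p; apply: free_linear_eq => [||i j q r c].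
- by move=> a x y; rewrite diff_linear; exact: aug_linear.
- by move=> a x y; rewrite aug_linear diff_linear.
have e1 : i - 1 + j = n by lia.
have e2 : i = i - 1 + 1 by lia.
have e3 : i + (j - 1) = n by lia.
have e4 : j = j - 1 + 1 by lia.
rewrite (diff_fterm (X := resolution_system) (nu_id R) p q r c e1 e2 e3 e4).
rewrite (linear_add (@aug_linear _ _ _ n)) (linear_ksign (@aug_linear _ _ _ n)).
rewrite !aug_gen aug_push [aug _ _]aug_gcell_bd.
by rewrite (act_leibniz q e1 e3 e2 e4 p).
Qed.
Next Obligation. by move=> i j n p a x; exact: aug_push. Qed.

Lemma resolution_mor_el j (c : gcell j) :
  resolution_mor j (cell_el (X := resolution_system) (nu_id R) c) = gcell_val c.
Proof. by rewrite [LHS]aug_gen act1. Qed.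

(** Every permitted boundary occurs, whatever list of terms represents it. *)
Lemma new_cell m n (p : m = n + 1) (x : N m) (y : Q n) :
  is_cycle y -> resolution_mor n y = diff p x ->
  exists c : gcell m, gcell_val c = x /\ gcell_bd p c = y.
Proof.
move=> zy yx.
have [s ys] : exists s : seq (gen R gcell n),
    y = \sum_(g <- s) fterm one (gen_deg g) (gen_coef g) (gen_cell g).
  move: {zy yx} y; apply: free_ind => [|i j q r c u [s ->]].
    by exists [::]; rewrite big_nil.
  by exists (Gen q r c :: s); rewrite big_cons.
pose t := in_tuple s.
have P l : gen_i (tnth t l) + gen_j (tnth t l) + 1 = m.
  by rewrite (gen_deg (tnth t l)) p.
pose c : rcell N m := RCell x P (fun l => gen_coef (tnth t l))
  (fun l => gcell_raw (gen_cell (tnth t l))).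
have bdc : rcell_bd p c = cellmap gcell_raw y.
  rewrite ys (linear_bigsum (@cellmap_linear _ _ _ _ _ _ n)) [RHS]big_tnth /=.
  apply: eq_bigr => l _; rewrite cellmap_gen; exact: fterm_irr.
have gc : good c.
  split=> [l|]; first exact: svalP (gen_cell (tnth t l)).
  move=> n' q; have E : n' = n by lia.
  subst n'; rewrite (eq_irrelevance q p) bdc aug_raw; split=> // l r.
  rewrite -raw_celld [celld _ _ _](zy l r).
  exact: (linear_zero (@cellmap_linear _ _ _ _ _ _ l)).
exists (exist _ c gc); split=> //.
by rewrite /gcell_bd [rcell_bd _ _]bdc restrictK.
Qed.

(** A cycle [y] over [d x] is the boundary of the cell attached along [y] over
    [x], and a cycle [x] is the image of the cell over [x] with zero boundary. *)
Lemma resolution_mor_qis : dgm_quasi_iso resolution_mor.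
Proof.
have dcell m n (p : m = n + 1) (c : gcell m) :
    diff p (cell_el (X := resolution_system) (nu_id R) c : Q m) = gcell_bd p c :> Q n.
  rewrite diff_cell_el.
  exact: (act1 (d := Q)).
move=> n; split=> [y zy /(boundaryE erefl)[x dx]|x zx].
  have [c [_ bdc]] := new_cell zy (esym dx).
  by exists (n + 1), erefl, (cell_el (X := resolution_system) (nu_id R) c); rewrite dcell.
have p : n = n - 1 + 1 by lia.
have [|c [cx bdc]] := new_cell (p := p) (x := x) (@cycle0 _ Q (n - 1)).
  by rewrite mor0 zx.
exists (cell_el (X := resolution_system) (nu_id R) c).
  by apply: (cycleI (p := p)); rewrite dcell.
by rewrite resolution_mor_el cx; exact: homologous_refl.
Qed.
End GoodCells.
End RawCells.

(** * Induction, unit and counit *)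

Section SemifreeMap.
Variables (k : comPzRingType) (R B : dgalgebra k) (phi : nonunital_morphism R B).
Variables (X X' : semifree_system R) (f : forall j, X j -> X' j).
Hypothesis fbd : forall m n (p : m = n + 1) c, cell_bd p (f c) = cellmap f (cell_bd p c).

Program Definition semifree_map : dgm_morphism (semifree X phi) (semifree X' phi) :=
  {| dgmf := fun n x => cellmap f x |}.
Next Obligation. by move=> n; exact: cellmap_linear. Qed.
Next Obligation. by move=> m n p x; exact: (cellmap_celld fbd). Qed.
Next Obligation. by move=> i j n p a x; exact: cellmap_push. Qed.

Lemma semifree_map_el j (c : X j) :
  semifree_map j (cell_el phi c) = cell_el phi (f c).
Proof. exact: cellmap_gen. Qed.
End SemifreeMap.

Section ResolutionMap.
Variables (k : comPzRingType) (R : dgalgebra k).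
Implicit Types N : dgmodule R.

Fixpoint rcell_map N N' (f : dgm_morphism N N') m (c : rcell N m) : rcell N' m :=
  match c in rcell _ m0 return rcell N' m0 with
  | RCell m0 x sz di dj p r c' => RCell (f m0 x) p r (fun l => rcell_map f (c' l))
  end.

Lemma rcell_bd_map N N' (f : dgm_morphism N N') m n (q : m = n + 1) (c : rcell N m) :
  rcell_bd q (rcell_map f c) = cellmap (@rcell_map _ _ f) (rcell_bd q c).
Proof.
case: m / c q => m x sz di dj p r c q /=.
rewrite (linear_bigsum (@cellmap_linear _ _ _ _ _ _ n)).
by apply: eq_bigr => l _; rewrite cellmap_gen.
Qed.

Lemma rcell_val_map N N' (f : dgm_morphism N N') m (c : rcell N m) :
  rcell_val (rcell_map f c) = f m (rcell_val c).
Proof. by case: m / c. Qed.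

Lemma aug_map N N' (f : dgm_morphism N N') n (x : freemod _ (rcell N) n) :
  aug (@rcell_val _ _ N') (cellmap (@rcell_map _ _ f) x) = f n (aug (@rcell_val _ _ N) x).
Proof.
move: x; apply: free_linear_eq => [||i j p r c].
- by move=> a x y; rewrite cellmap_linear; exact: aug_linear.
- by move=> a x y; rewrite aug_linear dgmf_linear.
by rewrite cellmap_gen !aug_gen rcell_val_map dgmf_act.
Qed.

Lemma good_map N N' (f : dgm_morphism N N') m (c : rcell N m) : good c -> good (rcell_map f c).
Proof.
elim: m / c => m x sz di dj p r c IHc [gc cc]; split=> [l|]; first exact: (IHc l (gc l)).
move=> n q; have [ac dc] := cc n q.
rewrite -/(rcell_map f (RCell x p r c)) rcell_bd_map aug_map ac dgmf_diff.
split=> [//|l s].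
rewrite -(cellmap_celld (X := raw_system N) (X' := raw_system N')); last first.
  by move=> *; exact: rcell_bd_map.
by rewrite dc (linear_zero (@cellmap_linear _ _ _ _ _ _ l)).
Qed.

Definition gcell_map N N' (f : dgm_morphism N N') m (c : gcell N m) : gcell N' m :=
  exist _ (rcell_map f (gcell_raw c)) (good_map f (svalP c)).

Lemma gcell_bd_map N N' (f : dgm_morphism N N') m n (q : m = n + 1) (c : gcell N m) :
  gcell_bd q (gcell_map f c) = cellmap (@gcell_map _ _ f) (gcell_bd q c).
Proof.
rewrite -[RHS]restrictK; congr restrict_good.
rewrite /= rcell_bd_map -raw_gcell_bd.
move: (gcell_bd q c); apply: free_linear_eq => [||i j p r c'].
- by move=> a x y; rewrite !cellmap_linear.
- by move=> a x y; rewrite !cellmap_linear.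
by rewrite !cellmap_gen.
Qed.

Lemma gcell_eq N m (c c' : gcell N m) : gcell_raw c = gcell_raw c' -> c = c'.
Proof.
case: c c' => [c g] [c' g'] /= E; subst c'.
by rewrite (Prop_irrelevance g g').
Qed.

Lemma rcell_map_ext N N' (f g : dgm_morphism N N') :
  (forall n x, f n x = g n x) -> forall m (c : rcell N m), rcell_map f c = rcell_map g c.
Proof.
move=> fg m c; elim: m / c => m x sz di dj p r c IHc /=.
by rewrite fg; congr RCell; apply: functional_extensionality_dep.
Qed.
Lemma rcell_map_id N m (c : rcell N m) : rcell_map (dgm_id N) c = c.
Proof.
elim: m / c => m x sz di dj p r c IHc /=.
by congr RCell; apply: functional_extensionality_dep.
Qed.
Lemma rcell_map_comp N N' N'' (g : dgm_morphism N' N'') (f : dgm_morphism N N') m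
    (c : rcell N m) : rcell_map (dgm_comp g f) c = rcell_map g (rcell_map f c).
Proof.
elim: m / c => m x sz di dj p r c IHc /=.
by congr RCell; apply: functional_extensionality_dep.
Qed.
End ResolutionMap.

Section Induction.
Variables (k : comPzRingType) (R B : dgalgebra k) (phi : nonunital_morphism R B).

(** [Be (x)_R QN], for the functorial semifree resolution [QN] of [N]. *)
Definition induced N : dgmodule B := semifree (resolution_system N) phi.

Definition induced_mor N N' (f : dgm_morphism N N') :
    dgm_morphism (induced N) (induced N') :=
  semifree_map phi (X := resolution_system N) (X' := resolution_system N')
    (f := @gcell_map _ _ _ _ f) (fun m n p c => gcell_bd_map f p c).

Lemma induced_mor_el N N' (f : dgm_morphism N N') j (c : gcell N j) :
  induced_mor f j (cell_el (X := resolution_system N) phi c) =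
  cell_el (X := resolution_system N') phi (gcell_map f c).
Proof. exact: semifree_map_el. Qed.

Program Definition induction_functor : functor (dgMod R) (dgMod B) :=
  {| fobj := fun N => induced N : dgMod B;
     fhom := fun N N' f => induced_mor f |}.
Next Obligation.
move=> N N' f g fg; apply: mor_cell_eq => j c; rewrite !induced_mor_el.
have -> : gcell_map f c = gcell_map g c by apply: gcell_eq; exact: rcell_map_ext.
by [].
Qed.
Next Obligation.
move=> N; apply: mor_cell_eq => j c; rewrite induced_mor_el /=.
have -> : gcell_map (dgm_id N) c = c by apply: gcell_eq; exact: rcell_map_id.
by [].
Qed.
Next Obligation.
move=> N N' N'' g f; apply: mor_cell_eq => j c.
rewrite -[RHS]/(induced_mor g j (induced_mor f j (cell_el phi c))).
rewrite !induced_mor_el.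
have -> : gcell_map (dgm_comp g f) c = gcell_map g (gcell_map f c).
  by apply: gcell_eq; exact: rcell_map_comp.
by [].
Qed.
End Induction.

Section UnitCounit.
Variables (k : comPzRingType) (R B : dgalgebra k) (phi : nonunital_morphism R B).
Implicit Types (N : dgmodule R) (M : dgmodule B).
Notation Q := (induced (nu_id R)).
Notation G := (induced phi).

(** The unit takes values in the restriction of [G N], but starts from the
    resolution of [N] since [G] is the left derived functor. *)
Definition ind_unit N : dgm_morphism (Q N) (restr phi (G N)) :=
  unit_mor (resolution_system N) phi.

Definition ind_counit M : dgm_morphism (G (restr phi M)) M :=
  adjoint (resolution_mor (restr phi M)).

Lemma ind_unit_natural N N' (f : dgm_morphism N N') n (x : Q N n) :
  ind_unit N' n (induced_mor (nu_id R) f n x) =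
  restr_mor phi (induced_mor phi f) n (ind_unit N n x).
Proof.
apply: val_inj => /=; rewrite cellmap_push.
by [].
Qed.

Lemma resolution_mor_natural N N' (f : dgm_morphism N N') n (x : Q N n) :
  resolution_mor N' n (induced_mor (nu_id R) f n x) = f n (resolution_mor N n x).
Proof.
move: n x; apply: (mor_cell_eq (X := resolution_system N)
  (f := dgm_comp (resolution_mor N') (induced_mor _ f))
  (g := dgm_comp f (resolution_mor N))) => j c.
rewrite -[LHS]/(resolution_mor N' _ (induced_mor (nu_id R) f _ _)) induced_mor_el.
rewrite -[RHS]/(f _ (resolution_mor N _ _)) !resolution_mor_el.
exact: rcell_val_map.
Qed.

Lemma ind_counit_natural M M' (f : dgm_morphism M M') n (x : G (restr phi M) n) :
  ind_counit M' n (induced_mor phi (restr_mor phi f) n x) = f n (ind_counit M n x).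
Proof.
move: n x; apply: (mor_cell_eq (X := resolution_system _)
  (f := dgm_comp (ind_counit M') (induced_mor phi (restr_mor phi f)))
  (g := dgm_comp f (ind_counit M))) => j c.
rewrite -[LHS]/(ind_counit M' _ (induced_mor phi (restr_mor phi f) _ _)) induced_mor_el.
rewrite -[RHS]/(f _ (ind_counit M _ _)) /ind_counit.
rewrite (adjoint_el (X := resolution_system _)) [X in f _ X](adjoint_el (X := resolution_system _)).
rewrite !resolution_mor_el.
by rewrite /gcell_val /= rcell_val_map.
Qed.

Hypothesis phi_qis : corner_quasi_iso phi.

Lemma ind_unit_qis N : dgm_quasi_iso (ind_unit N).
Proof. exact: unit_mor_qis. Qed.

(** By the triangle identity the composite with the unit, which is a
    quasi-isomorphism, is the resolution of [eM]. *)
Lemma restr_counit_qis M : dgm_quasi_iso (restr_mor phi (ind_counit M)).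
Proof.
apply: qis_cancel_right (ind_unit_qis (restr phi M)) _.
apply: qis_ext (resolution_mor_qis (restr phi M)) => n x.
apply: val_inj; symmetry.
exact: (adjoint_unit (resolution_mor (restr phi M)) x).
Qed.

Lemma counit_cone_unit_acyclic M : unit_acyclic phi (cone (ind_counit M)).
Proof. by apply: unit_acyclic_cone; exact: restr_counit_qis. Qed.

Lemma induced_hom_acyclic N Y : unit_acyclic phi Y -> hom_acyclic (G N) Y.
Proof. exact: semifree_hom_acyclic. Qed.

Lemma induced_K_projective N : K_projective (G N).
Proof. exact: semifree_K_projective. Qed.

(** The cone [C] of the induced map satisfies that [eC] is acyclic, since [e] turns
    the map back into [f] up to quasi-isomorphism; but every map from an induced
    module to such a [C] is null-homotopic. *)
Lemma induced_qis N N' (f : dgm_morphism N N') :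
  dgm_quasi_iso f -> dgm_quasi_iso (induced_mor phi f).
Proof.
move=> qf.
have Ca : unit_acyclic phi (cone (induced_mor phi f)).
  apply: unit_acyclic_cone; apply: qis_cancel_right (ind_unit_qis N) _.
  have qQf : dgm_quasi_iso (induced_mor (nu_id R) f).
    apply: (qis_cancel_left (resolution_mor_qis N')).
    apply: qis_ext (qis_comp qf (resolution_mor_qis N)) => n x.
    by rewrite -[LHS]/(f _ (resolution_mor N _ x)) -resolution_mor_natural.
  apply: qis_ext (qis_comp (ind_unit_qis N') qQf) => n x.
  by rewrite -[LHS]/(ind_unit N' _ (induced_mor _ _ _ x)) ind_unit_natural.
exact: (qis_of_hom_acyclic_cone (@induced_K_projective N) (qis_id (A := B) (G N'))
  (induced_hom_acyclic Ca) (induced_hom_acyclic Ca)).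
Qed.

Lemma induced_torsion N : torsion (done1 B - nu_unit phi) (G N).
Proof.
move=> Y /local_unit_acyclic Ya; exists (G N), (dgm_id _); split.
- exact: induced_K_projective.
- exact: qis_id.
- exact: induced_hom_acyclic.
Qed.

(** The cone of the counit is local, so a torsion module has no maps to it. *)
Lemma torsion_counit_qis M :
  torsion (done1 B - nu_unit phi) M -> dgm_quasi_iso (ind_counit M).
Proof.
have Ca := @counit_cone_unit_acyclic M.
move=> /(_ _ (unit_acyclic_local Ca))[P [r [KP qr PC]]].
exact: (qis_of_hom_acyclic_cone (@induced_K_projective _) qr PC
  (induced_hom_acyclic Ca)).
Qed.
End UnitCounit.

(** * Transport of torsion along quasi-isomorphisms *)

Section LocalModules.
Variables (k : comPzRingType) (A : dgalgebra k).
Implicit Types M N : dgmodule A.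

Lemma act_cycle M i j n (p : i + j = n) (s : A i) (x : M j) :
  is_cycle s -> is_cycle x -> is_cycle (act p s x).
Proof.
move=> zs zx n' q.
have e1 : i - 1 + j = n' by lia.
have e2 : i + (j - 1) = n' by lia.
have e3 : i = i - 1 + 1 by lia.
have e4 : j = j - 1 + 1 by lia.
by rewrite (act_leibniz p e1 e2 e3 e4 q) zs zx act0l act0r ksign0 addr0.
Qed.

Lemma act_boundary M i j n (p : i + j = n) (s : A i) (x : M j) :
  is_cycle s -> is_boundary x -> is_boundary (act p s x).
Proof.
move=> zs /(boundaryE erefl)[y <-].
have e1 : i + (j + 1) = n + 1 by lia.
have e2 : i - 1 + (j + 1) = n by lia.
have e3 : i = i - 1 + 1 by lia.
exists (n + 1), erefl, (act e1 (ksign i s) y).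
by rewrite act_ksignl diff_ksign (act_leibniz e1 e2 p e3 erefl erefl) zs act0l add0r ksignK.
Qed.

(** [(d t) x = d (t x)] when [d x = 0]. *)
Lemma act_boundary_left M i j n (p : i + j = n) (s : A i) (x : M j) :
  is_boundary s -> is_cycle x -> is_boundary (act p s x).
Proof.
move=> /(boundaryE erefl)[t <-] zx.
have e1 : i + 1 + j = n + 1 by lia.
have e2 : i + 1 + (j - 1) = n by lia.
have e3 : j = j - 1 + 1 by lia.
exists (n + 1), erefl, (act e1 t x).
by rewrite (act_leibniz e1 p e2 erefl e3 erefl) zx act0r ksign0 addr0.
Qed.

Lemma homology_bijective_ext (C D : dgcomplex k) i j (g g' : C i -> D j) :
  (forall x, is_cycle x -> homologous (g x) (g' x)) ->
  homology_bijective g -> homology_bijective g'.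
Proof.
move=> gg' [ig sg]; split=> [x zx bx|y zy].
  by apply: ig => //; apply: homologous_boundary bx; exact/homologous_sym/gg'.
have [x zx gx] := sg y zy; exists x => //.
by apply: homologous_trans gx; exact/homologous_sym/gg'.
Qed.

Lemma local_homologous M i (s s' : A i) : homologous s s' -> local s M -> local s' M.
Proof.
move=> ss' Ml j n p; apply: homology_bijective_ext (Ml j n p) => x zx.
by rewrite /homologous -actBl; exact: act_boundary_left.
Qed.

(** Being [s]-local is a property of [H(M)] with its action of the class of [s]. *)
Lemma local_qis M N (g : dgm_morphism M N) i (s : A i) :
  is_cycle s -> dgm_quasi_iso g -> local s M <-> local s N.
Proof.
move=> zs qg; split=> l j n p; have [inj surj] := l j n p.
- split=> [y zy bsy|z zz].
    have [x zx gxy] := proj2 (qg _) y zy.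
    apply: (homologous_boundary gxy); apply: mor_boundary; apply: inj => //.
    apply: (proj1 (qg _)); first exact: act_cycle.
    rewrite dgmf_act; apply: homologous_boundary bsy.
    by rewrite /homologous -actBr; apply: act_boundary => //; exact/homologous_sym.
  have [x zx gxz] := proj2 (qg _) z zz; have [x' zx' sx'x] := surj x zx.
  exists (g _ x'); first exact: mor_cycle.
  by rewrite -dgmf_act; apply: homologous_trans gxz; exact: mor_homologous.
- split=> [x zx bsx|x zx].
    apply: (proj1 (qg _)) => //; apply: inj; first exact: mor_cycle.
    by rewrite -dgmf_act; exact: mor_boundary.
  have [y zy syx] := surj _ (mor_cycle g zx); have [x' zx' gx'y] := proj2 (qg _) y zy.
  exists x' => //; apply: (proj1 (qg _)).
    by apply: cycleB => //; exact: act_cycle.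
  rewrite morB dgmf_act; apply: homologous_trans syx.
  by rewrite /homologous -actBr; exact: act_boundary.
Qed.
End LocalModules.

Section Transfer.
Variables (k : comPzRingType) (A B : dgalgebra k) (f : dga_morphism A B).
Hypothesis qf : dga_quasi_iso f.
Variables (a : A 0) (b : B 0).
Hypotheses (za : is_cycle a) (zb : is_cycle b) (fab : homologous (f 0 a) b).

Definition nu_of_dga : nonunital_morphism A B :=
  NonunitalMorphism (@dgaf_linear _ _ _ f) (@dgaf_diff _ _ _ f) (@dgaf_mul _ _ _ f).
Notation phi := nu_of_dga.

Lemma nu_of_dga_unit : nu_unit phi = done1 B.
Proof. exact: dgaf_one. Qed.

Lemma nu_of_dga_corner_qis : corner_quasi_iso phi.
Proof.
split=> [n r|n y zy _ _]; first exact: (proj1 (qf n)).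
exact: (proj2 (qf n)).
Qed.

(** [a] acts on [H(M)] through [f a], which is homologous to [b]. *)
Lemma local_restr (M : dgmodule B) :
  local (done1 B - b) M <-> local (done1 A - a) (restr phi M).
Proof.
have hs : homologous (phi 0 (done1 A - a)) (done1 B - b).
  have -> : phi 0 (done1 A - a) = done1 B - f 0 a.
    by rewrite nufB -[phi 0 (done1 A)]/(nu_unit phi) nu_of_dga_unit.
  by rewrite /homologous opprB addrC addrA subrK; exact: homologous_sym.
have val_in j (x : M j) : x \in @restr_pred _ _ _ phi M j.
  by apply/(restrP phi (add0r j)); rewrite nu_of_dga_unit act1.
pose s := phi 0 (done1 A - a).
transitivity (local s M).
  by split; apply: local_homologous => //; exact: homologous_sym.
split=> Ml j n p; have [inj surj] := Ml j n p; split.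
- by move=> x /restr_cycle zx /restr_boundary bx; apply/restr_boundary; exact: inj.
- move=> y /restr_cycle zy; have [x zx xy] := surj _ zy.
  exists (Restr (val_in j x)); first exact/restr_cycle.
  exact/restr_homologous.
- move=> x zx bx; apply/(restr_boundary (Restr (val_in j x))); apply: inj.
    exact/restr_cycle.
  exact/restr_boundary.
- move=> y zy; have [|x /restr_cycle zx /restr_homologous xy] := surj (Restr (val_in n y)).
    exact/restr_cycle.
  by exists (restr_val x).
Qed.

(** Here [e = 1], so that acyclicity of [e] times the cone of the counit is
    acyclicity of the cone. *)
Lemma counit_qis (M : dgmodule B) : dgm_quasi_iso (ind_counit phi M).
Proof.
have Ca := counit_cone_unit_acyclic nu_of_dga_corner_qis (M := M).
have CA : acyclic (cone (ind_counit phi M)).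
  by move=> n x zx; apply: Ca => //; rewrite nu_of_dga_unit act1.
have KP : K_projective (induced (nu_id B) M) by exact: semifree_K_projective.
exact: (qis_of_hom_acyclic_cone (induced_K_projective (phi := phi) (N := restr phi M))
  (resolution_mor_qis M) (KP _ CA) (induced_hom_acyclic Ca)).
Qed.

Lemma one_sub_cycle : is_cycle (done1 A - a).
Proof. by apply: cycleB => //; exact: one_cycle. Qed.

(** [RHom(Be (x) QN, Y) = RHom(N, restr Y)], and restriction preserves locality. *)
Lemma torsion_induced (N : dgmodule A) :
  torsion (done1 A - a) N -> torsion (done1 B - b) (induced phi N).
Proof.
move=> Nt Y /local_restr /Nt Ya.
exists (induced phi N), (dgm_id _); split.
- exact: induced_K_projective.
- exact: qis_id.
- apply/hom_acyclic_adj; apply: (RHom_acyclicE _ (resolution_mor_qis N)) Ya.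
  exact: semifree_K_projective.
Qed.

(** A local [A]-module [Y] is quasi-isomorphic to the restriction of the local
    [B]-module [induced Y], and the module [M] to the module induced from its
    restriction; so [RHom(restr M, Y)] is [RHom(M, induced Y)]. *)
Lemma torsion_restr (M : dgmodule B) :
  torsion (done1 B - b) M -> torsion (done1 A - a) (restr phi M).
Proof.
move=> Mt Y Yl.
have KQ (N : dgmodule A) : K_projective (induced (nu_id A) N) by exact: semifree_K_projective.
have GYl : local (done1 B - b) (induced phi Y).
  apply/local_restr/(local_qis one_sub_cycle (ind_unit_qis nu_of_dga_corner_qis Y)).
  exact/(local_qis one_sub_cycle (resolution_mor_qis Y)).
have := RHom_acyclicE (induced_K_projective (phi := phi) (N := restr phi M))
  (counit_qis M) (Mt _ GYl).
move=> /hom_acyclic_adj Ha.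
exists (induced (nu_id A) (restr phi M)), (resolution_mor _); split.
- exact: KQ.
- exact: resolution_mor_qis.
- apply: (hom_acyclic_forward (K_projective_cone (KQ _) (resolution_mor_qis Y))).
  exact: (hom_acyclic_backward
    (K_projective_cone (KQ _) (ind_unit_qis nu_of_dga_corner_qis Y))).
Qed.
End Transfer.

(** * The equivalences *)

Section MoritaEquivalence.
Variables (k : comPzRingType) (R B : dgalgebra k) (phi : nonunital_morphism R B).
Hypothesis phi_qis : corner_quasi_iso phi.

(** The predicates [P] and [P'] allow for torsion conditions on both sides.  They
    constrain the counit alone, since the unit is always a quasi-isomorphism. *)
Lemma restriction_equivalence (P : dgmodule B -> Prop) (P' : dgmodule R -> Prop) :
  (forall M, P M -> P' (restr phi M)) ->
  (forall N, P' N -> P (induced phi N)) ->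
  (forall M, P M -> dgm_quasi_iso (ind_counit phi M)) ->
  equivalent (@full_subcategory (Ho B) P) (@full_subcategory (Ho R) P').
Proof.
move=> FP GP counitW.
apply: (@localized_equivalence (dgMod B) (dgMod R) _ _ (restr_functor phi)
  (induction_functor phi) (fun M N f => @restr_qis _ _ _ phi M N f)
  (fun M N f => @induced_qis _ _ _ phi phi_qis M N f) P P' FP GP
  (ind_counit phi) (fun M N f => @ind_counit_natural _ _ _ phi M N f) counitW
  (fun N => induced (nu_id R) N) (fun N N' f => induced_mor (nu_id R) f)
  (ind_unit phi) (fun N => resolution_mor N)).
- by move=> N N' f n x; exact: ind_unit_natural.
- by move=> N N' f n x; exact: resolution_mor_natural.
- by move=> N; exact: ind_unit_qis.
- by move=> N; exact: resolution_mor_qis.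
Qed.
End MoritaEquivalence.

Section CornerInclusion.
Variables (k : comPzRingType) (B : dgalgebra k) (e : B 0).
Hypotheses (ze : is_cycle e) (ee : dmul (addr0 0) e e = e).

Definition corner_inclusion : nonunital_morphism (corner ze ee) B :=
  @NonunitalMorphism _ (corner ze ee) B (fun n x => corner_val x)
    (fun _ _ _ _ => erefl) (fun _ _ _ _ => erefl) (fun _ _ _ _ _ _ => erefl).

(** [eBe] is the image of the retraction [b |-> e b e] of the complex [B]. *)
Lemma corner_inclusion_qis : corner_quasi_iso corner_inclusion.
Proof.
split=> [n r _ /(boundaryE erefl)[y dy]|n b zb eb be].
  have yin : sandwich e y \in @corner_pred _ _ e (n + 1) by apply/(cornerP ee); exists y.
  exists (n + 1), erefl, (Corner yin : corner ze ee (n + 1)); apply: val_inj => /=.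
  rewrite /sandwich (diff_mul_unit corner_inclusion) (diff_unit_mul corner_inclusion) dy.
  by rewrite /= (corner_fixl ee) (corner_fixr ee).
have bin : b \in @corner_pred _ _ e n by exact: corner_in eb be.
exists (Corner bin : corner ze ee n); last exact: homologous_refl.
by move=> m p; apply: val_inj; exact: zb.
Qed.

Lemma torsion_corner_equivalence :
  equivalent (@full_subcategory (Ho B) (fun M : dgmodule B => torsion (done1 B - e) M))
    (Ho (corner ze ee)).
Proof.
apply: equivalent_trans (equivalent_full_True (P := fun _ : Ho (corner ze ee) => True) _) => //.
apply: (restriction_equivalence corner_inclusion_qis) => // [N _|M Mt].
- exact: (@induced_torsion _ _ _ corner_inclusion N).
- exact: (torsion_counit_qis corner_inclusion_qis Mt).
Qed.
End CornerInclusion.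

(** Each step of the zigzag is an equivalence by restriction along it. *)
Lemma torsion_qis_equivalence (k : comPzRingType) (A B : dgalgebra k) (a : A 0) (b : B 0) :
  dga_quasi_isomorphic a b ->
  equivalent (@full_subcategory (Ho A) (fun M : dgmodule A => torsion (done1 A - a) M))
    (@full_subcategory (Ho B) (fun M : dgmodule B => torsion (done1 B - b) M)).
Proof.
elim=> {A B a b} [A B f a b qf za zb fab|A B a b _|A B C a b c _ AB _ BC].
- apply: equivalent_sym.
  apply: (restriction_equivalence (nu_of_dga_corner_qis qf)) => [M|N|M _].
  + exact: (torsion_restr qf za fab).
  + exact: (torsion_induced fab).
  + exact: counit_qis.
- exact: equivalent_sym.
- exact: equivalent_trans AB BC.
Qed.

Theorem proposition9p4 (k : comPzRingType) (A : dgalgebra k) (e : A 0)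
    (e_cycle : is_cycle e) (e_idem : homologous (dmul (addr0 0) e e) e)
    (S : strict_model e) :
  equivalent
    (@full_subcategory (Ho A) (fun M : dgmodule A => torsion (done1 A - e) M))
    (Ho (eAe S)).
Proof.
apply: equivalent_trans (torsion_qis_equivalence (sm_qis S)) _.
exact: torsion_corner_equivalence.
Qed.
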